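(* Let $\mathbb{F}$ be a field and let $A=\bigoplus_{n\in\mathbb{N}}A_n$ be a strong tower of algebras over $\mathbb{F}$ with conjugation $\Psi$. Then for all $M,N\in A\text{-mod}$ and $P,Q\in A\text{-pmod}$ there are isomorphisms of functors $A\text{-mod}\to A\text{-mod}$: $$\mathrm{Ind}_M\circ\mathrm{Ind}_N\cong\mathrm{Ind}_{\nabla(M\otimes N)},$$ $$\mathrm{Res}_P\circ\mathrm{Res}_Q\cong\mathrm{Res}_{\nabla(P\otimes Q)},$$ $$\mathrm{Res}_P\circ\mathrm{Ind}_M\cong\nabla\,\mathrm{Res}_{\Psi^{\otimes2}\Delta\Psi^{-1}(P)}(M\otimes-).$$ In particular, if $A$ is dualizing, then these functors and isomorphisms yield a categorification of the lowest weight Fock space representations of $\mathfrak{h}(A)$ and of $\mathfrak{h}_{\mathrm{proj}}(A)$ (in the sense recalled in the context).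
   Context: Towers. $B\text{-mod}$ (resp. $B\text{-pmod}$) is the category of finitely generated (resp. finitely generated projective) left $B$-modules; $G_0(B)$ is the Grothendieck group of the abelian category $B\text{-mod}$, $K_0(B)$ the split Grothendieck group of $B\text{-pmod}$. A tower of algebras is a graded $\mathbb{F}$-algebra $A=\bigoplus_{n\in\mathbb{N}}A_n$ with multiplication $\rho$ such that: (TA1) each $A_n$ is itself a finite dimensional unital algebra (with a different multiplication) with unit $1_n$, and $A_0\cong\mathbb{F}$; (TA2) $\rho_{m,n}\colon A_m\otimes A_n\to A_{m+n}$ is a unital algebra homomorphism for all $m,n$; (TA3) $A_{m+n}$ is projective as a left and as a right $(A_m\otimes A_n)$-module via $\rho_{m,n}$; (TA4) the pairing $K_0(A_n)\times G_0(A_n)\to\mathbb{Z}$, $\langle[P],[M]\rangle=\dim_\mathbb{F}\mathrm{Hom}_{A_n}(P,M)$, is perfect for each $n$. $A\text{-mod}=\bigoplus_nA_n\text{-mod}$, $A\text{-mod}^{\otimes r}=\bigoplus_{n_1,\dots,n_r}(A_{n_1}\otimes\dots\otimes A_{n_r})\text{-mod}$, and similarly for pmod. $S_{ij}$ is the endofunctor of $A\text{-mod}^{\otimes r}$ interchanging the $i$th and $j$th factors. $\nabla\colon A\text{-mod}^{\otimes2}\to A\text{-mod}$ is $\mathrm{Ind}^{A_{m+n}}_{A_m\otimes A_n}=A_{m+n}\otimes_{A_m\otimes A_n}-$ on $(A_m\otimes A_n)\text{-mod}$; $\Delta\colon A\text{-mod}\to A\text{-mod}^{\otimes2}$ is $\bigoplus_{k+\ell=n}\mathrm{Res}^{A_n}_{A_k\otimes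 A_\ell}$ on $A_n\text{-mod}$ (restriction along $\rho_{k,\ell}$). Both restrict to projectives. Algebra automorphisms $\psi_n$ of $A_n$ give, by twisting the action, an automorphism $\Psi$ of the categories $A\text{-mod}$ and $A\text{-pmod}$. $A$ is strong with conjugation $\Psi$ if for some such $\psi_n$ the functor $\nabla$ is right adjoint to $\Psi^{\otimes2}\Delta\Psi^{-1}$, and there is an isomorphism of functors $\Delta\nabla\cong\nabla^{\otimes2}S_{23}\Delta^{\otimes2}$. Functors. For $M\in A_m\text{-mod}$, $\mathrm{Ind}_M(N)=\mathrm{Ind}^{A_{m+n}}_{A_m\otimes A_n}(M\otimes N)$ for $N\in A_n\text{-mod}$. For $P\in A_p\text{-pmod}$, $\mathrm{Res}_P(N)=\mathrm{Hom}_{A_p}(P,\mathrm{Res}^{A_n}_{A_{n-p}\otimes A_p}N)\in A_{n-p}\text{-mod}$ for $N\in A_n\text{-mod}$, with $A_{n-p}$ acting by $(a\cdot f)(b)=(a\otimes1)f(b)$; it is $0$ if $n<p$. For $Q\in(A_p\otimes A_q)\text{-pmod}$, $M\in A_m\text{-mod}$, $N\in A_n\text{-mod}$, $$\mathrm{Res}_Q(M\otimes N)=\mathrm{Hom}_{A_p\otimes A_q}\bigl(Q,S_{23}(\mathrm{Res}^{A_m}_{A_{m-p}\otimes A_p}M\otimes\mathrm{Res}^{A_n}_{A_{n-q}\otimes A_q}N)\bigr)\in(A_{m-p}\otimes A_{n-q})\text{-mod}$$ ($0$ if $m<p$ or $n<q$). All these are extended additively to direct sums in the subscripts and arguments. Dualizing,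 Heisenberg doubles, categorification. $\mathcal{G}(A)=\bigoplus_nG_0(A_n)$ and $\mathcal{K}(A)=\bigoplus_nK_0(A_n)$ carry the operations induced by $\nabla$, $\Delta$, and the unit and counit coming from $A_0\text{-mod}\cong\mathrm{Vect}$. $A$ is dualizing if these make $\mathcal{K}(A)$, $\mathcal{G}(A)$ Hopf algebras over $\mathbb{Z}$, graded dual to each other via the pairing $\langle[P],[M]\rangle=\dim\mathrm{Hom}_{A_n}(P,M)$ ($0$ in different degrees), i.e. this pairing is a Hopf pairing. Then $\mathfrak{h}(A)$ is the Heisenberg double: $\mathcal{G}(A)\otimes\mathcal{K}(A)$ with product $(a\# x)(b\# y)=\sum_{(x)}a\,{}^Rx_{(1)}^*(b)\# x_{(2)}y$, where $\langle y,{}^Rx^*(a)\rangle=\langle yx,a\rangle$. It acts on $\mathcal{F}(A)=\mathcal{G}(A)$ (lowest weight Fock space) by $(a\# x)(b)=a\,{}^Rx^*(b)$. $\mathcal{G}_{\mathrm{proj}}(A)$ is the image of the Cartan map $\mathcal{K}(A)\to\mathcal{G}(A)$, $[P]\mapsto[P]$; $\mathfrak{h}_{\mathrm{proj}}(A)=\mathcal{G}_{\mathrm{proj}}(A)\#\mathcal{K}(A)\subseteq\mathfrak{h}(A)$ acts on its lowest weight Fock space $\mathcal{F}_{\mathrm{proj}}(A)=\mathcal{G}_{\mathrm{proj}}(A)$. ''Categorification'' means: the exact functors $\mathrm{Ind}_M$, $\mathrm{Res}_P$ induce on $\mathcal{G}(A)$ the actions of $[M]\in\mathcal{G}(A)$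 and $[P]\in\mathcal{K}(A)$ in $\mathcal{F}(A)$, and the three isomorphisms of functors induce, respectively, the multiplication in $\mathcal{G}(A)$, the multiplication in $\mathcal{K}(A)$, and the relation $xa=\sum_{(x)}{}^Rx_{(1)}^*(a)x_{(2)}$ ($x\in\mathcal{K}(A)$, $a\in\mathcal{G}(A)$) as operators on $\mathcal{G}(A)$; for $\mathfrak{h}_{\mathrm{proj}}(A)$ the same holds with all functors restricted to $A\text{-pmod}$ and $M,N\in A\text{-pmod}$. *)

(* Defs.v *)
Set Warnings "-notation-overridden,-ambiguous-paths,-notation-incompatible-prefix".
From HB Require Import structures.
From mathcomp Require Import all_boot all_order all_algebra.
From mathcomp Require Import boolp classical_sets functions cardinality fsbigop.

Set Warnings "-redundant-canonical-projection".

Set Implicit Arguments.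
Unset Strict Implicit.
Unset Printing Implicit Defensive.

Import GRing.Theory.
Local Open Scope ring_scope.
Local Open Scope quotient_scope.

(* Abelian groups presented by generators [T] and relators [R].  A word is a
   list of signed generators ([true] for +).  Two words are identified when
   they have the same value under every map from [T] to an abelian group that
   kills the relators. *)
Section Presentation.
Variable T : choiceType.

Definition wval (Z : zmodType) (f : T -> Z) (w : seq (bool * T)) : Z :=
  \sum_(x <- w) (if x.1 then f x.2 else - f x.2).

Variable R : seq (bool * T) -> Prop.

Definition kills (Z : zmodType) (f : T -> Z) : Prop :=
  forall w, R w -> wval f w = 0.

Definition weq : rel (seq (bool * T)) := fun w w' =>
  `[< forall (Z : zmodType) (f : T -> Z), kills f -> wval f w = wval f w' >].

Lemma weq_refl : reflexive weq.
Proof. by move=> w; apply/asboolP. Qed.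
Lemma weq_sym : symmetric weq.
Proof. by move=> w w'; apply/asboolP/asboolP => h Z f kf; rewrite h. Qed.
Lemma weq_trans : transitive weq.
Proof.
by move=> b a c /asboolP h1 /asboolP h2; apply/asboolP => Z f kf; rewrite h1 ?h2.
Qed.
Canonical weq_equiv := EquivRel weq weq_refl weq_sym weq_trans.

Definition pres : Type := {eq_quot weq_equiv}.
HB.instance Definition _ : EqQuotient _ weq_equiv pres := EqQuotient.on pres.
HB.instance Definition _ := Choice.on pres.

Definition wopp (w : seq (bool * T)) := [seq (~~ x.1, x.2) | x <- w].

Lemma wval_cat (Z : zmodType) (f : T -> Z) w w' :
  wval f (w ++ w') = wval f w + wval f w'.
Proof. by rewrite /wval big_cat. Qed.
Lemma wval_opp (Z : zmodType) (f : T -> Z) w : wval f (wopp w) = - wval f w.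
Proof.
rewrite /wval big_map -sumrN; apply: eq_bigr => -[[] t] _ //=.
by rewrite opprK.
Qed.

Definition pres_add (x y : pres) : pres := \pi_pres (repr x ++ repr y).
Definition pres_opp (x : pres) : pres := \pi_pres (wopp (repr x)).
Definition pres_zero : pres := \pi_pres [::].
Definition pgen (t : T) : pres := \pi_pres [:: (true, t)].

(* The map out of the presented group given by [f] on generators; it is
   additive as soon as [f] kills the relators. *)
Definition plift (Z : zmodType) (f : T -> Z) (x : pres) : Z := wval f (repr x).

Lemma plift_pi (Z : zmodType) (f : T -> Z) w : kills f ->
  plift f (\pi_pres w) = wval f w.
Proof.
move=> kf; have /eqmodP/asboolP : repr (\pi_pres w) = w %[mod pres].
  by rewrite reprK.
exact.
Qed.

Lemma pres_eqP (x y : pres) :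
  (forall (Z : zmodType) (f : T -> Z), kills f -> plift f x = plift f y) ->
  x = y.
Proof.
elim/quotW: x => w; elim/quotW: y => w' h.
by apply/eqmodP/asboolP => Z f kf; rewrite -!plift_pi ?h.
Qed.

Lemma pliftD0 (Z : zmodType) (f : T -> Z) : kills f ->
  forall x y, plift f (pres_add x y) = plift f x + plift f y.
Proof. by move=> kf x y; rewrite plift_pi // wval_cat. Qed.
Lemma pliftN0 (Z : zmodType) (f : T -> Z) : kills f ->
  forall x, plift f (pres_opp x) = - plift f x.
Proof. by move=> kf x; rewrite plift_pi // wval_opp. Qed.
Lemma plift00 (Z : zmodType) (f : T -> Z) : kills f -> plift f pres_zero = 0.
Proof. by move=> kf; rewrite plift_pi // /wval big_nil. Qed.

Lemma pres_addA : associative pres_add.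
Proof. by move=> x y z; apply: pres_eqP => Z f kf; rewrite !pliftD0 ?addrA. Qed.
Lemma pres_addC : commutative pres_add.
Proof. by move=> x y; apply: pres_eqP => Z f kf; rewrite !pliftD0 // addrC. Qed.
Lemma pres_add0 : left_id pres_zero pres_add.
Proof.
by move=> x; apply: pres_eqP => Z f kf; rewrite pliftD0 // plift00 // add0r.
Qed.
Lemma pres_addN : left_inverse pres_zero pres_opp pres_add.
Proof.
move=> x; apply: pres_eqP => Z f kf.
by rewrite pliftD0 // pliftN0 // plift00 // addNr.
Qed.
HB.instance Definition _ :=
  GRing.isZmodule.Build pres pres_addA pres_addC pres_add0 pres_addN.

Section Lift.
Variables (Z : zmodType) (f : T -> Z).
Hypothesis kf : kills f.
Lemma pliftD x y : plift f (x + y) = plift f x + plift f y.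
Proof. exact: pliftD0. Qed.
Lemma pliftN x : plift f (- x) = - plift f x.
Proof. exact: pliftN0. Qed.
Lemma plift0 : plift f 0 = 0.
Proof. exact: plift00. Qed.
Lemma plift_gen t : plift f (pgen t) = f t.
Proof. by rewrite plift_pi // /wval big_seq1. Qed.
End Lift.

Lemma pi_wval w : \pi_pres w = wval pgen w.
Proof.
apply: pres_eqP => Z f kf; rewrite plift_pi // /wval.
elim: w => [|[b t] w IH]; first by rewrite !big_nil plift0.
rewrite !big_cons pliftD // -IH; congr (_ + _); case: b => /=.
  by rewrite plift_gen.
by rewrite pliftN // plift_gen.
Qed.

Lemma pgen_kills : kills pgen.
Proof.
move=> w Rw; rewrite -pi_wval; apply: pres_eqP => Z f kf.
by rewrite plift_pi // kf // plift0.
Qed.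

Lemma pres_ind (P : pres -> Prop) :
  P 0 -> (forall x y, P x -> P y -> P (x + y)) -> (forall x, P x -> P (- x)) ->
  (forall t, P (pgen t)) -> forall x, P x.
Proof.
move=> P0 PD PN Pg; elim/quotW => w; rewrite pi_wval /wval.
elim: w => [|[b t] w IH]; rewrite ?big_nil ?big_cons //=.
by apply: PD => //; case: b => //; apply: PN.
Qed.

End Presentation.

(* The tensor product over scalars [S], acting on the right of [M] by [ra] and
   on the left of [N] by [la]. *)
Section Tensor.
Variables (S : Type) (M N : zmodType) (ra : M -> S -> M) (la : S -> N -> N).

Inductive tens_rel : seq (bool * (M * N)) -> Prop :=
| TensDl m m' n :
    tens_rel [:: (true, (m + m', n)); (false, (m, n)); (false, (m', n))]
| TensDr m n n' :
    tens_rel [:: (true, (m, n + n')); (false, (m, n)); (false, (m, n'))]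
| TensS m s n : tens_rel [:: (true, (ra m s, n)); (false, (m, la s n))].

Definition tens : Type := pres tens_rel.
HB.instance Definition _ := GRing.Zmodule.on tens.

Definition tpure (m : M) (n : N) : tens := pgen tens_rel (m, n).
Definition tlift (Z : zmodType) (f : M -> N -> Z) : tens -> Z :=
  plift (R := tens_rel) (fun p => f p.1 p.2).

Definition balanced (Z : zmodType) (f : M -> N -> Z) : Prop :=
  [/\ forall m m' n, f (m + m') n = f m n + f m' n,
      forall m n n', f m (n + n') = f m n + f m n' &
      forall m s n, f (ra m s) n = f m (la s n)].

Lemma tens_kills (Z : zmodType) (f : M -> N -> Z) :
  balanced f -> kills tens_rel (fun p => f p.1 p.2).
Proof.
move=> [fl fr fs] w; case=> [m m' n|m n n'|m s n];
  rewrite /wval !big_cons big_nil /= addr0.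
- by rewrite fl -opprD subrr.
- by rewrite fr -opprD subrr.
- by rewrite fs subrr.
Qed.

Lemma tpure_balanced : balanced tpure.
Proof.
have K := @pgen_kills _ tens_rel.
split=> [m m' n|m n n'|m s n]; apply/eqP; rewrite -subr_eq0; apply/eqP.
- by have := K _ (TensDl m m' n); rewrite /wval !big_cons big_nil /= addr0 opprD.
- by have := K _ (TensDr m n n'); rewrite /wval !big_cons big_nil /= addr0 opprD.
- by have := K _ (TensS m s n); rewrite /wval !big_cons big_nil /= addr0.
Qed.

Lemma tpureDl m m' n : tpure (m + m') n = tpure m n + tpure m' n.
Proof. by case: tpure_balanced. Qed.
Lemma tpureDr m n n' : tpure m (n + n') = tpure m n + tpure m n'.
Proof. by case: tpure_balanced. Qed.
Lemma tpureS m s n : tpure (ra m s) n = tpure m (la s n).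
Proof. by case: tpure_balanced. Qed.
Lemma tpure0l n : tpure 0 n = 0.
Proof. by apply: (addIr (tpure 0 n)); rewrite -tpureDl !add0r. Qed.
Lemma tpure0r m : tpure m 0 = 0.
Proof. by apply: (addIr (tpure m 0)); rewrite -tpureDr !add0r. Qed.
Lemma tpureNl m n : tpure (- m) n = - tpure m n.
Proof. by apply/eqP; rewrite -addr_eq0 -tpureDl addNr tpure0l. Qed.

Section TLift.
Variables (Z : zmodType) (f : M -> N -> Z).
Hypothesis bf : balanced f.
Lemma tliftD x y : tlift f (x + y) = tlift f x + tlift f y.
Proof. by apply: pliftD; apply: tens_kills. Qed.
Lemma tliftN x : tlift f (- x) = - tlift f x.
Proof. by apply: pliftN; apply: tens_kills. Qed.
Lemma tlift0 : tlift f 0 = 0.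
Proof. by apply: plift0; apply: tens_kills. Qed.
Lemma tlift_pure m n : tlift f (tpure m n) = f m n.
Proof. by rewrite /tlift plift_gen //; apply: tens_kills. Qed.
End TLift.

Lemma tens_ind (P : tens -> Prop) :
  (forall x y, P x -> P y -> P (x + y)) ->
  (forall m n, P (tpure m n)) -> forall x, P x.
Proof.
move=> PD Pp x.
have P0 : P 0 by rewrite -(tpure0l 0); apply: Pp.
suff : P x /\ P (- x) by case.
elim/pres_ind: x => [|x y [h1 h2] [h3 h4]|x [h1 h2]|[m n]]; first by rewrite oppr0.
- by rewrite opprD; split; apply: PD.
- by rewrite opprK.
- by split; [exact: Pp | rewrite -[- _]tpureNl; exact: Pp].
Qed.

Lemma tens_addE (Z : zmodType) (g h : tens -> Z) :
  {morph g : x y / x + y} -> {morph h : x y / x + y} ->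
  (forall m n, g (tpure m n) = h (tpure m n)) -> g =1 h.
Proof.
move=> gD hD e; elim/tens_ind => [x y ex ey|m n]; last exact: e.
by rewrite gD hD ex ey.
Qed.

End Tensor.

Definition tmap S S' (M N M' N' : zmodType) (ra : M -> S -> M) (la : S -> N -> N)
    (ra' : M' -> S' -> M') (la' : S' -> N' -> N') (f : M -> M') (g : N -> N') :
  tens ra la -> tens ra' la' :=
  tlift (fun m n => tpure ra' la' (f m) (g n)).

Section TMap.
Variables (S S' : Type) (M N M' N' : zmodType).
Variables (ra : M -> S -> M) (la : S -> N -> N).
Variables (ra' : M' -> S' -> M') (la' : S' -> N' -> N') (f : M -> M') (g : N -> N').
Hypotheses (fD : {morph f : x y / x + y}) (gD : {morph g : x y / x + y}).
Hypothesis fgS : forall m s n,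
  tpure ra' la' (f (ra m s)) (g n) = tpure ra' la' (f m) (g (la s n)).

Lemma tmap_balanced :
  balanced ra la (fun m n => tpure ra' la' (f m) (g n)).
Proof.
by split=> *; rewrite ?fD ?gD ?tpureDl ?tpureDr ?fgS.
Qed.
Lemma tmapD (x y : tens ra la) :
  tmap ra' la' f g (x + y) = tmap ra' la' f g x + tmap ra' la' f g y.
Proof. exact/tliftD/tmap_balanced. Qed.
Lemma tmap_pure m n :
  tmap ra' la' f g (tpure ra la m n) = tpure ra' la' (f m) (g n).
Proof. exact/tlift_pure/tmap_balanced. Qed.
End TMap.

Definition tensZ (M N : zmodType) : Type :=
  tens (fun (m : M) (z : int) => m *~ z) (fun z (n : N) => n *~ z).
HB.instance Definition _ M N := GRing.Zmodule.on (tensZ M N).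
Definition purez (M N : zmodType) (m : M) (n : N) : tensZ M N := tpure _ _ m n.
Definition zlift (M N Z : zmodType) (f : M -> N -> Z) : tensZ M N -> Z := tlift f.

Definition fgen (R : pzRingType) (M : lmodType R) : Prop :=
  exists (n : nat) (s : 'I_n -> M), forall m, exists c : 'I_n -> R,
    m = \sum_i c i *: s i.

Definition res (R S : pzRingType) (f : {rmorphism R -> S}) (M : lmodType S) :
  Type := M.

Section Restriction.
Variables (R S : pzRingType) (f : {rmorphism R -> S}) (M : lmodType S).
Local Notation res := (res f M).
HB.instance Definition _ := GRing.Zmodule.on res.

Definition res_scale (a : R) (m : res) : res := f a *: (m : M).
Lemma res_scaleA a b m : res_scale a (res_scale b m) = res_scale (a * b) m.
Proof. by rewrite /res_scale rmorphM scalerA. Qed.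
Lemma res_scale1 : left_id 1 res_scale.
Proof. by move=> m; rewrite /res_scale rmorph1 scale1r. Qed.
Lemma res_scaleDr : right_distributive res_scale +%R.
Proof. by move=> a m n; rewrite /res_scale [LHS]scalerDr. Qed.
Lemma res_scaleDl m : {morph res_scale^~ m : a b / a + b}.
Proof. by move=> a b; rewrite /res_scale rmorphD [LHS]scalerDl. Qed.
HB.instance Definition _ := GRing.Zmodule_isLmodule.Build R res
  res_scaleA res_scale1 res_scaleDr res_scaleDl.

Lemma res_scaleE (a : R) (m : res) : a *: m = f a *: (m : M) :> M.
Proof. by []. Qed.
End Restriction.

(* A finite dimensional algebra is a ring with a ring morphism [scal] from the
   field into its centre, of finite dimension over the field.  The library's
   [algType] is not used because it excludes the zero algebra. *)
Record fdalg (F : fieldType) := FdAlg {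
  alg_ring :> pzRingType;
  scal : {rmorphism F -> alg_ring};
  scal_central : forall k a, scal k * a = a * scal k;
  alg_fin : fgen (res scal alg_ring^o) }.
Arguments scal {F} _.

Record alghom (F : fieldType) (B C : fdalg F) := AlgHom {
  ahom :> {rmorphism B -> C};
  ahom_scal : forall k, ahom (scal B k) = scal C k }.

Definition resF (F : fieldType) (B : fdalg F) (M : lmodType B) : lmodType F :=
  res (scal B) M.

(* [M] tensor [N] over the field, for modules over two algebras *)
Section ExternalTensor.
Variables (F : fieldType) (B C : fdalg F).

Definition rscal (M : lmodType B) (m : M) (k : F) : M := scal B k *: m.
Definition lscal (N : lmodType C) (k : F) (n : N) : N := scal C k *: n.

Section Action.
Variables (M : lmodType B) (N : lmodType C).
Definition xtens : Type := tens (@rscal M) (@lscal N).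
HB.instance Definition _ := GRing.Zmodule.on xtens.
Definition xpure (m : M) (n : N) : xtens := tpure _ _ m n.

Lemma xpureS k m n : xpure (scal B k *: m) n = xpure m (scal C k *: n).
Proof. exact: (tpureS (@rscal M) (@lscal N)). Qed.

Definition xact1 (b : B) (c : C) : xtens -> xtens :=
  tmap (@rscal M) (@lscal N) ( *:%R b) ( *:%R c).

Lemma xact1_compat b c (m : M) k (n : N) :
  tpure (@rscal M) (@lscal N) (b *: rscal m k) (c *: n) =
  tpure (@rscal M) (@lscal N) (b *: m) (c *: lscal k n).
Proof.
rewrite /rscal /lscal !scalerA -!scal_central -!scalerA.
exact: (tpureS (@rscal M) (@lscal N) (b *: m) k (c *: n)).
Qed.
Lemma xact1D b c : {morph xact1 b c : x y / x + y}.
Proof.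
move=> x y; apply: tmapD; [exact: scalerDr|exact: scalerDr|exact: xact1_compat].
Qed.
Lemma xact1_pure b c m n : xact1 b c (xpure m n) = xpure (b *: m) (c *: n).
Proof.
apply: tmap_pure; [exact: scalerDr|exact: scalerDr|exact: xact1_compat].
Qed.

Lemma xtens_addE (Z : zmodType) (g h : xtens -> Z) :
  {morph g : x y / x + y} -> {morph h : x y / x + y} ->
  (forall m n, g (xpure m n) = h (xpure m n)) -> g =1 h.
Proof. exact: tens_addE. Qed.

Lemma xact1_balanced (x : xtens) :
  balanced (fun (b : B^o) k => scal B k * b) (fun k (c : C^o) => scal C k * c)
           (fun b c => xact1 b c x).
Proof.
split.
- move=> b b' c; move: x; apply: xtens_addE => [x y|x y|m n].
  + exact: xact1D.
  + by rewrite !xact1D addrACA.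
  + by rewrite !xact1_pure scalerDl /xpure tpureDl.
- move=> b c c'; move: x; apply: xtens_addE => [x y|x y|m n].
  + exact: xact1D.
  + by rewrite !xact1D addrACA.
  + by rewrite !xact1_pure scalerDl /xpure tpureDr.
- move=> b k c; move: x; apply: xtens_addE => [x y|x y|m n].
  + exact: xact1D.
  + exact: xact1D.
  + by rewrite !xact1_pure -!scalerA xpureS.
Qed.
End Action.

Definition tring : Type := xtens (B^o : lmodType B) (C^o : lmodType C).
HB.instance Definition _ := GRing.Zmodule.on tring.
Definition tp (b : B) (c : C) : tring := xpure (b : B^o) (c : C^o).

Definition xact (M : lmodType B) (N : lmodType C) (t : tring) (x : xtens M N)
  : xtens M N := tlift (fun (b : B^o) (c : C^o) => xact1 b c x) t.

Section ActionLaws.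
Variables (M : lmodType B) (N : lmodType C).
Implicit Types (x y : xtens M N) (s t : tring).
Lemma xact_tp b c x : xact (tp b c) x = xact1 b c x.
Proof. exact: (tlift_pure (xact1_balanced x)). Qed.
Lemma xactDl x s t : xact (s + t) x = xact s x + xact t x.
Proof. exact: (tliftD (xact1_balanced x)). Qed.
Lemma tring_ind (P : tring -> Prop) :
  (forall s t, P s -> P t -> P (s + t)) -> (forall b c, P (tp b c)) ->
  forall t, P t.
Proof. exact: tens_ind. Qed.
Lemma xactDr t x y : xact t (x + y) = xact t x + xact t y.
Proof.
elim/tring_ind: t => [s t es et|b c].
  by rewrite !xactDl es et addrACA.
by rewrite !xact_tp xact1D.
Qed.
Lemma xact_pure b c m n :
  xact (tp b c) (xpure m n) = xpure (b *: m) (c *: n) :> xtens M N.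
Proof. by rewrite xact_tp xact1_pure. Qed.
End ActionLaws.

Lemma xactA (M : lmodType B) (N : lmodType C) (s t : tring) (x : xtens M N) :
  xact s (xact t x) = xact (xact s t : tring) x.
Proof.
elim/tring_ind: s => [s s' es es'|b c].
  by rewrite !xactDl es es' -xactDl.
elim/tring_ind: t => [t t' et et'|b' c'].
  by rewrite [xact (t + t') x]xactDl !xactDr et et' -[LHS]xactDl.
move: x; apply: xtens_addE => [x y|x y|m n].
- by rewrite !(@xactDr M N).
- by rewrite (@xactDr M N).
have -> : xact (tp b c) (tp b' c') = tp (b * b') (c * c') by exact: xact_pure.
by rewrite !xact_pure !scalerA.
Qed.
Lemma xact_1l (M : lmodType B) (N : lmodType C) (x : xtens M N) :
  xact (tp 1 1) x = x.
Proof.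
move: x; apply: xtens_addE => [x y|//|m n]; first exact: xactDr.
by rewrite xact_pure !scale1r.
Qed.
Lemma xact_1r (t : tring) : xact t (tp 1 1) = t :> tring.
Proof.
elim/tring_ind: t => [s t es et|b c]; first by rewrite xactDl es et.
by rewrite xact_pure -[b *: _]/(b * 1) -[c *: _]/(c * 1) !mulr1.
Qed.

Definition tmul (s t : tring) : tring := xact s t.
Lemma tmulA : associative tmul.
Proof. by move=> s t u; exact: xactA. Qed.
Lemma tmul1l : left_id (tp 1 1) tmul.
Proof. by move=> t; exact: xact_1l. Qed.
Lemma tmul1r : right_id (tp 1 1) tmul.
Proof. exact: xact_1r. Qed.
Lemma tmulDl : left_distributive tmul +%R.
Proof. by move=> s t u; exact: xactDl. Qed.
Lemma tmulDr : right_distributive tmul +%R.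
Proof. by move=> s t u; exact: xactDr. Qed.
HB.instance Definition _ :=
  GRing.Zmodule_isPzRing.Build tring tmulA tmul1l tmul1r tmulDl tmulDr.

Lemma tpM b c b' c' : tp b c * tp b' c' = tp (b * b') (c * c').
Proof. exact: xact_pure. Qed.
Lemma tp1 : tp 1 1 = 1. Proof. by []. Qed.
Lemma tpDl b b' c : tp (b + b') c = tp b c + tp b' c.
Proof. exact: tpureDl. Qed.
Lemma tpDr b c c' : tp b (c + c') = tp b c + tp b c'.
Proof. exact: tpureDr. Qed.
Lemma tpS b k c : tp (scal B k * b) c = tp b (scal C k * c).
Proof. exact: (tpureS (@rscal B^o) (@lscal C^o)). Qed.

Section ModuleInstance.
Variables (M : lmodType B) (N : lmodType C).
HB.instance Definition _ := GRing.Zmodule_isLmodule.Build tring (xtens M N)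
  (@xactA M N) (@xact_1l M N) (@xactDr M N) (@xactDl M N).
End ModuleInstance.
End ExternalTensor.

Section FiniteGeneration.
Lemma fgen_fin (R : pzRingType) (M : lmodType R) (I : finType) (s : I -> M) :
  (forall m, exists c : I -> R, m = \sum_i c i *: s i) -> fgen M.
Proof.
move=> h; exists #|I|, (s \o enum_val) => m; have [c ->] := h m.
exists (c \o enum_val); rewrite (reindex (@enum_val I predT)) //=.
by apply: onW_bij; exact: enum_val_bij.
Qed.

Variables (F : fieldType) (B : fdalg F).

Lemma scal_scale (M : lmodType B) (k : F) (b : B) (m : M) :
  scal B k *: (b *: m) = b *: (scal B k *: m).
Proof. by rewrite !scalerA scal_central. Qed.

Lemma fd_fgen (M : lmodType B) : fgen (resF M) -> fgen M.
Proof.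
move=> [n [s h]]; exists n, s => m; have [c ->] := h m.
by exists (fun i => scal B (c i)).
Qed.

Lemma fgen_fd (M : lmodType B) : fgen M -> fgen (resF M).
Proof.
move=> [n [s h]]; have [d [e he]] := alg_fin B.
pose g (p : 'I_n * 'I_d) : resF M := (e p.2 : B) *: s p.1.
apply: (@fgen_fin _ _ _ g) => m.
have [c mE] := h m.
have /choice[k hk] : forall i, exists k : 'I_d -> F,
  c i = \sum_j scal B (k j) * (e j : B) by move=> i; exact: he.
exists (fun p => k p.1 p.2).
rewrite -(pair_bigA _ (fun i j => k i j *: g (i, j))) /= [LHS]mE.
apply: eq_bigr => i _; rewrite hk scaler_suml; apply: eq_bigr => j _.
by rewrite -scalerA.
Qed.

(* A vector space embedding into a finite dimensional one is finite
   dimensional: take a maximal free family in the preimage of its image. *)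
Lemma fgen_inj (V W : lmodType F) (g : {linear V -> W}) :
  injective g -> fgen W -> fgen V.
Proof.
move=> gI [n [s hs]].
pose p (r : 'rV[F]_n) : W := \sum_i r 0 i *: s i.
have pL a r r' : p (a *: r + r') = a *: p r + p r'.
  rewrite /p scaler_sumr -big_split; apply: eq_bigr => i _.
  by rewrite !mxE scalerDl scalerA.
pose U (r : 'rV[F]_n) := exists v, g v = p r.
pose P k := `[< exists A : 'M[F]_(k, n), row_free A /\ forall i, U (row i A) >].
have P0 : exists k, P k.
  exists 0%N; apply/asboolP; exists 0; split; last by case.
  by rewrite /row_free mxrank0.
have Pn k : P k -> (k <= n)%N.
  by move=> /asboolP[A [/eqP rk _]]; rewrite -rk; exact: rank_leq_col.
case: (ex_maxnP P0 Pn) => k /asboolP[A [fA UA]] kmax.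
have [v hv] := choice UA.
exists k, v => w.
have [c cE] := hs (g w).
pose r : 'rV[F]_n := \row_i c i.
have rE : p r = g w by rewrite cE; apply: eq_bigr => i _; rewrite mxE.
have rA : (r <= A)%MS.
  apply: contrapT => /negP nrA.
  have /kmax : P (k + 1)%N; last by rewrite addn1 ltnn.
  apply/asboolP; exists (col_mx A r); split.
    rewrite /row_free -addsmxE; apply/eqP; apply/anti_leq/andP; split.
      by rewrite addsmxE rank_leq_row.
    rewrite addn1 -{1}(eqP fA); apply: rank_ltmx.
    by rewrite /ltmx addsmxSl /= addsmx_sub submx_refl.
  move=> i; case: (split_ordP i) => j ->.
    by rewrite rowKu.
  by rewrite rowKd row_id; exists w; rewrite rE.
have /submxP[D rD] := rA.
exists (D 0); apply: gI; rewrite -rE rD linear_sum.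
under [RHS]eq_bigr => i _ do rewrite linearZ /= hv.
have p0 : p 0 = 0 by apply: big1 => i _; rewrite mxE scale0r.
rewrite mulmx_sum_row.
elim/big_rec2: _ => [//|i x y _ <-]; exact: pL.
Qed.
End FiniteGeneration.

Section TensorAlgebra.
Variables (F : fieldType) (B C : fdalg F).

Definition tscal (k : F) : tring B C := tp (scal B k) 1.
Lemma tscal_additive : zmod_morphism tscal.
Proof.
move=> k l; apply: (addIr (tscal l)); rewrite subrK /tscal -tpDl.
by rewrite -rmorphD subrK.
Qed.
Lemma tscal_multiplicative : monoid_morphism tscal.
Proof.
split; first by rewrite /tscal rmorph1.
by move=> k l; rewrite /tscal tpM mulr1 rmorphM.
Qed.
HB.instance Definition _ :=
  GRing.isZmodMorphism.Build F (tring B C) tscal tscal_additive.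
HB.instance Definition _ :=
  GRing.isMonoidMorphism.Build F (tring B C) tscal tscal_multiplicative.

Lemma tscal_central k (t : tring B C) : tscal k * t = t * tscal k.
Proof.
elim/tring_ind: t => [s t es et|b c]; first by rewrite mulrDl mulrDr es et.
by rewrite !tpM scal_central mul1r mulr1.
Qed.

Lemma xtens_tscal (M : lmodType B) (N : lmodType C) k (m : M) (n : N) :
  tscal k *: xpure m n = xpure (scal B k *: m) n.
Proof. by rewrite -[LHS]/(xact _ _) xact_pure scale1r. Qed.

Lemma xtens_fd (M : lmodType B) (N : lmodType C) :
  fgen (resF M) -> fgen (resF N) -> fgen (res tscal (xtens M N)).
Proof.
move=> [d [e he]] [d' [e' he']].
pose g (p : 'I_d * 'I_d') : res tscal (xtens M N) := xpure (e p.1 : M) (e' p.2 : N).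
apply: (@fgen_fin _ _ _ g); elim/tens_ind => [x y [c xE] [c' yE]|m n].
  exists (fun p => c p + c' p); rewrite [x]xE [y]yE -[LHS]big_split.
  by apply: eq_bigr => p _; rewrite scalerDl.
have [c cE] := he m; have [c' cE'] := he' n.
exists (fun p => c p.1 * c' p.2).
rewrite -(pair_bigA _ (fun i j => (c i * c' j) *: g (i, j))) /=.
transitivity (xpure (\sum_i c i *: e i : M) (\sum_j c' j *: e' j : N)).
  by rewrite -cE -cE'.
have suml (I : Type) (r : seq I) (f : I -> M) (x : N) :
    xpure (\sum_(i <- r) f i) x = \sum_(i <- r) xpure (f i) x.
  by apply: (big_morph (fun y => xpure y x)) => [a b|];
    [exact: tpureDl | exact: tpure0l].
have sumr (I : Type) (r : seq I) (f : I -> N) (x : M) :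
    xpure x (\sum_(i <- r) f i) = \sum_(i <- r) xpure x (f i).
  by apply: (big_morph (fun y => xpure x y)) => [a b|];
    [exact: tpureDr | exact: tpure0r].
rewrite suml; apply: eq_bigr => i _; rewrite sumr; apply: eq_bigr => j _.
rewrite [RHS]res_scaleE rmorphM -scalerA [tscal (c' j) *: _]xtens_tscal xpureS.
by rewrite xtens_tscal.
Qed.

Lemma tring_fin : fgen (res tscal (tring B C)^o).
Proof. exact: (xtens_fd (alg_fin B) (alg_fin C)). Qed.

Definition talg : fdalg F := FdAlg tscal_central tring_fin.
End TensorAlgebra.

Section AlgebraMorphisms.
Variable F : fieldType.
Implicit Types B C D : fdalg F.

Definition aid B : alghom B B :=
  @AlgHom F B B (idfun : {rmorphism B -> B}) (fun=> erefl).

Lemma acomp_scal B C D (g : alghom C D) (f : alghom B C) k :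
  (g \o f) (scal B k) = scal D k.
Proof. by rewrite /= !ahom_scal. Qed.
Definition acomp B C D (g : alghom C D) (f : alghom B C) : alghom B D :=
  @AlgHom F B D (g \o f : {rmorphism B -> D}) (acomp_scal g f).

Section Inclusions.
Variables B C : fdalg F.
Definition tinl_fun (b : B) : talg B C := tp b 1.
Definition tinr_fun (c : C) : talg B C := tp 1 c.
Lemma tinl_additive : zmod_morphism tinl_fun.
Proof.
move=> k l; apply: (addIr (tinl_fun l)); rewrite subrK /tinl_fun -tpDl.
by rewrite subrK.
Qed.
Lemma tinr_additive : zmod_morphism tinr_fun.
Proof.
move=> k l; apply: (addIr (tinr_fun l)); rewrite subrK /tinr_fun -tpDr.
by rewrite subrK.
Qed.
Lemma tinl_multiplicative : monoid_morphism tinl_fun.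
Proof. by split=> // b b'; rewrite /tinl_fun [RHS]tpM mulr1. Qed.
Lemma tinr_multiplicative : monoid_morphism tinr_fun.
Proof. by split=> // b b'; rewrite /tinr_fun [RHS]tpM mulr1. Qed.
HB.instance Definition _ :=
  GRing.isZmodMorphism.Build B (talg B C) tinl_fun tinl_additive.
HB.instance Definition _ :=
  GRing.isMonoidMorphism.Build B (talg B C) tinl_fun tinl_multiplicative.
HB.instance Definition _ :=
  GRing.isZmodMorphism.Build C (talg B C) tinr_fun tinr_additive.
HB.instance Definition _ :=
  GRing.isMonoidMorphism.Build C (talg B C) tinr_fun tinr_multiplicative.
Lemma tinr_scal k : tinr_fun (scal C k) = scal (talg B C) k.
Proof.
rewrite /= /tscal /tinr_fun -[scal C k]mulr1 -[scal B k]mulr1.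
by rewrite (tpS 1 k 1).
Qed.
Definition tinl : alghom B (talg B C) :=
  @AlgHom F B (talg B C) (tinl_fun : {rmorphism _ -> _}) (fun=> erefl).
Definition tinr : alghom C (talg B C) :=
  @AlgHom F C (talg B C) (tinr_fun : {rmorphism _ -> _}) tinr_scal.
End Inclusions.

(* The morphism b (x) c |-> f b * g c, for f and g with commuting images *)
Section Lift.
Variables (B C D : fdalg F) (f : alghom B D) (g : alghom C D).
Definition acommute : Prop := forall b c, f b * g c = g c * f b.
Hypothesis fg : acommute.

Definition alift_fun (t : talg B C) : D :=
  tlift (fun (b : B^o) (c : C^o) => f b * g c) (t : tring B C).

Lemma alift_balanced :
  balanced (@rscal F B B^o) (@lscal F C C^o) (fun b c => f b * g c).
Proof.
split=> [b b' c|b c c'|b k c].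
- by rewrite rmorphD mulrDl.
- by rewrite rmorphD mulrDr.
rewrite /rscal /lscal -[_ *: b]/(scal B k * b) -[_ *: c]/(scal C k * c).
rewrite !rmorphM !ahom_scal scal_central.
exact: esym (mulrA _ _ _).
Qed.
Lemma alift_tp b c : alift_fun (tp b c) = f b * g c.
Proof. exact: (tlift_pure alift_balanced). Qed.
Lemma alift_D s t : alift_fun (s + t) = alift_fun s + alift_fun t.
Proof. exact: (tliftD alift_balanced). Qed.
Lemma alift_additive : zmod_morphism alift_fun.
Proof.
by move=> s t; apply: (addIr (alift_fun t)); rewrite subrK -alift_D subrK.
Qed.
Lemma alift_multiplicative : monoid_morphism alift_fun.
Proof.
split; first by rewrite -[1]/(tp 1 1 : tring B C) alift_tp !rmorph1 mulr1.
elim/tring_ind => [s s' es es' t|b c]; first by rewrite mulrDl !alift_D es es' mulrDl.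
elim/tring_ind => [s s' es es'|b' c'].
  by rewrite mulrDr !alift_D es es' mulrDr.
rewrite [tp b c * tp b' c']tpM !alift_tp !rmorphM.
by rewrite -!mulrA; congr (_ * _); rewrite !mulrA fg.
Qed.
HB.instance Definition _ :=
  GRing.isZmodMorphism.Build (talg B C) D alift_fun alift_additive.
HB.instance Definition _ :=
  GRing.isMonoidMorphism.Build (talg B C) D alift_fun alift_multiplicative.
Lemma alift_scal k : alift_fun (scal (talg B C) k) = scal D k.
Proof. by rewrite alift_tp rmorph1 mulr1 ahom_scal. Qed.
Definition alift : alghom (talg B C) D :=
  @AlgHom F (talg B C) D (alift_fun : {rmorphism _ -> _}) alift_scal.
End Lift.

Lemma tin_commute B C D E (f : alghom B D) (g : alghom C E) :
  acommute (acomp (tinl D E) f) (acomp (tinr D E) g).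
Proof.
by move=> b c; rewrite /= /tinl_fun /tinr_fun [LHS]tpM [RHS]tpM !mul1r !mulr1.
Qed.
Definition thom B C D E (f : alghom B D) (g : alghom C E) :
  alghom (talg B C) (talg D E) := alift (tin_commute f g).

Lemma flip_commute B C D E :
  acommute (thom (tinl B D) (tinl C E)) (thom (tinr B D) (tinr C E)).
Proof.
move=> s t; elim/tring_ind: s => [s s' es es'|b c].
  by rewrite rmorphD mulrDl mulrDr es es'.
elim/tring_ind: t => [s s' es es'|d e].
  by rewrite rmorphD mulrDl mulrDr es es'.
rewrite /= !alift_tp /= /tinl_fun /tinr_fun ![tp _ 1 * tp 1 _]tpM !mul1r !mulr1.
by rewrite [LHS]tpM [RHS]tpM ![tp _ _ * tp _ _]tpM !mul1r !mulr1.
Qed.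
(* (b (x) c) (x) (d (x) e) |-> (b (x) d) (x) (c (x) e) *)
Definition tflip B C D E :
  alghom (talg (talg B C) (talg D E)) (talg (talg B D) (talg C E)) :=
  alift (@flip_commute B C D E).
End AlgebraMorphisms.

Lemma lin_ext (R : pzRingType) (M N : lmodType R) (f g : {linear M -> N}) :
  f =1 g -> f = g.
Proof.
case: f => f [[[fa fb]] [fs]]; case: g => g [[[ga gb]] [gs]] /= /funext e.
case: _ / e ga gb gs => ga gb gs.
by rewrite (Prop_irrelevance fa ga) (Prop_irrelevance fb gb)
  (Prop_irrelevance fs gs).
Qed.

Section LinearOf.
Variables (R : pzRingType) (M N : lmodType R) (f : M -> N).
Hypotheses (fD : {morph f : x y / x + y}) (fZ : forall a x, f (a *: x) = a *: f x).
Definition lin_of_fun (_ : {morph f : x y / x + y})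
  (_ : forall a x, f (a *: x) = a *: f x) : M -> N := f.
Local Notation g := (lin_of_fun fD fZ).
Lemma lin_of_linear : linear g.
Proof. by move=> a x y; rewrite /lin_of_fun fD fZ. Qed.
HB.instance Definition _ := GRing.isLinear.Build R M N *:%R g lin_of_linear.
Definition lin_of : {linear M -> N} := g.
End LinearOf.

Section Induction.
Variables (R S : pzRingType) (f : {rmorphism R -> S}).

Definition ind_ra (c : S) (b : R) : S := c * f b.
Definition ind_la (M : lmodType R) (b : R) (m : M) : M := b *: m.

(* S (x)_R M, where R acts on the right of S through f *)
Definition ind (M : lmodType R) : Type := tens ind_ra (@ind_la M).
HB.instance Definition _ M := GRing.Zmodule.on (ind M).
Definition ipure (M : lmodType R) (c : S) (m : M) : ind M := tpure _ _ c m.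

Section IndModule.
Variable M : lmodType R.
Implicit Types (c : S) (x y : ind M).

Definition ind_scale c : ind M -> ind M :=
  tmap ind_ra (@ind_la M) (fun c' => c * c') id.

Lemma ind_scale_compat c c' b m :
  tpure ind_ra (@ind_la M) (c * ind_ra c' b) m =
  tpure ind_ra (@ind_la M) (c * c') (ind_la b m).
Proof. by rewrite /ind_ra mulrA; exact: (tpureS ind_ra (@ind_la M)). Qed.
Lemma ind_scaleD c x y : ind_scale c (x + y) = ind_scale c x + ind_scale c y.
Proof. by apply: tmapD => //; [exact: mulrDr | exact: ind_scale_compat]. Qed.
Lemma ind_scale_pure c c' m : ind_scale c (ipure c' m) = ipure (c * c') m.
Proof. by apply: tmap_pure => //; [exact: mulrDr | exact: ind_scale_compat]. Qed.
Lemma ind_ext (Z : zmodType) (g h : ind M -> Z) :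
  {morph g : x y / x + y} -> {morph h : x y / x + y} ->
  (forall c m, g (ipure c m) = h (ipure c m)) -> g =1 h.
Proof. exact: tens_addE. Qed.

Lemma ind_scaleA a b x : ind_scale a (ind_scale b x) = ind_scale (a * b) x.
Proof.
move: x; apply: ind_ext => [x y|x y|c m]; rewrite ?ind_scaleD //.
by rewrite !ind_scale_pure mulrA.
Qed.
Lemma ind_scale1 : left_id 1 ind_scale.
Proof.
apply: ind_ext => [x y|//|c m]; first exact: ind_scaleD.
by rewrite ind_scale_pure mul1r.
Qed.
Lemma ind_scaleDr : right_distributive ind_scale +%R.
Proof. by move=> c x y; exact: ind_scaleD. Qed.
Lemma ind_scaleDl x : {morph ind_scale^~ x : a b / a + b}.
Proof.
move=> a b; move: x; apply: ind_ext => [x y|x y|c m].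
- exact: ind_scaleD.
- by rewrite !ind_scaleD addrACA.
by rewrite !ind_scale_pure mulrDl /ipure tpureDl.
Qed.
HB.instance Definition _ := GRing.Zmodule_isLmodule.Build S (ind M)
  ind_scaleA ind_scale1 ind_scaleDr ind_scaleDl.
Lemma ind_scaleE c c' m : c *: ipure c' m = ipure (c * c') m.
Proof. exact: ind_scale_pure. Qed.
Lemma ipureS c b (m : M) : ipure (c * f b) m = ipure c (b *: m).
Proof. exact: (tpureS ind_ra (@ind_la M)). Qed.
End IndModule.

Section IndMap.
Variables (M N : lmodType R) (h : {linear M -> N}).
Definition ind_fun : ind M -> ind N := tmap ind_ra (@ind_la N) id h.
Lemma ind_fun_compat c b m : tpure ind_ra (@ind_la N) (ind_ra c b) (h m) =
  tpure ind_ra (@ind_la N) c (h (ind_la b m)).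
Proof.
by rewrite /ind_la linearZ; exact: (tpureS ind_ra (@ind_la N)).
Qed.
Lemma ind_funD : {morph ind_fun : x y / x + y}.
Proof.
by move=> x y; apply: tmapD => //; [exact: (linearD h) | exact: ind_fun_compat].
Qed.
Lemma ind_fun_pure c m : ind_fun (ipure c m) = ipure c (h m).
Proof. by apply: tmap_pure => //; [exact: (linearD h) | exact: ind_fun_compat]. Qed.
Lemma ind_funZ c x : ind_fun (c *: x) = c *: ind_fun x.
Proof.
move: x; apply: ind_ext => [x y|x y|c' m].
- by rewrite scalerDr ind_funD.
- by rewrite ind_funD scalerDr.
by rewrite ind_scaleE !ind_fun_pure ind_scaleE.
Qed.
Definition ind_map : {linear ind M -> ind N} := lin_of ind_funD ind_funZ.
End IndMap.

Lemma ind_fgen (M : lmodType R) : fgen M -> fgen (ind M).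
Proof.
move=> [n [s h]]; exists n, (fun i => ipure 1 (s i)).
elim/tens_ind => [x y [c ->] [c' ->]|c m].
  exists (fun i => c i + c' i); rewrite -big_split.
  by apply: eq_bigr => i _; rewrite scalerDl.
have [b ->] := h m; exists (fun i => c * f (b i)).
rewrite (big_morph (fun m : M => tpure ind_ra (@ind_la M) c m)
  (fun m m' => tpureDr _ _ c m m') (tpure0r _ _ c)).
by apply: eq_bigr => i _; rewrite ind_scaleE mulr1 ipureS.
Qed.
End Induction.

Section RestrictionMap.
Variables (R S : pzRingType) (f : {rmorphism R -> S}).
Variables (M N : lmodType S) (h : {linear M -> N}).
Lemma res_mapD : {morph (h : res f M -> res f N) : x y / x + y}.
Proof. exact: (linearD h). Qed.
Lemma res_mapZ a (x : res f M) : h (a *: x) = a *: (h x : res f N).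
Proof. exact: (linearZZ h (f a) x). Qed.
Definition res_map : {linear res f M -> res f N} := lin_of res_mapD res_mapZ.
End RestrictionMap.

Section ExternalTensorMap.
Variables (F : fieldType) (B C : fdalg F).
Variables (M M' : lmodType B) (N N' : lmodType C).
Variables (g : {linear M -> M'}) (h : {linear N -> N'}).
Definition xtens_fun : xtens M N -> xtens M' N' :=
  tmap (@rscal F B M') (@lscal F C N') g h.
Lemma xtens_fun_compat m k n :
  tpure (@rscal F B M') (@lscal F C N') (g (rscal m k)) (h n) =
  tpure (@rscal F B M') (@lscal F C N') (g m) (h (lscal k n)).
Proof.
rewrite /rscal /lscal !linearZ; exact: (tpureS (@rscal F B M') (@lscal F C N')).
Qed.
Lemma xtens_funD : {morph xtens_fun : x y / x + y}.
Proof.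
by move=> x y; apply: tmapD; [exact: (linearD g)|exact: (linearD h)|exact: xtens_fun_compat].
Qed.
Lemma xtens_fun_pure m n : xtens_fun (xpure m n) = xpure (g m) (h n).
Proof.
by apply: tmap_pure; [exact: (linearD g)|exact: (linearD h)|exact: xtens_fun_compat].
Qed.
Lemma xtens_funZ (t : talg B C) x : xtens_fun (t *: x) = t *: xtens_fun x.
Proof.
elim/tring_ind: t => [s t es et|b c].
  by rewrite !scalerDl xtens_funD es et.
move: x; apply: xtens_addE => [x y|x y|m n].
- by rewrite scalerDr xtens_funD.
- by rewrite xtens_funD scalerDr.
rewrite -[tp b c *: xpure m n]/(xact _ _) xact_pure !xtens_fun_pure.
by rewrite -[RHS]/(xact _ _) xact_pure !linearZ.
Qed.
Definition xtens_map : {linear (xtens M N : lmodType (talg B C)) -> xtens M' N'} :=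
  lin_of xtens_funD xtens_funZ.
End ExternalTensorMap.

Definition homz (R : pzRingType) (M N : lmodType R) : Type := {linear M -> N}.

Section HomGroup.
Variables (R : pzRingType) (M N : lmodType R).
Local Notation homz := (homz M N).
HB.instance Definition _ := gen_eqMixin homz.
HB.instance Definition _ := gen_choiceMixin homz.
Definition hom_zero : homz := GRing.null_fun N : {linear M -> N}.
Definition hom_add (f g : {linear M -> N}) : homz := f \+ g : {linear M -> N}.
Definition hom_opp (f : {linear M -> N}) : homz := \- f : {linear M -> N}.
Lemma hom_addA : associative (hom_add : homz -> homz -> homz).
Proof. by move=> f g h; apply: lin_ext => x /=; rewrite addrA. Qed.
Lemma hom_addC : commutative (hom_add : homz -> homz -> homz).
Proof. by move=> f g; apply: lin_ext => x /=; rewrite addrC. Qed.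
Lemma hom_add0 : left_id hom_zero (hom_add : homz -> homz -> homz).
Proof. by move=> f; apply: lin_ext => x /=; rewrite add0r. Qed.
Lemma hom_addN :
  left_inverse hom_zero (hom_opp : homz -> homz) (hom_add : homz -> homz -> homz).
Proof. by move=> f; apply: lin_ext => x /=; rewrite addNr. Qed.
HB.instance Definition _ :=
  GRing.isZmodule.Build homz hom_addA hom_addC hom_add0 hom_addN.

Definition happ (f : homz) : M -> N := (f : {linear M -> N}).
Lemma happD (f g : homz) x : happ (f + g) x = happ f x + happ g x.
Proof. by []. Qed.
Lemma happ_eq (f g : homz) : happ f =1 happ g -> f = g.
Proof. exact: lin_ext. Qed.
End HomGroup.

(* Hom_C(P, W) for a module W over B (x) C, with (b . f)(p) = (b (x) 1) f(p) *)
Section HomRight.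
Variables (F : fieldType) (B C : fdalg F).

Section Scaling.
Variable W : lmodType (talg B C).
Definition lact_fun (b : B) (w : res (tinr B C) W) : res (tinr B C) W :=
  tinl B C b *: (w : W).
Lemma lact_funD b : {morph lact_fun b : x y / x + y}.
Proof. by move=> x y; exact: (scalerDr (tinl B C b) (x : W)). Qed.
Lemma lact_funZ b (c : C) x : lact_fun b (c *: x) = c *: lact_fun b x.
Proof.
rewrite -[LHS]/(tinl B C b *: (tinr B C c *: (x : W))).
rewrite -[RHS]/(tinr B C c *: (tinl B C b *: (x : W))) !scalerA.
congr (_ *: (x : W)); by rewrite /= /tinl_fun /tinr_fun [LHS]tpM [RHS]tpM !mul1r !mulr1.
Qed.
Definition lact b : {linear res (tinr B C) W -> res (tinr B C) W} :=
  lin_of (lact_funD b) (lact_funZ b).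
End Scaling.

Definition homr (P : lmodType C) (W : lmodType (talg B C)) : Type :=
  homz P (res (tinr B C) W).
HB.instance Definition _ P W := GRing.Zmodule.on (homr P W).

Section HomRightModule.
Variables (P : lmodType C) (W : lmodType (talg B C)).
Definition homr_scale (b : B) (f : homr P W) : homr P W :=
  lact W b \o (f : {linear _ -> _}) : {linear _ -> _}.
Lemma homr_scaleA a b f : homr_scale a (homr_scale b f) = homr_scale (a * b) f.
Proof.
by apply: lin_ext => x /=; rewrite /lin_of_fun /lact_fun scalerA -rmorphM.
Qed.
Lemma homr_scale1 : left_id 1 homr_scale.
Proof.
by move=> f; apply: lin_ext => x; rewrite /= /lin_of_fun /lact_fun rmorph1 scale1r.
Qed.
Lemma homr_scaleDr : right_distributive homr_scale +%R.
Proof. by move=> b f g; apply: lin_ext => x; exact: (lact_funD b). Qed.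
Lemma homr_scaleDl f : {morph homr_scale^~ f : a b / a + b}.
Proof.
move=> a b; apply: lin_ext => x /=; rewrite /lin_of_fun /lact_fun.
by rewrite rmorphD scalerDl.
Qed.
HB.instance Definition _ := GRing.Zmodule_isLmodule.Build B (homr P W)
  homr_scaleA homr_scale1 homr_scaleDr homr_scaleDl.
End HomRightModule.

Section HomRightMap.
Variables (P : lmodType C) (W W' : lmodType (talg B C)) (h : {linear W -> W'}).
Definition homr_fun (f : homr P W) : homr P W' :=
  res_map (tinr B C) h \o (f : {linear _ -> _}) : {linear _ -> _}.
Lemma homr_funD : {morph homr_fun : f g / f + g}.
Proof. by move=> f g; apply: lin_ext => x; exact: (linearD h). Qed.
Lemma homr_funZ b (f : homr P W) : homr_fun (b *: f) = b *: homr_fun f.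
Proof. by apply: lin_ext => x; exact: (linearZZ h). Qed.
Definition homr_map : {linear homr P W -> homr P W'} := lin_of homr_funD homr_funZ.
End HomRightMap.

Section HomRightFinite.
Variables (P : lmodType C) (W : lmodType (talg B C)).
Lemma homr_fgen : fgen P -> fgen W -> fgen (homr P W).
Proof.
move=> [n [s hs]] /fgen_fd[d [e he]]; apply: fd_fgen.
have fdV : fgen ({ffun 'I_n -> resF W} : lmodType F).
  pose g (p : 'I_n * 'I_d) : {ffun 'I_n -> resF W} :=
    [ffun i => if i == p.1 then e p.2 else 0].
  apply: (@fgen_fin _ _ _ g) => x.
  have /choice[k hk] : forall i, exists k : 'I_d -> F, x i = \sum_j k j *: e j.
    by move=> i; exact: he.
  exists (fun p => k p.1 p.2); apply/ffunP => i; rewrite hk sum_ffunE.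
  rewrite -(pair_bigA _ (fun i' j => (k i' j *: g (i', j)) i)) /= (bigD1 i) //=.
  rewrite [X in _ = _ + X]big1 ?addr0 => [|i' ne].
    by apply: eq_bigr => j _; rewrite !ffunE eqxx.
  by apply: big1 => j _; rewrite !ffunE eq_sym (negPf ne) scaler0.
pose ev (f : resF (homr P W)) : {ffun 'I_n -> resF W} :=
  [ffun i => (f : {linear P -> res (tinr B C) W}) (s i)].
have evD : {morph ev : f g / f + g} by move=> f g; apply/ffunP => i; rewrite !ffunE.
have evZ (a : F) (f : resF (homr P W)) : ev (a *: f) = a *: ev f.
  by apply/ffunP => i; rewrite !ffunE.
apply: (@fgen_inj _ _ _ (lin_of evD evZ)) => // f g /ffunP fg.
apply: lin_ext => x; have [c ->] := hs x; rewrite !linear_sum.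
by apply: eq_bigr => i _; have := fg i; rewrite !ffunE !linearZ => ->.
Qed.
End HomRightFinite.
End HomRight.

(* Hom_B(M, N) as a vector space over the field *)
Section HomField.
Variables (F : fieldType) (B : fdalg F).

Section Scaling.
Variable N : lmodType B.
Definition fact_fun (k : F) (x : N) : N := scal B k *: x.
Lemma fact_funD k : {morph fact_fun k : x y / x + y}.
Proof. by move=> x y; exact: scalerDr. Qed.
Lemma fact_funZ k (b : B) x : fact_fun k (b *: x) = b *: fact_fun k x.
Proof. exact: scal_scale. Qed.
Definition fact k : {linear N -> N} := lin_of (fact_funD k) (fact_funZ k).
End Scaling.

Definition homF (M N : lmodType B) : Type := homz M N.
HB.instance Definition _ M N := GRing.Zmodule.on (homF M N).

Variables M N : lmodType B.
Definition homF_scale (k : F) (f : homF M N) : homF M N :=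
  fact N k \o (f : {linear _ -> _}) : {linear _ -> _}.
Lemma homF_scaleA a b f : homF_scale a (homF_scale b f) = homF_scale (a * b) f.
Proof.
by apply: lin_ext => x /=; rewrite /lin_of_fun /fact_fun scalerA -rmorphM.
Qed.
Lemma homF_scale1 : left_id 1 homF_scale.
Proof.
by move=> f; apply: lin_ext => x; rewrite /= /lin_of_fun /fact_fun rmorph1 scale1r.
Qed.
Lemma homF_scaleDr : right_distributive homF_scale +%R.
Proof. by move=> b f g; apply: lin_ext => x; exact: (fact_funD b). Qed.
Lemma homF_scaleDl f : {morph homF_scale^~ f : a b / a + b}.
Proof.
move=> a b; apply: lin_ext => x /=; rewrite /lin_of_fun /fact_fun.
by rewrite rmorphD scalerDl.
Qed.
HB.instance Definition _ := GRing.Zmodule_isLmodule.Build F (homF M N)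
  homF_scaleA homF_scale1 homF_scaleDr homF_scaleDl.
End HomField.

(* Direct sums: families with finite support *)
Record dsum (I : choiceType) (M : I -> zmodType) : Type := DSum {
  dval :> forall i, M i;
  dsupp : exists s : seq I, forall i, i \notin s -> dval i = 0 }.

Section DirectSum.
Variables (I : choiceType) (M : I -> zmodType).
Implicit Types x y : dsum M.
HB.instance Definition _ := gen_eqMixin (dsum M).
HB.instance Definition _ := gen_choiceMixin (dsum M).

Lemma dsum_ext x y : (forall i, x i = y i) -> x = y.
Proof.
case: x y => [x xs] [y ys] /= h.
have e : x = y by apply: functional_extensionality_dep.
by subst y; congr DSum; apply: Prop_irrelevance.
Qed.

Lemma dzero_supp : exists s : seq I, forall i, i \notin s -> (0 : M i) = 0.
Proof. by exists [::]. Qed.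
Lemma dadd_supp x y :
  exists s : seq I, forall i, i \notin s -> x i + y i = 0.
Proof.
case: (dsupp x) (dsupp y) => s hs [t ht]; exists (s ++ t) => i.
by rewrite mem_cat negb_or => /andP[/hs -> /ht ->]; rewrite addr0.
Qed.
Lemma dopp_supp x : exists s : seq I, forall i, i \notin s -> - x i = 0.
Proof. by case: (dsupp x) => s hs; exists s => i /hs ->; rewrite oppr0. Qed.
Definition dzero := DSum dzero_supp.
Definition dadd x y := DSum (dadd_supp x y).
Definition dopp x := DSum (dopp_supp x).
Lemma dsum_addA : associative dadd.
Proof. by move=> x y z; apply: dsum_ext => i /=; rewrite addrA. Qed.
Lemma dsum_addC : commutative dadd.
Proof. by move=> x y; apply: dsum_ext => i /=; rewrite addrC. Qed.
Lemma dsum_add0 : left_id dzero dadd.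
Proof. by move=> x; apply: dsum_ext => i /=; rewrite add0r. Qed.
Lemma dsum_addN : left_inverse dzero dopp dadd.
Proof. by move=> x; apply: dsum_ext => i /=; rewrite addNr. Qed.
HB.instance Definition _ :=
  GRing.isZmodule.Build (dsum M) dsum_addA dsum_addC dsum_add0 dsum_addN.

Definition dinj_val (i : I) (m : M i) (j : I) : M j :=
  if i =P j is ReflectT e then
    match e in _ = j' return M j' with erefl => m end
  else 0.
Lemma dinj_supp (i : I) (m : M i) :
  exists s : seq I, forall j, j \notin s -> dinj_val m j = 0.
Proof.
exists [:: i] => j; rewrite inE => /eqP ne; rewrite /dinj_val; case: eqP => // e.
by case: ne.
Qed.
Definition dinj (i : I) (m : M i) : dsum M := DSum (dinj_supp m).

Lemma dinj_same i (m : M i) : dinj m i = m.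
Proof. by rewrite /= /dinj_val; case: eqP => // e; rewrite eq_axiomK. Qed.
Lemma dinj_other i j (m : M i) : i != j -> dinj m j = 0.
Proof. by rewrite /= /dinj_val; case: eqP. Qed.
Lemma dsum_sumE (J : Type) (r : seq J) (P : pred J) (f : J -> dsum M) i :
  (\sum_(j <- r | P j) f j) i = \sum_(j <- r | P j) f j i.
Proof. by apply: (big_morph (fun x : dsum M => x i)). Qed.

(* The map on the direct sum given by [f] on the summands, provided that each
   [f i] is additive *)
Definition dlift (Z : zmodType) (f : forall i, M i -> Z) (x : dsum M) : Z :=
  \sum_(i \in [set: I]) f i (x i).
End DirectSum.

Definition dsumm (R : pzRingType) (I : choiceType) (M : I -> lmodType R) : Type :=
  dsum M.

Section DirectSumModule.
Variables (R : pzRingType) (I : choiceType).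

Section Scaling.
Variable M : I -> lmodType R.
HB.instance Definition _ := GRing.Zmodule.on (dsumm M).
Implicit Types x y : dsumm M.
Lemma dscale_supp (a : R) x :
  exists s : seq I, forall i, i \notin s -> a *: (x : dsum M) i = 0.
Proof.
by case: (dsupp x) => s hs; exists s => i /hs ->; rewrite scaler0.
Qed.
Definition dscale a x : dsumm M := DSum (dscale_supp a x).
Lemma dscaleA a b x : dscale a (dscale b x) = dscale (a * b) x.
Proof. by apply: dsum_ext => i /=; rewrite scalerA. Qed.
Lemma dscale1 : left_id 1 dscale.
Proof. by move=> x; apply: dsum_ext => i /=; rewrite scale1r. Qed.
Lemma dscaleDr : right_distributive dscale +%R.
Proof. by move=> a x y; apply: dsum_ext => i; exact: scalerDr. Qed.
Lemma dscaleDl x : {morph dscale^~ x : a b / a + b}.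
Proof. by move=> a b; apply: dsum_ext => i; exact: scalerDl. Qed.
HB.instance Definition _ := GRing.Zmodule_isLmodule.Build R (dsumm M)
  dscaleA dscale1 dscaleDr dscaleDl.
End Scaling.

Section DMap.
Variables (M N : I -> lmodType R) (h : forall i, {linear M i -> N i}).
Lemma dmap_supp (x : dsumm M) :
  exists s : seq I, forall i, i \notin s -> h i ((x : dsum M) i) = 0.
Proof. by case: (dsupp x) => s hs; exists s => i /hs ->; rewrite linear0. Qed.
Definition dmap_fun (x : dsumm M) : dsumm N := DSum (dmap_supp x).
Lemma dmap_funD : {morph dmap_fun : x y / x + y}.
Proof. by move=> x y; apply: dsum_ext => i; exact: linearD. Qed.
Lemma dmap_funZ a x : dmap_fun (a *: x) = a *: dmap_fun x.
Proof. by apply: dsum_ext => i; exact: linearZZ. Qed.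
Definition dmap : {linear dsumm M -> dsumm N} := lin_of dmap_funD dmap_funZ.
End DMap.

Lemma dsumm_fgen (M : I -> lmodType R) :
  (exists s : seq I, forall i, i \notin s -> forall x : M i, x = 0) ->
  (forall i, fgen (M i)) -> fgen (dsumm M).
Proof.
move=> [s s0] fg.
pose n i := projT1 (cid (fg i)).
pose g i : 'I_(n i) -> M i := projT1 (cid (projT2 (cid (fg i)))).
have hg i m : exists c : 'I_(n i) -> R, m = \sum_j c j *: g i j.
  exact: (projT2 (cid (projT2 (cid (fg i))))).
pose c (x : dsumm M) i : 'I_(n i) -> R := projT1 (cid (hg i ((x : dsum M) i))).
have hc (x : dsumm M) i : (x : dsum M) i = \sum_j c x i j *: g i j.
  exact: (projT2 (cid (hg i ((x : dsum M) i)))).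
pose J := {i : seq_sub s & 'I_(n (val i))}.
pose e (p : J) : dsumm M := dinj (g _ (tagged p)).
apply: (@fgen_fin _ _ _ e) => x.
exists (fun p => c x _ (tagged p)).
transitivity (\sum_(i : seq_sub s) \sum_(j < n (val i))
    c x (val i) j *: (dinj (g (val i) j) : dsumm M)); last first.
  exact: (sig_big_dep (fun=> true) (fun _ _ => true)
    (fun (i : seq_sub s) j => c x (val i) j *: (dinj (g (val i) j) : dsumm M))).
apply: dsum_ext => i; rewrite dsum_sumE.
have cinj (k j : I) : dval (\sum_(l < n k) c x k l *: (dinj (g k l) : dsumm M)) j
    = \sum_(l < n k) c x k l *: dval (dinj (g k l) : dsumm M) j.
  exact: dsum_sumE.
have [si|/s0 z] := boolP (i \in s); last by rewrite [LHS]z [RHS]z.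
rewrite (bigD1 (SeqSub si)) //= [X in _ + X]big1 ?addr0 => [|k ne].
  by rewrite cinj hc; apply: eq_bigr => j _; rewrite dinj_same.
rewrite cinj big1 // => j _; rewrite dinj_other ?scaler0 //.
Qed.
End DirectSumModule.

Definition isom (R : pzRingType) (M N : lmodType R) : Prop :=
  exists f : {linear M -> N}, bijective f.

Definition ses (R : pzRingType) (M' M M'' : lmodType R)
    (f : {linear M' -> M}) (g : {linear M -> M''}) : Prop :=
  [/\ injective f, forall x, g x = 0 <-> exists y, x = f y &
      forall z, exists x, g x = z].

Definition projective (R : pzRingType) (P : lmodType R) : Prop :=
  forall (M N : lmodType R) (g : {linear M -> N}) (f : {linear P -> N}),
    (forall y, exists x, g x = y) ->
    exists h : {linear P -> M}, forall p, g (h p) = f p.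

(* 0 if [V] is not finite dimensional *)
Definition dimv (F : fieldType) (V : lmodType F) : nat :=
  xget 0%N [set d | exists e : 'I_d -> V,
    forall v, exists! c : {ffun 'I_d -> F}, v = \sum_i c i *: e i]%classic.

(* Matrix representations, which form a small set of representatives of the
   isomorphism classes of finitely generated modules *)
Record mxrep (F : fieldType) (B : fdalg F) := MxRep {
  mxdim : nat;
  mxact :> {rmorphism B -> 'M[F]_mxdim};
  mxact_scal : forall k, mxact (scal B k) = k%:M }.

Definition mxmod (F : fieldType) (B : fdalg F) (X : mxrep B) : Type :=
  'cV[F]_(mxdim X).
Section MatrixModule.
Variables (F : fieldType) (B : fdalg F) (X : mxrep B).
HB.instance Definition _ := GRing.Zmodule.on (mxmod X).
Definition mx_scale (b : B) (v : mxmod X) : mxmod X := X b *m v.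
Lemma mx_scaleA a b v : mx_scale a (mx_scale b v) = mx_scale (a * b) v.
Proof. by rewrite /mx_scale mulmxA rmorphM. Qed.
Lemma mx_scale1 : left_id 1 mx_scale.
Proof. by move=> v; rewrite /mx_scale rmorph1 mul1mx. Qed.
Lemma mx_scaleDr : right_distributive mx_scale +%R.
Proof. by move=> b v w; exact: mulmxDr. Qed.
Lemma mx_scaleDl v : {morph mx_scale^~ v : a b / a + b}.
Proof. by move=> a b; rewrite /mx_scale rmorphD; exact: mulmxDl. Qed.
HB.instance Definition _ := GRing.Zmodule_isLmodule.Build B (mxmod X)
  mx_scaleA mx_scale1 mx_scaleDr mx_scaleDl.
End MatrixModule.

(* [Abelian]: all finitely generated modules modulo short exact sequences
   (giving G_0); [Split]: the projective ones modulo direct sums (K_0) *)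
Variant gkind := Abelian | Split.

Section Grothendieck.
Variables (F : fieldType) (B : fdalg F) (k : gkind).

Definition admissible (M : lmodType B) : Prop :=
  match k with Abelian => True | Split => projective M end.

Definition extension (M' M M'' : lmodType B) : Prop :=
  match k with
  | Abelian => exists f g, @ses B M' M M'' f g
  | Split => isom M (M' * M'')%type
  end.

Definition ggen : Type := {classic {X : mxrep B | admissible (mxmod X)}}.
HB.instance Definition _ := Choice.on ggen.
Definition gmodule (X : ggen) : lmodType B :=
  mxmod (sval (X : {X : mxrep B | admissible (mxmod X)})).

Inductive grel : seq (bool * ggen) -> Prop :=
| Grel X' X X'' : extension (gmodule X') (gmodule X) (gmodule X'') ->
    grel [:: (true, X); (false, X'); (false, X'')].

Definition Groth : Type := pres grel.
HB.instance Definition _ := GRing.Zmodule.on Groth.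

(* The class of a module; 0 if the module is not finitely generated, or not
   projective for [Split] *)
Definition cls (M : lmodType B) : Groth :=
  if pselect (exists X : ggen, isom M (gmodule X)) is left h
  then pgen grel (projT1 (cid h)) else 0.

(* The map on the Grothendieck group given by a function on modules, provided
   that the function is additive on [extension]s *)
Definition glift (Z : zmodType) (f : lmodType B -> Z) (x : Groth) : Z :=
  plift (R := grel) (fun X => f (gmodule X)) x.

Lemma cls0 (M : lmodType B) : (forall x : M, x = 0) -> cls M = 0.
Proof.
move=> M0; rewrite /cls; case: pselect => // h; case: (cid h) => X [f fb] /=.
have X0 (x : gmodule X) : x = 0.
  by case: fb => g _ gK; rewrite -(gK x) (M0 (g x)) linear0.
have /pgen_kills : grel [:: (true, X); (false, X); (false, X)].
  constructor; rewrite /extension; case: (k).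
    exists idfun, (GRing.null_fun _); split=> // [x|z].
      by split=> // _; exists x.
    by exists 0; rewrite (X0 z) (X0 (_ 0)).
  have gD : {morph (fun x : gmodule X => (0, 0) : gmodule X * gmodule X) :
      x y / x + y} by move=> x y; congr pair; rewrite addr0.
  have gZ (a : B) (x : gmodule X) :
      (0, 0) = a *: ((0, 0) : gmodule X * gmodule X).
    by congr pair; rewrite scaler0.
  exists (lin_of gD gZ); exists (fun=> 0) => [x|[y z]]; first by rewrite (X0 x).
  by rewrite (X0 y) (X0 z).
rewrite /wval !big_cons big_nil /= addr0 addrA subrr sub0r => /eqP.
by rewrite oppr_eq0 => /eqP.
Qed.
End Grothendieck.

Notation G0 B := (Groth B Abelian).
Notation K0 B := (Groth B Split).

Definition G0_K0_pairing (F : fieldType) (B : fdalg F) (x : K0 B) (a : G0 B) : int :=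
  glift (fun P => glift (fun M => (dimv (homF P M))%:Z) a) x.

Definition biadditive (U V W : zmodType) (b : U -> V -> W) : Prop :=
  (forall u u' v, b (u + u') v = b u v + b u' v) /\
  (forall u v v', b u (v + v') = b u v + b u v').

Definition perfect (U V : zmodType) (b : U -> V -> int) : Prop :=
  [/\ biadditive b,
      forall phi : {additive V -> int}, exists! u, forall v, b u v = phi v &
      forall phi : {additive U -> int}, exists! v, forall u, b u v = phi u].

Record category := Category {
  cob :> Type;
  chom : cob -> cob -> Type;
  idc : forall X, chom X X;
  compc : forall X Y Z, chom Y Z -> chom X Y -> chom X Z;
  compc1 : forall X Y (f : chom X Y), compc f (idc X) = f;
  comp1c : forall X Y (f : chom X Y), compc (idc Y) f = f;
  compcA : forall X Y Z T (h : chom Z T) (g : chom Y Z) (f : chom X Y),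
    compc h (compc g f) = compc (compc h g) f }.
Arguments idc {c} X.

Record functor (C D : category) := Functor {
  fob :> C -> D;
  fmor : forall X Y, chom X Y -> chom (fob X) (fob Y);
  fmor1 : forall X, fmor (idc X) = idc (fob X);
  fmorM : forall X Y Z (g : chom Y Z) (f : chom X Y),
    fmor (compc g f) = compc (fmor g) (fmor f) }.
Arguments fmor {C D} _ {X Y} _.

Section FunctorComposition.
Variables (C D E : category) (G : functor D E) (F : functor C D).
Lemma fcomp1 X : fmor G (fmor F (idc X)) = idc (G (F X)).
Proof. by rewrite !fmor1. Qed.
Lemma fcompM X Y Z (g : chom Y Z) (f : chom X Y) :
  fmor G (fmor F (compc g f)) = compc (fmor G (fmor F g)) (fmor G (fmor F f)).
Proof. by rewrite !fmorM. Qed.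
Definition fcomp : functor C E :=
  @Functor C E (fun X => G (F X)) (fun X Y f => fmor G (fmor F f)) fcomp1 fcompM.
End FunctorComposition.
Notation "G \of F" := (fcomp G F) (at level 50, left associativity).

Definition natiso (C D : category) (F G : functor C D) : Prop :=
  exists (eta : forall X, chom (F X) (G X)) (theta : forall X, chom (G X) (F X)),
    [/\ forall X, compc (theta X) (eta X) = idc (F X),
        forall X, compc (eta X) (theta X) = idc (G X) &
        forall X Y (f : chom X Y),
          compc (eta Y) (fmor F f) = compc (fmor G f) (eta X)].

Definition right_adjoint (C D : category) (G : functor D C) (L : functor C D) :
  Prop :=
  exists phi : forall X Y, chom (L X) Y -> chom X (G Y),
    (forall X Y, bijective (phi X Y)) /\
    forall X X' Y Y' (h : chom X' X) (k : chom Y Y') (u : chom (L X) Y),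
      phi X' Y' (compc k (compc u (fmor L h))) =
      compc (fmor G k) (compc (phi X Y u) h).

Section FullSubcategory.
Variables (C : category) (S : C -> Prop).
Definition full : category := @Category {X : C | S X}
  (fun X Y => chom (sval X) (sval Y)) (fun X => idc (sval X))
  (fun _ _ _ g f => compc g f) (fun _ _ f => compc1 f) (fun _ _ f => comp1c f)
  (fun _ _ _ _ h g f => compcA h g f).
Variables (F : functor C C) (FS : forall X, S X -> S (F X)).
Definition frestr : functor full full := @Functor full full
  (fun X => exist S (F (sval X)) (FS (proj2_sig X)))
  (fun X Y (f : chom (sval X) (sval Y)) => fmor F f)
  (fun X => fmor1 F (sval X))
  (fun X Y Z g f => @fmorM C C F (sval X) (sval Y) (sval Z) g f).
End FullSubcategory.

Record fgmod (F : fieldType) (B : fdalg F) := FgMod {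
  fgsort :> lmodType B;
  fgP : fgen fgsort }.

Definition zero_module (R : pzRingType) (M : lmodType R) : Prop :=
  forall x : M, x = 0.

(* Objects of the direct sum over [i] of the categories [B i]-mod *)
Record gmod (F : fieldType) (I : choiceType) (B : I -> fdalg F) := GMod {
  gcomp :> forall i, fgmod (B i);
  gsupp : exists s : seq I, forall i, i \notin s -> zero_module (gcomp i) }.

Section GradedCategory.
Variables (F : fieldType) (I : choiceType) (B : I -> fdalg F).
Definition ghom (X Y : gmod B) : Type := forall i, {linear X i -> Y i}.
Lemma ghom_ext (X Y : gmod B) (f g : ghom X Y) : (forall i, f i =1 g i) -> f = g.
Proof.
by move=> fg; apply: functional_extensionality_dep => i; apply: lin_ext.
Qed.
Definition gidm (X : gmod B) : ghom X X := fun i => idfun.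
Definition gcompm (X Y Z : gmod B) (g : ghom Y Z) (f : ghom X Y) : ghom X Z :=
  fun i => g i \o f i : {linear _ -> _}.
Lemma gcompm1 X Y (f : ghom X Y) : gcompm f (gidm X) = f.
Proof. exact: ghom_ext. Qed.
Lemma gcomp1m X Y (f : ghom X Y) : gcompm (gidm Y) f = f.
Proof. exact: ghom_ext. Qed.
Lemma gcompmA X Y Z T (h : ghom Z T) (g : ghom Y Z) (f : ghom X Y) :
  gcompm h (gcompm g f) = gcompm (gcompm h g) f.
Proof. exact: ghom_ext. Qed.
Definition modc : category := Category gcompm1 gcomp1m gcompmA.

Definition gproj (X : gmod B) : Prop := forall i, projective (X i).
Definition pmodc : category := @full modc gproj.

Definition gses (X' X X'' : gmod B) (f : ghom X' X) (g : ghom X X'') : Prop :=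
  forall i, ses (f i) (g i).
End GradedCategory.

Definition exact_functor (F : fieldType) (I J : choiceType)
    (B : I -> fdalg F) (C : J -> fdalg F) (T : functor (modc B) (modc C)) : Prop :=
  forall (X' X X'' : modc B) (f : chom X' X) (g : chom X X''),
    gses f g -> gses (fmor T f) (fmor T g).

Lemma tens_zero S (M N : zmodType) (ra : M -> S -> M) (la : S -> N -> N) :
  (forall m : M, m = 0) \/ (forall n : N, n = 0) -> forall x : tens ra la, x = 0.
Proof.
move=> h; elim/tens_ind => [x y -> ->|m n]; first by rewrite addr0.
by case: h => h; [rewrite (h m) tpure0l | rewrite (h n) tpure0r].
Qed.

Section PushPull.
Variables (F : fieldType) (I J : choiceType).
Variables (B : I -> fdalg F) (C : J -> fdalg F) (t : I -> J).
Variable f : forall i, alghom (B i) (C (t i)).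

Definition fibre_hom (j : J) (k : {i : I | t i == j}) : alghom (B (val k)) (C j) :=
  match eqP (valP k) in _ = j' return alghom (B (val k)) (C j') with
  | erefl => f (val k)
  end.

(* The functor sending X to the family of the direct sums, over the [i] with
   [t i = j], of the C_j-modules induced from X_i *)
Section InductionObject.
Variable X : gmod B.
Definition gind_mod (j : J) : lmodType (C j) :=
  dsumm (fun k : {i : I | t i == j} => ind (fibre_hom k) (X (val k))).
Lemma gind_fg j : fgen (gind_mod j).
Proof.
apply: dsumm_fgen => [|k]; last exact/ind_fgen/fgP.
have [s s0] := gsupp X; exists (pmap insub s) => k ks x.
apply: tens_zero; right; apply: s0; apply: contra ks => ks.
by rewrite mem_pmap_sub.
Qed.
Lemma gind_supp : exists s : seq J, forall j, j \notin s -> zero_module (gind_mod j).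
Proof.
have [s s0] := gsupp X; exists (map t s) => j js x; apply: dsum_ext => k.
apply: tens_zero; right; apply: s0; apply: contra js => ks.
by rewrite -(eqP (valP k)) map_f.
Qed.
Definition gind : gmod C := @GMod _ _ C (fun j => FgMod (gind_fg j)) gind_supp.
End InductionObject.

Definition gind_mor (X Y : gmod B) (h : ghom X Y) : ghom (gind X) (gind Y) :=
  fun j => dmap (fun k => ind_map (fibre_hom k) (h (val k))).
Lemma gind_mor1 X : gind_mor (gidm X) = gidm (gind X).
Proof.
apply: ghom_ext => j x; apply: dsum_ext => k.
rewrite -[LHS]/(ind_fun idfun (dval x k)) -[RHS]/(dval x k).
move: (dval x k); apply: ind_ext => // [x' y'|c m]; first exact: ind_funD.
exact: ind_fun_pure.
Qed.
Lemma gind_morM X Y Z (g : ghom Y Z) (h : ghom X Y) :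
  gind_mor (gcompm g h) = gcompm (gind_mor g) (gind_mor h).
Proof.
apply: ghom_ext => j x; apply: dsum_ext => k.
rewrite -[LHS]/(ind_fun (g (val k) \o h (val k)) (dval x k)).
rewrite -[RHS]/(ind_fun (g (val k))
  (ind_fun (h (val k)) (dval x k))).
move: (dval x k).
apply: ind_ext => [x' y'|x' y'|c m].
- exact: ind_funD.
- by rewrite !ind_funD.
by rewrite !ind_fun_pure.
Qed.
Definition Indf : functor (modc B) (modc C) :=
  @Functor (modc B) (modc C) gind gind_mor gind_mor1 gind_morM.

Definition finite_fibres : Prop :=
  forall j, exists s : seq I, forall i, t i = j -> i \in s.
Hypothesis tfin : finite_fibres.

Section RestrictionObject.
Variable Y : gmod C.
Lemma gres_fg i : fgen (res (f i) (Y (t i)) : lmodType (B i)).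
Proof.
apply: fd_fgen; have [n [s hs]] := fgen_fd (fgP (Y (t i))).
exists n, s => y; have [c cE] := hs y; exists c; rewrite [LHS]cE.
apply: eq_bigr => k _; rewrite !res_scaleE.
by rewrite [RHS]/(f i (scal (B i) (c k)) *: _) ahom_scal.
Qed.
Lemma gres_supp :
  exists s : seq I, forall i, i \notin s -> zero_module (res (f i) (Y (t i))).
Proof.
have [s s0] := gsupp Y; have [u hu] := choice tfin.
exists (flatten (map u s)) => i iu; apply: s0; apply: contra iu => js.
by apply/flatten_mapP; exists (t i) => //; apply: hu.
Qed.
Definition gres : gmod B := @GMod _ _ B (fun i => FgMod (gres_fg i)) gres_supp.
End RestrictionObject.

Definition gres_mor (X Y : gmod C) (h : ghom X Y) : ghom (gres X) (gres Y) :=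
  fun i => res_map (f i) (h (t i)).
Lemma gres_mor1 X : gres_mor (gidm X) = gidm (gres X).
Proof. exact: ghom_ext. Qed.
Lemma gres_morM X Y Z (g : ghom Y Z) (h : ghom X Y) :
  gres_mor (gcompm g h) = gcompm (gres_mor g) (gres_mor h).
Proof. exact: ghom_ext. Qed.
(* The functor sending Y to the family of the restrictions of Y_(t i) to B_i *)
Definition Resf : functor (modc C) (modc B) :=
  @Functor (modc C) (modc B) gres gres_mor gres_mor1 gres_morM.
End PushPull.

Section TensorHom.
Variables (F : fieldType) (I J : choiceType).
Variables (B : I -> fdalg F) (C : J -> fdalg F).
Definition talgs (p : (I * J)%type) : fdalg F := talg (B p.1) (C p.2).

Section TensorFunctor.
Variable X : gmod B.

Section Object.
Variable Y : gmod C.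
Definition gtens_mod p : lmodType (talgs p) := xtens (X p.1) (Y p.2).
Lemma gtens_fg p : fgen (gtens_mod p).
Proof. by apply: fd_fgen; apply: xtens_fd; apply: fgen_fd; apply: fgP. Qed.
Lemma gtens_supp :
  exists s : seq (I * J), forall p, p \notin s -> zero_module (gtens_mod p).
Proof.
have [s s0] := gsupp X; have [u u0] := gsupp Y.
exists [seq (i, j) | i <- s, j <- u] => -[i j] ij; apply: tens_zero.
have [is_|/s0] := boolP (i \in s); last by left.
have [ju|/u0] := boolP (j \in u); last by right.
by case/negP: ij; apply: allpairs_f.
Qed.
Definition gtens : gmod talgs :=
  @GMod _ _ talgs (fun p => FgMod (gtens_fg p)) gtens_supp.
End Object.

Definition gtens_mor (Y Z : gmod C) (h : ghom Y Z) : ghom (gtens Y) (gtens Z) :=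
  fun p => xtens_map idfun (h p.2).
Lemma gtens_mor1 Y : gtens_mor (gidm Y) = gidm (gtens Y).
Proof.
apply: ghom_ext => p; apply: xtens_addE => // [x y|m n]; first exact: xtens_funD.
exact: xtens_fun_pure.
Qed.
Lemma gtens_morM Y Z T (g : ghom Z T) (h : ghom Y Z) :
  gtens_mor (gcompm g h) = gcompm (gtens_mor g) (gtens_mor h).
Proof.
apply: ghom_ext => p; apply: xtens_addE => [x y|x y|m n].
- exact: xtens_funD.
- by rewrite /= /lin_of_fun !xtens_funD.
by rewrite /= /lin_of_fun !xtens_fun_pure.
Qed.
(* Y |-> X (x) Y, the external tensor product over the field *)
Definition Tensf : functor (modc C) (modc talgs) :=
  @Functor (modc C) (modc talgs) gtens gtens_mor gtens_mor1 gtens_morM.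
End TensorFunctor.

Section HomFunctor.
Variable P : gmod C.

Section Object.
Variable W : gmod talgs.
Definition ghomr_comp i (j : J) : lmodType (B i) := homr (P j) (W (i, j)).
Definition ghomr_mod i : lmodType (B i) := dsumm (ghomr_comp i).
Lemma homr_zero i j : zero_module (P j) \/ zero_module (W (i, j)) ->
  forall f : homr (P j) (W (i, j)), f = 0.
Proof.
move=> h f; apply: lin_ext => x; case: h => h; last exact: h.
by rewrite (h x) linear0.
Qed.
Lemma ghomr_fg i : fgen (ghomr_mod i).
Proof.
apply: dsumm_fgen => [|j]; last by apply: homr_fgen; apply: fgP.
have [s s0] := gsupp P; exists s => j js; apply: homr_zero; left; exact: s0.
Qed.
Lemma ghomr_supp :
  exists s : seq I, forall i, i \notin s -> zero_module (ghomr_mod i).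
Proof.
have [s s0] := gsupp W; exists (map fst s) => i si x; apply: dsum_ext => j.
apply: homr_zero; right; apply: s0; apply: contra si => ijs.
by apply/mapP; exists (i, j).
Qed.
Definition ghomr : gmod B := @GMod _ _ B (fun i => FgMod (ghomr_fg i)) ghomr_supp.
End Object.

Definition ghomr_mor (W W' : gmod talgs) (h : ghom W W') :
    ghom (ghomr W) (ghomr W') :=
  fun i => @dmap _ _ (ghomr_comp W i) (ghomr_comp W' i)
    (fun j => homr_map (P j) (h (i, j))).
Lemma ghomr_mor1 W : ghomr_mor (gidm W) = gidm (ghomr W).
Proof. by apply: ghom_ext => i x; apply: dsum_ext => j; apply: lin_ext. Qed.
Lemma ghomr_morM W W' W'' (g : ghom W' W'') (h : ghom W W') :
  ghomr_mor (gcompm g h) = gcompm (ghomr_mor g) (ghomr_mor h).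
Proof. by apply: ghom_ext => i x; apply: dsum_ext => j; apply: lin_ext. Qed.
(* W |-> (the sum over j of Hom_(C_j)(P_j, W_(i,j)))_i *)
Definition Homf : functor (modc talgs) (modc B) :=
  @Functor (modc talgs) (modc B) ghomr ghomr_mor ghomr_mor1 ghomr_morM.
End HomFunctor.
End TensorHom.

(* S as a right R-module along f, i.e. as a left module over the converse ring *)
Definition rres (R S : pzRingType) (f : {rmorphism R -> S}) : Type := S.
Section RightRestriction.
Variables (R S : pzRingType) (f : {rmorphism R -> S}).
HB.instance Definition _ := GRing.Zmodule.on (rres f).
Definition rres_scale (a : R^c) (x : rres f) : rres f := (x : S) * f (a : R).
Lemma rres_scaleA a b x : rres_scale a (rres_scale b x) = rres_scale (a * b) x.
Proof. by rewrite /rres_scale -mulrA -rmorphM. Qed.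
Lemma rres_scale1 : left_id 1 rres_scale.
Proof. by move=> x; rewrite /rres_scale rmorph1 mulr1. Qed.
Lemma rres_scaleDr : right_distributive rres_scale +%R.
Proof. by move=> a x y; exact: mulrDl. Qed.
Lemma rres_scaleDl x : {morph rres_scale^~ x : a b / a + b}.
Proof. by move=> a b; rewrite /rres_scale rmorphD mulrDr. Qed.
HB.instance Definition _ := GRing.Zmodule_isLmodule.Build R^c (rres f)
  rres_scaleA rres_scale1 rres_scaleDr rres_scaleDl.
End RightRestriction.

Record tower (F : fieldType) := Tower {
  tw :> nat -> fdalg F;
  rho : forall m n, alghom (talg (tw m) (tw n)) (tw (m + n));
  rho_assoc : forall m n k (a : tw m) (b : tw n) (c : tw k),
    rho (m + n) k (tp (rho m n (tp a b)) c) =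
    ecast i (tw i) (addnA m n k) (rho m (n + k) (tp a (rho n k (tp b c))));
  rho_unit : exists e : tw 0, forall n (a : tw n),
    rho 0 n (tp e a) = a /\ ecast i (tw i) (addn0 n) (rho n 0 (tp a e)) = a;
  tower_deg0 : bijective (scal (tw 0));
  rho_projl : forall m n, projective (res (rho m n) (tw (m + n))^o);
  rho_projr : forall m n, projective (rres (rho m n));
  tower_perfect : forall n, perfect (@G0_K0_pairing F (tw n)) }.

Record algauts (F : fieldType) (A : tower F) := AlgAuts {
  psi : forall n, alghom (A n) (A n);
  psiV : forall n, alghom (A n) (A n);
  psiK : forall n, cancel (psi n) (psiV n);
  psiVK : forall n, cancel (psiV n) (psi n) }.

Definition addp (p : nat * nat) : nat := (p.1 + p.2)%N.
Definition addp2 (q : (nat * nat) * (nat * nat)) : nat * nat :=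
  (addp q.1, addp q.2).
Definition mid (q : (nat * nat) * (nat * nat)) : (nat * nat) * (nat * nat) :=
  ((q.1.1, q.2.1), (q.1.2, q.2.2)).

Lemma addp_fin : finite_fibres addp.
Proof.
move=> n; exists [seq (i, j) | i <- iota 0 n.+1, j <- iota 0 n.+1] => -[i j] <-.
apply: allpairs_f; rewrite mem_iota add0n ltnS /addp /=;
  by rewrite ?leq_addr ?leq_addl.
Qed.
Lemma addp2_fin : finite_fibres addp2.
Proof.
move=> [m n]; have [s hs] := addp_fin m; have [u hu] := addp_fin n.
by exists [seq (i, j) | i <- s, j <- u] => -[i j] [/hs si /hu uj]; apply: allpairs_f.
Qed.
Lemma mid_fin : finite_fibres mid.
Proof. by move=> q; exists [:: mid q] => -[[a b] [c d]] <-; rewrite inE. Qed.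
Lemma id_fin (I : choiceType) : @finite_fibres I I id.
Proof. by move=> i; exists [:: i] => j <-; rewrite inE. Qed.

Section TowerFunctors.
Variables (F : fieldType) (A : tower F).

Definition A2 : nat * nat -> fdalg F := talgs A A.
Definition A4 : (nat * nat) * (nat * nat) -> fdalg F := talgs A2 A2.

(* With A-mod = modc A and A-mod^(x)2 = modc A2, [rhop] is the multiplication of
   the tower: induction along it is nabla and restriction along it is Delta. *)
Definition rhop (p : nat * nat) : alghom (A2 p) (A (addp p)) := rho A p.1 p.2.
Definition rhop2 (q : (nat * nat) * (nat * nat)) : alghom (A4 q) (A2 (addp2 q)) :=
  thom (rhop q.1) (rhop q.2).
Definition flipp (q : (nat * nat) * (nat * nat)) : alghom (A4 q) (A4 (mid q)) :=
  tflip (A q.1.1) (A q.1.2) (A q.2.1) (A q.2.2).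

Definition nabla : functor (modc A2) (modc A) := Indf rhop.
Definition delta : functor (modc A) (modc A2) := Resf rhop addp_fin.
Definition nabla2 : functor (modc A4) (modc A2) := Indf rhop2.
Definition delta2 : functor (modc A2) (modc A4) := Resf rhop2 addp2_fin.
Definition S23 : functor (modc A4) (modc A4) := Resf flipp mid_fin.

Definition Ind (M : modc A) : functor (modc A) (modc A) := nabla \of Tensf A M.
(* For P projective this is Res_P, and for Q projective [Res2 Q M] is the functor
   N |-> Res_Q (M (x) N); the definitions make sense for all P and Q. *)
Definition Res (P : modc A) : functor (modc A) (modc A) := Homf A P \of delta.
Definition Res2 (Q : modc A2) (M : modc A) : functor (modc A) (modc A2) :=
  Homf A2 Q \of S23 \of Tensf A2 (delta M) \of delta.

Section Conjugation.
Variable c : algauts A.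
(* Psi twists by psi, so its inverse twists by the inverses psiV *)
Definition Psi : functor (modc A) (modc A) := Resf (t := id) (psi c) (@id_fin _).
Definition PsiV : functor (modc A) (modc A) := Resf (t := id) (psiV c) (@id_fin _).
Definition Psi2 : functor (modc A2) (modc A2) :=
  Resf (t := id) (fun p => thom (psi c p.1) (psi c p.2)) (@id_fin _).
Definition Psi2DeltaPsiV : functor (modc A) (modc A2) := Psi2 \of delta \of PsiV.

Definition strong : Prop :=
  right_adjoint nabla Psi2DeltaPsiV /\
  natiso (delta \of nabla) (nabla2 \of S23 \of delta2).
End Conjugation.
End TowerFunctors.

Section HopfAlgebra.
Variables (H : zmodType) (mul : H -> H -> H) (one : H).
Variables (comul : H -> tensZ H H) (counit : H -> int).

Definition tensZ_map (U U' V V' : zmodType) (f : U -> V) (g : U' -> V') :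
  tensZ U U' -> tensZ V V' := zlift (fun u u' => purez (f u) (g u')).
Definition tensZ_assoc (U V W : zmodType) :
  tensZ (tensZ U V) W -> tensZ U (tensZ V W) :=
  zlift (fun t w => zlift (fun u v => purez u (purez v w)) t).
Definition tensZ_mul (s t : tensZ H H) : tensZ H H :=
  zlift (fun x y => zlift (fun x' y' => purez (mul x x') (mul y y')) t) s.

Record is_hopf : Prop := IsHopf {
  hopf_mul_biadd : biadditive mul;
  hopf_mulA : associative mul;
  hopf_mul1 : left_id one mul;
  hopf_mulr1 : right_id one mul;
  hopf_comulD : {morph comul : x y / x + y};
  hopf_counitD : {morph counit : x y / x + y};
  hopf_coassoc : forall x,
    tensZ_assoc (tensZ_map comul id (comul x)) = tensZ_map id comul (comul x);
  hopf_counitl : forall x, zlift (fun y z => z *~ counit y) (comul x) = x;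
  hopf_counitr : forall x, zlift (fun y z => y *~ counit z) (comul x) = x;
  hopf_comulM : forall x y, comul (mul x y) = tensZ_mul (comul x) (comul y);
  hopf_comul1 : comul one = purez one one;
  hopf_counitM : forall x y, counit (mul x y) = counit x * counit y;
  hopf_counit1 : counit one = 1;
  hopf_antipode : exists S : {additive H -> H}, forall x,
    zlift (fun y z => mul (S y) z) (comul x) = one *~ counit x /\
    zlift (fun y z => mul y (S z)) (comul x) = one *~ counit x }.
End HopfAlgebra.

Section TowerGrothendieck.
Variables (F : fieldType) (A : tower F).

(* G(A) for k = Abelian, K(A) for k = Split *)
Definition GK (k : gkind) : zmodType := dsum (fun n => Groth (A n) k).

Section Operations.
Variable k : gkind.

Lemma gcls_supp (X : gmod A) :
  exists s : seq nat, forall n, n \notin s -> cls k (X n) = 0.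
Proof. by have [s s0] := gsupp X; exists s => n /s0 z; apply: cls0. Qed.
Definition gcls (X : gmod A) : GK k := DSum (gcls_supp X).

Definition gmul (x y : GK k) : GK k :=
  dlift (fun m a => dlift (fun n b =>
    glift (fun M => glift (fun N =>
      dinj (cls k (ind (rho A m n) (xtens M N))) : GK k) b) a) y) x.
Definition gone : GK k := dinj (cls k (A 0)^o).
(* A_0-mod is the category of vector spaces, and the class of A_0 is that of the
   field *)
Definition gcounit (x : GK k) : int :=
  glift (fun M => (dimv (resF M))%:Z) (dval x 0).

(* The (m, n) component of the map from GK (x) GK to the direct sum of the
   Grothendieck groups of the A_m (x) A_n *)
Definition gext (t : tensZ (GK k) (GK k)) (m n : nat) : Groth (talg (A m) (A n)) k :=
  zlift (fun x y : GK k =>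
    glift (fun M => glift (fun N =>
      cls k (xtens M N : lmodType (talg (A m) (A n)))) (dval y n)) (dval x m)) t.
(* Delta [M] is the sum of the [Res M], pulled back along the isomorphism [gext] *)
Definition gcomul (x : GK k) : tensZ (GK k) (GK k) :=
  xget 0 [set t | forall m n,
    gext t m n = glift (fun M => cls k (res (rho A m n) M)) (dval x (m + n)%N)]%classic.
End Operations.

Notation G := (GK Abelian).
Notation K := (GK Split).

Definition gpairing (x : K) (a : G) : int :=
  \sum_(n \in [set: nat]%classic) G0_K0_pairing (dval x n) (dval a n).
Definition gpairing2 (s : tensZ K K) (t : tensZ G G) : int :=
  zlift (fun x y => zlift (fun a b => gpairing x a * gpairing y b) t) s.

Definition dualizing : Prop :=
  [/\ is_hopf (@gmul Abelian) (gone Abelian) (@gcomul Abelian) (@gcounit Abelian),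
      is_hopf (@gmul Split) (gone Split) (@gcomul Split) (@gcounit Split) &
      [/\ forall x y a, gpairing (gmul x y) a = gpairing2 (purez x y) (gcomul a),
          forall x a b, gpairing x (gmul a b) = gpairing2 (gcomul x) (purez a b),
          forall a, gpairing (gone Split) a = gcounit a &
          forall x, gpairing x (gone Abelian) = gcounit x]].

Definition Rstar (x : K) (a : G) : G :=
  xget 0 [set b | forall y, gpairing y b = gpairing (gmul y x) a]%classic.

(* The Heisenberg double; [purez a x] is a # x *)
Definition heis : zmodType := tensZ G K.
Definition hmul (u v : heis) : heis :=
  zlift (fun (a : G) (x : K) => zlift (fun (b : G) (y : K) =>
    zlift (fun x1 x2 : K => purez (gmul a (Rstar x1 b)) (gmul x2 y) : heis)
      (gcomul x)) v) u.
(* The action on the lowest weight Fock space *)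
Definition hact (u : heis) (b : G) : G :=
  zlift (fun (a : G) (x : K) => gmul a (Rstar x b)) u.

Definition hG (a : G) : heis := purez a (gone Split).
Definition hK (x : K) : heis := purez (gone Abelian) x.

(* Sum of (R x_(1))^*(a) # x_(2), the normal form of xa *)
Definition hcross (x : K) (a : G) : heis :=
  zlift (fun x1 x2 : K => purez (Rstar x1 a) x2 : heis) (gcomul x).

(* The image of the Cartan map *)
Definition in_Gproj (a : G) : Prop :=
  exists x : K, forall n, dval a n = glift (fun P => cls Abelian P) (dval x n).
Definition in_hproj (u : heis) : Prop :=
  exists s : seq (G * K),
    (forall a x, (a, x) \in s -> in_Gproj a) /\ u = \sum_(p <- s) purez p.1 p.2.

Notation endof := (functor (modc A) (modc A)).
Notation clsG := (gcls Abelian).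
Notation clsK := (gcls Split).

Definition induces (T : endof) (phi : G -> G) : Prop :=
  [/\ exact_functor T, {morph phi : a b / a + b} &
      forall N, clsG (T N) = phi (clsG N)].

(* The isomorphism T = T' induces the relation uv = w of h(A) on the Fock space *)
Definition induces_relation (T T' : endof) (u v w : heis) : Prop :=
  [/\ natiso T T', hmul u v = w, induces T (hact u \o hact v) &
      induces T' (hact w)].

(* The restriction of T to A-pmod and of phi to the image of the Cartan map *)
Definition induces_proj (T : endof) (phi : G -> G) : Prop :=
  [/\ exact_functor T, forall N, gproj N -> gproj (T N),
      forall a, in_Gproj a -> in_Gproj (phi a),
      forall a b, in_Gproj a -> in_Gproj b -> phi (a + b) = phi a + phi b &
      forall N, gproj N -> clsG (T N) = phi (clsG N)].

Definition induces_relation_proj (T T' : endof) (u v w : heis) : Prop :=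
  [/\ exists (TP : forall N : modc A, gproj N -> gproj (T N))
        (TP' : forall N : modc A, gproj N -> gproj (T' N)),
        natiso (frestr TP) (frestr TP'),
      hmul u v = w, induces_proj T (hact u \o hact v) & induces_proj T' (hact w)].

Variable c : algauts A.

Definition categorifies_fock : Prop :=
  [/\ forall M, induces (Ind M) (hact (hG (clsG M))),
      forall P, gproj P -> induces (Res P) (hact (hK (clsK P))),
      forall M N, induces_relation (Ind M \of Ind N) (Ind (nabla A (gtens M N)))
        (hG (clsG M)) (hG (clsG N)) (hG (gmul (clsG M) (clsG N))),
      forall P Q, gproj P -> gproj Q ->
        induces_relation (Res P \of Res Q) (Res (nabla A (gtens P Q)))
          (hK (clsK P)) (hK (clsK Q)) (hK (gmul (clsK P) (clsK Q))) &
      forall M P, gproj P ->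
        induces_relation (Res P \of Ind M) (nabla A \of Res2 (Psi2DeltaPsiV c P) M)
          (hK (clsK P)) (hG (clsG M)) (hcross (clsK P) (clsG M))].

Definition categorifies_fock_proj : Prop :=
  (forall u v, in_hproj u -> in_hproj v -> in_hproj (hmul u v)) /\
  (forall u a, in_hproj u -> in_Gproj a -> in_Gproj (hact u a)) /\
  [/\ forall M, gproj M -> in_hproj (hG (clsG M)) /\
        induces_proj (Ind M) (hact (hG (clsG M))),
      forall P, gproj P -> in_hproj (hK (clsK P)) /\
        induces_proj (Res P) (hact (hK (clsK P))),
      forall M N, gproj M -> gproj N ->
        induces_relation_proj (Ind M \of Ind N) (Ind (nabla A (gtens M N)))
          (hG (clsG M)) (hG (clsG N)) (hG (gmul (clsG M) (clsG N))),
      forall P Q, gproj P -> gproj Q ->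
        induces_relation_proj (Res P \of Res Q) (Res (nabla A (gtens P Q)))
          (hK (clsK P)) (hK (clsK Q)) (hK (gmul (clsK P) (clsK Q))) &
      forall M P, gproj M -> gproj P ->
        induces_relation_proj (Res P \of Ind M)
          (nabla A \of Res2 (Psi2DeltaPsiV c P) M)
          (hK (clsK P)) (hG (clsG M)) (hcross (clsK P) (clsG M))].
End TowerGrothendieck.

(* Main.v *)
(* Ind_M Ind_N = Ind_(M N) is the associativity of tensor products, and
   Res_P Res_Q = Res_(P Q) is the adjunction between Hom and the tensor product.
   For the third isomorphism, Res_P Ind_M N is Hom(P, -) applied, in the second
   factor, to delta (nabla (M (x) N)), which is nabla2 S23 delta2 (M (x) N) when the
   tower is strong.  As P is projective, Hom(P, -) commutes with the induction in
   the first factor, and the adjunction between Psi2DeltaPsiV and nabla absorbs the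
   induction in the second.

   For the categorification, <[Q], [N]> is the dimension of the degree 0 part of
   Res_Q N, so that Res_Q Res_P = Res_(Q P) says that [Res_P N] and Rstar [P] [N] have
   the same pairing with every [Q]; they are equal since the pairing is perfect.  The
   relations in the Heisenberg double then follow from the axioms of a Hopf pairing
   alone, and the classes of the two sides of each isomorphism of functors agree
   because isomorphic functors have the same classes. *)

From HB Require Import structures.
Require Import Defs.
From mathcomp Require Import all_boot all_algebra.
From mathcomp Require Import boolp classical_sets fsbigop.
Import Defs.

Set Implicit Arguments.
Unset Strict Implicit.
Unset Printing Implicit Defensive.

Import GRing.Theory.
Local Open Scope ring_scope.
Local Open Scope quotient_scope.

(** * Universal properties of direct sums, induction and tensor products *)

(** The adjunction in [strong] compares whole families of maps, while the third isomorphism must be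
    linear over the first tensor factor. So a module W over four factors is cut into the graded
    modules W_(p, -), one for each p. The adjunction applies to each of them, and its naturality for
    the endomorphisms coming from [A2 p] is the required linearity. Only the unit P -> nabla Q and
    its universal property enter.

    Projectivity acts through dual bases: they describe Hom, restriction and induction by finitely
    many coordinates, which yields exactness, preservation of projectives and an explicit inverse of
    the comparison map [theta].

    Degrees such as i + (k + l) and i + k + l are equal but not convertible. Generators and
    structure maps therefore carry a proof of i + k = n, and such proofs are unique.

    Both Grothendieck groups are handled together: a short exact sequence of projective modules
    splits, so for either kind the relations amount to short exact sequences of admissible modules.

    [dimv] and [Rstar] are defined by choice, so a basis, respectively a representing element, has
    to be produced before they can be computed. *)

Section DirectSumLift.
Variables (I : choiceType) (M : I -> zmodType) (Z : zmodType).

Lemma dlift_supp (f : forall i, M i -> Z) (s : seq I) (x : dsum M) :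
  uniq s -> (forall i, i \notin s -> f i (x i) = 0) ->
  dlift f x = \sum_(i <- s) f i (x i).
Proof.
by move=> us s0; rewrite /dlift -set_true -(bigfs _ us) // => i _ /s0.
Qed.

Lemma dliftE (f : forall i, M i -> Z) (s : seq I) (x : dsum M) :
  (forall i, f i 0 = 0) -> uniq s -> (forall i, i \notin s -> x i = 0) ->
  dlift f x = \sum_(i <- s) f i (x i).
Proof. by move=> f0 us s0; apply: dlift_supp => // i /s0 ->. Qed.

Lemma dsumE (x : dsum M) (s : seq I) :
  uniq s -> (forall i, i \notin s -> x i = 0) ->
  x = \sum_(i <- s) dinj (x i).
Proof.
move=> us s0; apply: dsum_ext => i; rewrite dsum_sumE.
have [si|si] := boolP (i \in s).
  rewrite (bigD1_seq i) // [X in _ = _ + X]big1 ?addr0 => [|j ji].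
    exact: esym (dinj_same _).
  by rewrite dinj_other.
rewrite s0 // big_seq big1 // => j js; rewrite dinj_other //.
by apply: contraNneq si => <-.
Qed.

Lemma dsum_uniq_supp (x : dsum M) :
  exists2 s : seq I, uniq s & forall i, i \notin s -> x i = 0.
Proof.
have [s s0] := dsupp x; exists (undup s); first exact: undup_uniq.
by move=> i; rewrite mem_undup; exact: s0.
Qed.

Lemma dsumDE (x y : dsum M) i : (x + y) i = x i + y i.
Proof. by []. Qed.

Lemma dinjD i (a b : M i) : dinj (a + b) = dinj a + dinj b.
Proof.
apply: dsum_ext => j; have [<-|ij] := eqVneq i j.
  by rewrite dsumDE !dinj_same.
by rewrite dsumDE !dinj_other // addr0.
Qed.

Lemma dinj0 i : dinj (0 : M i) = 0.
Proof. by apply: (addIr (dinj (0 : M i))); rewrite -dinjD !add0r. Qed.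

Lemma dinj_sum (K : Type) (r : seq K) i (f : K -> M i) :
  dinj (\sum_(k <- r) f k) = \sum_(k <- r) dinj (f k).
Proof. exact: (big_morph (@dinj I M i) (@dinjD i) (dinj0 i)). Qed.

Lemma dsum_ind (P : dsum M -> Prop) : P 0 ->
  (forall x y, P x -> P y -> P (x + y)) -> (forall i m, P (dinj (i := i) m)) ->
  forall x, P x.
Proof.
move=> P0 PD Pi x; have [s us s0] := dsum_uniq_supp x.
by rewrite (dsumE us s0); apply: big_ind.
Qed.

Section Additive.
Variable f : forall i, M i -> Z.
Arguments f : clear implicits.
Hypothesis fD : forall i, {morph f i : a b / a + b}.
Let f0 i : f i 0 = 0.
Proof. by apply: (addIr (f i 0)); rewrite -fD !add0r. Qed.

Lemma dliftD : {morph dlift f : x y / x + y}.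
Proof.
move=> x y; have [s us s0] := dsum_uniq_supp x.
have [t ut t0] := dsum_uniq_supp y.
have h i : i \notin undup (s ++ t) -> x i = 0 /\ y i = 0.
  by rewrite mem_undup mem_cat negb_or => /andP[/s0 -> /t0 ->].
rewrite !(dliftE f0 (undup_uniq (s ++ t))) => [|i /h[]|i /h[]|i /h[hx hy]] //.
  by rewrite -big_split; apply: eq_bigr => i _; exact: fD.
by rewrite [LHS]/= hx hy addr0.
Qed.

Lemma dlift_dinj i (m : M i) : dlift f (dinj m) = f i m.
Proof.
rewrite (@dliftE _ [:: i]) //; first by rewrite big_seq1 dinj_same.
by move=> j; rewrite inE => ji; rewrite dinj_other // eq_sym.
Qed.
End Additive.

Lemma dsum_addE (g h : dsum M -> Z) :
  {morph g : x y / x + y} -> {morph h : x y / x + y} ->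
  (forall i m, g (dinj (i := i) m) = h (dinj m)) -> g =1 h.
Proof.
move=> gD hD gh; elim/dsum_ind => [|x y ex ey|i m]; last exact: gh.
- have a0 (k : dsum M -> Z) : {morph k : x y / x + y} -> k 0 = 0.
    by move=> kD; apply: (addIr (k 0)); rewrite -kD !add0r.
  by rewrite !a0.
- by rewrite gD hD ex ey.
Qed.
End DirectSumLift.

Section DirectSumModuleLift.
Variables (R : pzRingType) (I : choiceType) (M : I -> lmodType R) (N : lmodType R).

Lemma dsummZE a (x : dsumm M) i : dval (a *: x) i = a *: dval x i.
Proof. by []. Qed.

Lemma dinjZ i a (m : M i) : dinj (a *: m) = a *: (dinj m : dsumm M).
Proof.
apply: dsum_ext => j; have [<-|ij] := eqVneq i j.
  by rewrite dsummZE !dinj_same.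
by rewrite dsummZE !dinj_other // scaler0.
Qed.
Definition dinj_map i : {linear M i -> dsumm M} :=
  lin_of (f := fun m : M i => dinj m : dsumm M) (@dinjD I M i) (@dinjZ i).

Variable f : forall i, {linear M i -> N}.
Let fD i : {morph f i : a b / a + b} := linearD (f i).
Lemma dsumm_liftZ a (x : dsumm M) : dlift f (a *: x) = a *: dlift f x.
Proof.
apply: (dsum_addE (g := fun x => dlift f (a *: (x : dsumm M)))
  (h := fun x => a *: dlift f x)) => [y z|y z|i m].
- by rewrite scalerDr dliftD.
- by rewrite dliftD // scalerDr.
by rewrite -dinjZ !dlift_dinj // linearZ.
Qed.
Lemma dsumm_liftD : {morph (dlift f : dsumm M -> N) : x y / x + y}.
Proof. exact: (dliftD fD). Qed.
Definition dsumm_lift : {linear dsumm M -> N} := lin_of dsumm_liftD dsumm_liftZ.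
Lemma dsumm_lift_dinj i (m : M i) : dsumm_lift (dinj m) = f i m.
Proof. exact: dlift_dinj. Qed.

End DirectSumModuleLift.

Lemma dmap_dinj (R : pzRingType) (I : choiceType) (M N : I -> lmodType R)
    (h : forall i, {linear M i -> N i}) i (m : M i) :
  dmap h (dinj m) = dinj (h i m).
Proof.
apply: dsum_ext => j; rewrite [LHS]/(h j _).
have [<-|ij] := eqVneq i j; first by rewrite !dinj_same.
by rewrite !dinj_other //; exact: linear0.
Qed.

Lemma lin_eq_dsumm (R : pzRingType) (I : choiceType) (M : I -> lmodType R)
    (N : lmodType R) (g h : {linear dsumm M -> N}) :
  (forall i m, g (dinj (i := i) m) = h (dinj m)) -> g =1 h.
Proof. move=> gh; apply: dsum_addE => //; [exact: (linearD g)|exact: (linearD h)]. Qed.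

Section InducedLift.
Variables (R S : pzRingType) (f : {rmorphism R -> S}) (M : lmodType R).
Variables (N : lmodType S) (h : M -> N).
Hypotheses (hD : {morph h : x y / x + y}) (hZ : forall a x, h (a *: x) = f a *: h x).

Lemma ind_lift_balanced :
  balanced (ind_ra f) (@ind_la R M) (fun c m => c *: h m).
Proof.
split=> [c c' m|c m m'|c a m]; first exact: scalerDl.
  by rewrite hD scalerDr.
by rewrite /ind_ra /ind_la hZ scalerA.
Qed.
Definition ind_lift_fun : ind f M -> N := tlift (fun c m => c *: h m).
Lemma ind_lift_pure c m : ind_lift_fun (ipure f c m) = c *: h m.
Proof. exact: (tlift_pure ind_lift_balanced). Qed.
Lemma ind_liftD : {morph ind_lift_fun : x y / x + y}.
Proof. exact: (tliftD ind_lift_balanced). Qed.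
Lemma ind_liftZ a (x : ind f M) : ind_lift_fun (a *: x) = a *: ind_lift_fun x.
Proof.
move: x; apply: ind_ext => [x y|x y|c m].
- by rewrite scalerDr ind_liftD.
- by rewrite ind_liftD scalerDr.
by rewrite ind_scaleE !ind_lift_pure scalerA.
Qed.
Definition ind_lift : {linear ind f M -> N} := lin_of ind_liftD ind_liftZ.
Lemma ind_liftE c m : ind_lift (ipure f c m) = c *: h m.
Proof. exact: ind_lift_pure. Qed.
Lemma ind_lift1 m : ind_lift (ipure f 1 m) = h m.
Proof. by rewrite ind_liftE scale1r. Qed.
End InducedLift.

Lemma ipureD (R S : pzRingType) (f : {rmorphism R -> S}) (M : lmodType R) (c : S) :
  {morph @ipure R S f M c : m m' / m + m'}.
Proof. by move=> m m'; exact: tpureDr. Qed.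

Lemma lin_eq_ind (R S : pzRingType) (f : {rmorphism R -> S}) (M : lmodType R)
    (N : lmodType S) (g h : {linear ind f M -> N}) :
  (forall m, g (ipure f 1 m) = h (ipure f 1 m)) -> g =1 h.
Proof.
move=> gh; apply: ind_ext => [||c m]; [exact: (linearD g)|exact: (linearD h)|].
by rewrite -[c]mulr1 -ind_scaleE !linearZ gh.
Qed.

Lemma ind_map_pure (R S : pzRingType) (f : {rmorphism R -> S}) (M N : lmodType R)
    (h : {linear M -> N}) c m :
  ind_map f h (ipure f c m) = ipure f c (h m).
Proof. exact: ind_fun_pure. Qed.

Section ExternalTensorLift.
Variables (F : fieldType) (B C : fdalg F) (M : lmodType B) (N : lmodType C).
Variables (Z : lmodType (talg B C)) (h : M -> N -> Z).
Hypotheses (hDl : forall n, {morph h^~ n : x y / x + y})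
  (hDr : forall m, {morph h m : x y / x + y})
  (hZ : forall b c m n, h (b *: m) (c *: n) = (tp b c : talg B C) *: h m n).

Lemma xtens_lift_balanced : balanced (@rscal F B M) (@lscal F C N) h.
Proof.
split=> [m m' n|m n n'|m k n]; [exact: hDl|exact: hDr|].
rewrite /rscal /lscal -[n in LHS]scale1r -[m in RHS]scale1r !hZ.
by rewrite -[scal B k]mulr1 tpS mulr1.
Qed.
Definition xtens_lift_fun : xtens M N -> Z := tlift h.
Lemma xtens_lift_pure m n : xtens_lift_fun (xpure m n) = h m n.
Proof. exact: (tlift_pure xtens_lift_balanced). Qed.
Lemma xtens_liftD : {morph xtens_lift_fun : x y / x + y}.
Proof. exact: (tliftD xtens_lift_balanced). Qed.
Lemma xtens_liftZ (t : talg B C) (x : xtens M N) :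
  xtens_lift_fun (t *: x) = t *: xtens_lift_fun x.
Proof.
elim/tring_ind: t => [s t es et|b c]; first by rewrite !scalerDl xtens_liftD es et.
move: x; apply: xtens_addE => [x y|x y|m n].
- by rewrite scalerDr xtens_liftD.
- by rewrite xtens_liftD scalerDr.
by rewrite -[tp b c *: xpure m n]/(xact _ _) xact_pure !xtens_lift_pure hZ.
Qed.
Definition xtens_lift : {linear (xtens M N : lmodType (talg B C)) -> Z} :=
  lin_of xtens_liftD xtens_liftZ.
Lemma xtens_liftE m n : xtens_lift (xpure m n) = h m n.
Proof. exact: xtens_lift_pure. Qed.
End ExternalTensorLift.

Lemma xpureDl (F : fieldType) (B C : fdalg F) (M : lmodType B) (N : lmodType C)
  (n : N) : {morph @xpure F B C M N ^~ n : x y / x + y}.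
Proof. by move=> x y; exact: tpureDl. Qed.
Lemma xpureDr (F : fieldType) (B C : fdalg F) (M : lmodType B) (N : lmodType C)
  (m : M) : {morph @xpure F B C M N m : x y / x + y}.
Proof. by move=> x y; exact: tpureDr. Qed.
Lemma xpureZ (F : fieldType) (B C : fdalg F) (M : lmodType B) (N : lmodType C)
    (b : B) (c : C) (m : M) (n : N) :
  xpure (b *: m) (c *: n) = (tp b c : talg B C) *: xpure m n.
Proof. exact: esym (xact_pure _ _ _ _). Qed.

Lemma xtens_map_pure (F : fieldType) (B C : fdalg F) (M M' : lmodType B)
    (N N' : lmodType C) (g : {linear M -> M'}) (h : {linear N -> N'}) m n :
  xtens_map g h (xpure m n) = xpure (g m) (h n).
Proof. exact: xtens_fun_pure. Qed.

(** * Dual bases, projectivity and exactness *)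

Section DualBasis.
Variable R : pzRingType.

(** The data of the dual basis lemma. The [e i] may satisfy relations, and [d i (e j)] is not
    prescribed. *)
Definition dual_basis (P : lmodType R) n (e : 'I_n -> P)
    (d : 'I_n -> {linear P -> R^o}) : Prop :=
  forall p, p = \sum_i (d i p : R) *: e i.

Lemma dualZ (P : lmodType R) (d : {linear P -> R^o}) a x :
  d (a *: x) = a * (d x : R).
Proof. exact: (linearZ_LR d). Qed.

Section Free.
Variables (P : lmodType R) (n : nat) (e : 'I_n -> P).
Definition free_fun (c : {ffun 'I_n -> R^o}) : P := \sum_i (c i : R) *: e i.
Lemma free_funD : {morph free_fun : x y / x + y}.
Proof.
by move=> x y; rewrite -big_split; apply: eq_bigr => i _; rewrite ffunE scalerDl.
Qed.
Lemma free_funZ a x : free_fun (a *: x) = a *: free_fun x.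
Proof.
by rewrite scaler_sumr; apply: eq_bigr => i _; rewrite ffunE -scalerA.
Qed.
Definition free_map : {linear {ffun 'I_n -> R^o} -> P} := lin_of free_funD free_funZ.
End Free.

(** The identity of P lifts through the surjection R^n -> P given by generators; the components of
    the lift are the functionals. *)
Lemma projective_dual_basis (P : lmodType R) : projective P -> fgen P ->
  exists n (e : 'I_n -> P) (d : 'I_n -> {linear P -> R^o}), dual_basis e d.
Proof.
move=> pP [n [e he]].
have [] := pP _ _ (free_map e) idfun.
  by move=> y; have [c ->] := he y; exists [ffun i => c i : R^o];
    apply: eq_bigr => i _; rewrite ffunE.
move=> h hK; exists n, e.
have hD i : {morph (fun p => (h p : {ffun 'I_n -> R^o}) i) : x y / x + y}.
  by move=> x y; rewrite linearD ffunE.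
have hZ i a x : (h (a *: x) : {ffun 'I_n -> R^o}) i = a *: (h x) i.
  by rewrite linearZ ffunE.
by exists (fun i => lin_of (hD i) (hZ i)) => p; rewrite -[LHS]hK.
Qed.

(** The hypothesis on [a] and [b] says that M is a retract of the direct sum of the N_i, without
    forming that sum. Every preservation result for projectives that rests on a dual basis goes
    through this form. *)
Lemma projective_coords (n : nat) (M : lmodType R) (N : 'I_n -> lmodType R)
    (a : forall i, {linear M -> N i}) (b : forall i, {linear N i -> M}) :
  (forall i, projective (N i)) -> (forall x, x = \sum_i b i (a i x)) ->
  projective M.
Proof.
move=> pN ab L L' g f gs.
have hx i : exists h : {linear N i -> L}, forall p, g (h p) = f (b i p).
  exact: (pN i _ _ g (f \o b i : {linear _ -> _}) gs).
pose h i := projT1 (cid (hx i)).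
have hP i p : g (h i p) = f (b i p) by exact: (projT2 (cid (hx i))).
pose k x := \sum_i h i (a i x).
have kD : {morph k : x y / x + y}.
  by move=> x y; rewrite -big_split; apply: eq_bigr => i _; rewrite !linearD.
have kZ c x : k (c *: x) = c *: k x.
  by rewrite scaler_sumr; apply: eq_bigr => i _; rewrite !linearZ.
exists (lin_of kD kZ) => x; rewrite [in RHS](ab x) !linear_sum.
by apply: eq_bigr => i _; exact: hP.
Qed.

(** The values of h lie in the kernel of g, which is the image of f; the pointwise preimages form a
    linear map because f is injective. This is left exactness of Hom. *)
Lemma ses_factor (M' M M'' P : lmodType R) (f : {linear M' -> M})
    (g : {linear M -> M''}) (h : {linear P -> M}) :
  ses f g -> (forall p, g (h p) = 0) ->
  exists h' : {linear P -> M'}, forall p, h p = f (h' p).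
Proof.
move=> [fI fg _] gh; have ex p : exists y, h p = f y by apply/fg; exact: gh.
have /choice[k kE] := ex.
have kD : {morph k : x y / x + y}.
  by move=> x y; apply: fI; rewrite linearD -!kE linearD.
have kZ a x : k (a *: x) = a *: k x by apply: fI; rewrite linearZ /= -!kE linearZ.
by exists (lin_of kD kZ) => p; exact: kE.
Qed.

Lemma projective_regular : projective (R^o : lmodType R).
Proof.
move=> M N g f gs; have [x gx] := gs (f 1).
have hD : {morph (fun a : R^o => (a : R) *: x) : a b / a + b}.
  by move=> a b; exact: scalerDl.
have hZ (a : R) (b : R^o) : (a *: b : R) *: x = a *: ((b : R) *: x).
  by rewrite scalerA.
exists (lin_of hD hZ) => p; rewrite [LHS]linearZ /= gx -linearZ.
by congr (f _); exact: mulr1.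
Qed.

Lemma projective_bij (M N : lmodType R) (f : {linear M -> N}) :
  bijective f -> projective M -> projective N.
Proof.
move=> [f' fK f'K] pM L L' g h gs.
have [k kP] := pM _ _ g (h \o f : {linear _ -> _}) gs.
have f'D : {morph f' : x y / x + y}.
  by move=> x y; rewrite -{1}[x]f'K -{1}[y]f'K -linearD fK.
have f'Z a x : f' (a *: x) = a *: f' x by rewrite -{1}[x]f'K -linearZ fK.
exists (k \o lin_of f'D f'Z : {linear _ -> _}) => p.
by rewrite [LHS]kP /= /lin_of_fun f'K.
Qed.

Lemma projective_zero (M : lmodType R) : zero_module M -> projective M.
Proof.
move=> M0 L L' g f _; exists (GRing.null_fun L : {linear M -> L}) => p.
by rewrite (M0 p) !linear0.
Qed.

Lemma projective_dsumm (I : choiceType) (M : I -> lmodType R) :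
  (forall i, projective (M i)) -> projective (dsumm M).
Proof.
move=> pM L L' g f gs.
have hx i : exists h : {linear M i -> L}, forall p, g (h p) = f (dinj_map M i p).
  exact: (pM i _ _ g (f \o dinj_map M i : {linear _ -> _}) gs).
pose h i := projT1 (cid (hx i)).
have hP i p : g (h i p) = f (dinj_map M i p) by exact: (projT2 (cid (hx i))).
exists (dsumm_lift h).
apply: (lin_eq_dsumm (g := g \o dsumm_lift h : {linear _ -> _})) => i m.
by rewrite [LHS]/= dsumm_lift_dinj hP.
Qed.
End DualBasis.

Section InductionCoordinates.
Variables (R S : pzRingType) (f : {rmorphism R -> S}) (n : nat).
Variables (e : 'I_n -> rres f) (d : 'I_n -> {linear rres f -> (R^c)^o}).
Hypothesis ed : dual_basis e d.

Section Object.
Variable M : lmodType R.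
(** The k-th coordinate on S (x)_R M is d_k (x) id. S is a right R-module here, so [d k] is linear
    over the converse ring, which is what makes this map balanced. *)
Definition icoord_fun k (c : S) (m : M) : M := (d k c : R) *: m.
Lemma icoord_balanced k : balanced (ind_ra f) (@ind_la R M) (icoord_fun k).
Proof.
split=> [c c' m|c m m'|c b m]; rewrite /icoord_fun.
- by rewrite (linearD (d k)) scalerDl.
- exact: scalerDr.
have -> : d k (ind_ra f c b) = (d k c : R) * b by exact: (linearZ_LR (d k) b c).
by rewrite scalerA.
Qed.
Definition icoord k : ind f M -> M := tlift (icoord_fun k).
Lemma icoordD k : {morph icoord k : x y / x + y}.
Proof. exact: (tliftD (icoord_balanced k)). Qed.
Lemma icoord0 k : icoord k 0 = 0.
Proof. exact: (tlift0 (icoord_balanced k)). Qed.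
Lemma icoord_pure k c m : icoord k (ipure f c m) = (d k c : R) *: m.
Proof. exact: (tlift_pure (icoord_balanced k)). Qed.
Lemma icoordE x : x = \sum_k ipure f (e k : S) (icoord k x).
Proof.
move: x; apply: ind_ext => [//|x y|c m].
  by rewrite -big_split; apply: eq_bigr => k _; rewrite icoordD ipureD.
under eq_bigr => k _ do rewrite icoord_pure -ipureS.
rewrite -(big_morph (fun c => ipure f c m) (fun c c' => tpureDl _ _ c c' m)
  (tpure0l _ _ m)).
by congr (ipure f _ m); exact: ed.
Qed.
End Object.

Lemma icoord_map (M N : lmodType R) (h : {linear M -> N}) k x :
  icoord k (ind_map f h x) = h (icoord k x).
Proof.
move: x; apply: ind_ext => [x y|x y|c m].
- by rewrite linearD icoordD.
- by rewrite icoordD linearD.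
by rewrite ind_map_pure !icoord_pure linearZ.
Qed.

(* Coordinates are natural in M and determine elements of the induced module, so
   exactness can be tested on them. *)
Lemma ind_ses_coords (M' M M'' : lmodType R) (g : {linear M' -> M})
    (h : {linear M -> M''}) :
  ses g h -> ses (ind_map f g) (ind_map f h).
Proof.
move=> [gI gh hs]; split=> [x y xy|x|z].
- rewrite [x]icoordE [y]icoordE; apply: eq_bigr => k _; congr ipure.
  by apply: gI; rewrite -!icoord_map xy.
- split=> [hx|[y ->]]; last first.
    rewrite [y]icoordE (linear_sum (ind_map f g))
      (linear_sum (ind_map f h)) big1 // => k _.
    rewrite !ind_map_pure.
    have -> : h (g (icoord k y)) = 0 by apply/gh; exists (icoord k y).
    exact: tpure0r.
  have /choice[y hy] k : exists y, icoord k x = g y.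
    by apply/gh; rewrite -icoord_map hx; exact: icoord0.
  exists (\sum_k ipure f (e k : S) (y k)); rewrite linear_sum {1}[x]icoordE.
  by apply: eq_bigr => k _; rewrite hy; rewrite ind_map_pure.
have /choice[y hy] k : exists y, h y = icoord k z by exact: hs.
exists (\sum_k ipure f (e k : S) (y k)); rewrite linear_sum [RHS]icoordE.
by apply: eq_bigr => k _; rewrite -hy; rewrite ind_map_pure.
Qed.
End InductionCoordinates.

Section AlgebraInduction.
Variables (F : fieldType) (B C : fdalg F) (f : alghom B C).

Lemma fgen_rres : fgen (rres f).
Proof.
have [n [s hs]] := alg_fin C; exists n, s => c; have [k kE] := hs c.
exists (fun i => scal B (k i)); rewrite [LHS]kE; apply: eq_bigr => i _.
rewrite res_scaleE -[LHS]/(scal C (k i) * (s i : C)) scal_central -(ahom_scal f).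
by [].
Qed.

Lemma ind_ses (M' M M'' : lmodType B) (g : {linear M' -> M})
    (h : {linear M -> M''}) :
  projective (rres f) -> ses g h -> ses (ind_map f g) (ind_map f h).
Proof.
move=> pf; have [n [e [d ed]]] := projective_dual_basis pf fgen_rres.
exact: (ind_ses_coords ed).
Qed.
End AlgebraInduction.

(** Induction is left adjoint to restriction, and restriction preserves surjections: lift the map m
    |-> h (1 (x) m) over R, then extend it to the induced module. *)
Lemma projective_ind (R S : pzRingType) (f : {rmorphism R -> S}) (M : lmodType R) :
  projective M -> projective (ind f M).
Proof.
move=> pM L L' g h gs.
pose i (m : M) : res f L' := h (ipure f 1 m).
have iD : {morph i : x y / x + y}.
  by move=> x y; rewrite /i ipureD linearD.
have iZ a x : i (a *: x) = a *: i x.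
  by rewrite /i res_scaleE -linearZ ind_scaleE mulr1 -ipureS mul1r.
have [k kP] := pM (res f L) (res f L') (res_map f g) (lin_of iD iZ) gs.
exists (ind_lift (N := L) (h := k) (linearD k) (linearZ_LR k)).
apply: (lin_eq_ind (g := g \o _ : {linear _ -> _})) => m.
by rewrite -[LHS]/(g (ind_lift _ _ _)) ind_lift1; exact: kP.
Qed.

(** * Bases and dimensions of vector spaces *)

Section FieldModules.
Variable F : fieldType.

Definition fbasis (V : lmodType F) d (e : 'I_d -> V) : Prop :=
  forall v, exists! c : {ffun 'I_d -> F}, v = \sum_i c i *: e i.

Lemma fbasisP (V : lmodType F) d (e : 'I_d -> V) :
  (forall v, exists c : 'I_d -> F, v = \sum_i c i *: e i) ->
  (forall c : 'I_d -> F, \sum_i c i *: e i = 0 -> forall i, c i = 0) -> fbasis e.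
Proof.
move=> gen free v; have [c cE] := gen v; exists [ffun i => c i]; split.
  by rewrite cE; apply: eq_bigr => i _; rewrite ffunE.
move=> c' c'E; apply/ffunP => i; rewrite ffunE; apply/eqP.
rewrite -subr_eq0; apply/eqP; apply: (free (fun i => c i - c' i)).
under eq_bigr => j _ do rewrite scalerBl.
by rewrite sumrB -cE -c'E subrr.
Qed.

Lemma fbasis_free (V : lmodType F) d (e : 'I_d -> V) : fbasis e ->
  forall c : 'I_d -> F, \sum_i c i *: e i = 0 -> forall i, c i = 0.
Proof.
move=> b c c0 i; have [x [_ xu]] := b 0.
transitivity ([ffun i => c i] i); first by rewrite ffunE.
have <- : x = [ffun i => c i].
  by apply: xu; rewrite -{1}c0; apply: eq_bigr => j _; rewrite ffunE.
have -> : x = [ffun=> 0]; last by rewrite ffunE.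
by apply: xu; rewrite big1 // => j _; rewrite ffunE scale0r.
Qed.

(** A generating family of least size is free: a nontrivial relation would express one member by the
    others, and that member could be dropped. *)
Lemma fgen_fbasis (V : lmodType F) : fgen V -> exists d (e : 'I_d -> V), fbasis e.
Proof.
move=> fV.
pose P n := `[< exists e : 'I_n -> V,
  forall v, exists c : 'I_n -> F, v = \sum_i c i *: e i >].
have exP : exists n, P n by case: fV => n h; exists n; apply/asboolP.
case: (ex_minnP exP) => n /asboolP[e he] nmin; exists n, e.
apply: fbasisP => // c c0 i; apply: contrapT => /eqP ci.
case: n i e he nmin c c0 ci => [[]//|n] i e he nmin c c0 ci.
have /nmin : P n; last by rewrite ltnn.
apply/asboolP; exists (e \o lift i) => v; have [b bE] := he v.
(* The relation gives e_i = - c_i^-1 * (the sum of the other c_j e_j); substituting this into the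
   expansion of v yields these coefficients. *)
exists (fun j => b (lift i j) - b i * (c i)^-1 * c (lift i j)).
under eq_bigr => j _ do rewrite scalerBl -scalerA.
rewrite sumrB -scaler_sumr bE (bigD1_ord i) //= addrC; congr (_ + _).
move: c0; rewrite (bigD1_ord i) //= => /eqP; rewrite addr_eq0 => /eqP c0.
by rewrite -scalerN -c0 scalerA -mulrA mulVf // mulr1.
Qed.

Section Coordinates.
Variables (V : lmodType F) (d : nat) (e : 'I_d -> V).
Hypothesis be : fbasis e.
Definition fcoord v : {ffun 'I_d -> F} := projT1 (cid (be v)).
Lemma fcoordE v : v = \sum_i fcoord v i *: e i.
Proof. by case: (projT2 (cid (be v))). Qed.
Lemma fcoord_uniq v (c : {ffun 'I_d -> F}) : v = \sum_i c i *: e i -> fcoord v = c.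
Proof. by case: (projT2 (cid (be v))) => _; apply. Qed.
Lemma fcoordD i : {morph (fun v => fcoord v i : F^o) : x y / x + y}.
Proof.
move=> x y /=; rewrite (@fcoord_uniq (x + y) [ffun i => fcoord x i + fcoord y i]).
  by rewrite ffunE.
rewrite {1}[x]fcoordE {1}[y]fcoordE -big_split; apply: eq_bigr => j _.
by rewrite ffunE scalerDl.
Qed.
Lemma fcoordZ i a v : (fcoord (a *: v) i : F^o) = a *: (fcoord v i : F^o).
Proof.
rewrite (@fcoord_uniq (a *: v) [ffun i => a * fcoord v i]); first by rewrite ffunE.
rewrite {1}[v]fcoordE scaler_sumr; apply: eq_bigr => j _.
by rewrite ffunE scalerA.
Qed.
Definition fdual i : {linear V -> F^o} := lin_of (fcoordD i) (fcoordZ i).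
Lemma fdual_basis : dual_basis e fdual.
Proof. exact: fcoordE. Qed.
End Coordinates.

Lemma fgen_dual_basis (V : lmodType F) : fgen V ->
  exists n (e : 'I_n -> V) (d : 'I_n -> {linear V -> F^o}), dual_basis e d.
Proof.
by move=> /fgen_fbasis[n [e be]]; exists n, e, (fdual be); exact: fdual_basis.
Qed.

(** The matrix of f in the two bases has independent rows, so its rank d is bounded by the number d'
    of its columns. *)
Lemma fbasis_size (V W : lmodType F) d d' (e : 'I_d -> V) (e' : 'I_d' -> W)
    (f : {linear V -> W}) :
  injective f -> fbasis e -> fbasis e' -> (d <= d')%N.
Proof.
move=> fI be be'.
pose A : 'M[F]_(d, d') := \matrix_(i, j) fcoord be' (f (e i)) j.
have fE (r : 'rV_d) : f (\sum_i r 0 i *: e i) = \sum_j (r *m A) 0 j *: e' j.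
  rewrite linear_sum.
  under [RHS]eq_bigr => j _ do rewrite mxE scaler_suml.
  rewrite exchange_big; apply: eq_bigr => i _.
  rewrite linearZ /= {1}[f (e i)](fcoordE be') scaler_sumr.
  by apply: eq_bigr => j _; rewrite mxE scalerA.
suff /eqP <- : row_free A by exact: rank_leq_col.
apply/inj_row_free => r r0; apply/rowP => i; rewrite mxE.
apply: (fbasis_free be (c := r 0)); apply: fI.
by rewrite fE r0 linear0 big1 // => j _; rewrite mxE scale0r.
Qed.

Lemma dimv_fbasis (V : lmodType F) d (e : 'I_d -> V) : fbasis e -> dimv V = d.
Proof.
move=> be; rewrite /dimv; case: xgetP => [k _ [e' be']|/(_ d)[]]; last by exists e.
apply/eqP; rewrite eqn_leq.
by rewrite (@fbasis_size _ _ _ _ e' e idfun) ?(@fbasis_size _ _ _ _ e e' idfun).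
Qed.

Lemma dimv_ses (V' V V'' : lmodType F) (f : {linear V' -> V})
    (g : {linear V -> V''}) : fgen V' -> fgen V'' -> ses f g ->
  dimv V = (dimv V' + dimv V'')%N.
Proof.
move=> /fgen_fbasis[m [e be]] /fgen_fbasis[n [e' be']] [fI fg gs].
rewrite (dimv_fbasis be) (dimv_fbasis be').
have /choice[s sP] i : exists v, g v = e' i by exact: gs.
(* The basis of V: the images of the basis of V', followed by preimages of the basis of V''. *)
pose b (i : 'I_(m + n)) := match split i with inl j => f (e j) | inr j => s j end.
have bE (c : 'I_(m + n) -> F) : \sum_i c i *: b i =
    f (\sum_i c (lshift n i) *: e i) + \sum_i c (rshift m i) *: s i.
  rewrite big_split_ord linear_sum; congr (_ + _); apply: eq_bigr => i _.
    by rewrite linearZ /b (unsplitK (inl i : 'I_m + 'I_n)).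
  by rewrite /b (unsplitK (inr i : 'I_m + 'I_n)).
have gE (c : 'I_(m + n) -> F) : g (\sum_i c i *: b i) =
    \sum_i c (rshift m i) *: e' i.
  rewrite bE linearD (linear_sum g).
  have -> : g (f (\sum_i c (lshift n i) *: e i)) = 0 by apply/fg; eexists.
  by rewrite add0r; apply: eq_bigr => i _; rewrite linearZ /= sP.
suff bb : fbasis b by exact: dimv_fbasis bb.
apply: fbasisP => [v|c c0].
  pose y := \sum_i fcoord be' (g v) i *: s i.
  have /fg[x xE] : g (v - y) = 0.
    rewrite linearB [X in X - _](fcoordE be') linear_sum -sumrB big1 // => i _.
    by rewrite linearZ /= sP subrr.
  exists (fun i => match split i with
    inl j => fcoord be x j | inr j => fcoord be' (g v) j end).
  rewrite bE -[LHS](subrK y) xE; congr (f _ + _).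
    rewrite [LHS](fcoordE be); apply: eq_bigr => i _.
    by rewrite (unsplitK (inl i : 'I_m + 'I_n)).
  by apply: eq_bigr => i _; rewrite (unsplitK (inr i : 'I_m + 'I_n)).
have cr : forall i, c (rshift m i) = 0.
  by apply: (fbasis_free be' (c := fun i => c (rshift m i))); rewrite -gE c0 linear0.
have cl : forall i, c (lshift n i) = 0.
  apply: (fbasis_free be (c := fun i => c (lshift n i))); apply: fI.
  rewrite linear0 -[RHS]c0 bE [X in _ + X]big1 ?addr0 // => i _.
  by rewrite cr scale0r.
by move=> i; case: (split_ordP i) => j ->.
Qed.
End FieldModules.

(** * Exactness of the tensor product over the field *)

Section ExternalTensorExact.
Variables (F : fieldType) (B C : fdalg F).

Section Left.
Variables (M : lmodType B) (n : nat) (e : 'I_n -> resF M).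
Variable d : 'I_n -> {linear resF M -> F^o}.
Hypothesis ed : dual_basis e d.

Section Object.
Variable N : lmodType C.
Definition xcoord_fun k (m : M) (x : N) : N := scal C (d k m) *: x.
Lemma xcoord_balanced k : balanced (@rscal F B M) (@lscal F C N) (xcoord_fun k).
Proof.
split=> [m m' x|m x x'|m a x]; rewrite /xcoord_fun.
- by rewrite (linearD (d k)) rmorphD scalerDl.
- exact: scalerDr.
have -> : d k (rscal m a) = a * (d k m : F) by exact: (linearZ_LR (d k) a m).
by rewrite /lscal mulrC rmorphM scalerA.
Qed.
Definition xcoord k : xtens M N -> N := tlift (xcoord_fun k).
Lemma xcoordD k : {morph xcoord k : x y / x + y}.
Proof. exact: (tliftD (xcoord_balanced k)). Qed.
Lemma xcoord0 k : xcoord k 0 = 0.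
Proof. exact: (tlift0 (xcoord_balanced k)). Qed.
Lemma xcoord_pure k m x : xcoord k (xpure m x) = scal C (d k m) *: x.
Proof. exact: (tlift_pure (xcoord_balanced k)). Qed.
Lemma xcoordE x : x = \sum_k xpure (e k : M) (xcoord k x).
Proof.
move: x; apply: xtens_addE => [//|x y|m x].
  by rewrite -big_split; apply: eq_bigr => k _; rewrite xcoordD xpureDr.
under eq_bigr => k _ do rewrite xcoord_pure -xpureS.
rewrite -(big_morph (fun m : M => xpure m x) (fun c c' => xpureDl x c c')
  (tpure0l _ _ x)).
by congr (xpure _ x); exact: ed.
Qed.
End Object.

Lemma xcoord_map (N N' : lmodType C) (h : {linear N -> N'}) k x :
  xcoord k (xtens_map (idfun : {linear M -> M}) h x) = h (xcoord k x).
Proof.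
move: x; apply: xtens_addE => [x y|x y|m x].
- by rewrite linearD xcoordD.
- by rewrite xcoordD linearD.
by rewrite xtens_map_pure !xcoord_pure linearZ.
Qed.

(** As for induction: the coordinates with respect to a dual basis of M over F are natural in N and
    determine the tensor, so exactness is tested on them. *)
Lemma xtens_ses_coords (N' N N'' : lmodType C) (g : {linear N' -> N})
    (h : {linear N -> N''}) :
  ses g h -> ses (xtens_map (idfun : {linear M -> M}) g) (xtens_map idfun h).
Proof.
move=> [gI gh hs]; split=> [x y xy|x|z].
- rewrite [x]xcoordE [y]xcoordE; apply: eq_bigr => k _; congr xpure.
  by apply: gI; rewrite -!xcoord_map xy.
- split=> [hx|[y ->]]; last first.
    rewrite [y]xcoordE (linear_sum (xtens_map _ g)) (linear_sum (xtens_map _ h)).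
    rewrite big1 // => k _; rewrite !xtens_map_pure.
    have -> : h (g (xcoord k y)) = 0 by apply/gh; exists (xcoord k y).
    exact: tpure0r.
  have /choice[y hy] k : exists y, xcoord k x = g y.
    by apply/gh; rewrite -xcoord_map hx; exact: xcoord0.
  exists (\sum_k xpure (e k : M) (y k)).
  rewrite (linear_sum (xtens_map _ g)) {1}[x]xcoordE.
  by apply: eq_bigr => k _; rewrite hy xtens_map_pure.
have /choice[y hy] k : exists y, h y = xcoord k z by exact: hs.
exists (\sum_k xpure (e k : M) (y k)).
rewrite (linear_sum (xtens_map _ h)) [RHS]xcoordE.
by apply: eq_bigr => k _; rewrite -hy xtens_map_pure.
Qed.
End Left.

Lemma xtens_ses (M : lmodType B) (N' N N'' : lmodType C) (g : {linear N' -> N})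
    (h : {linear N -> N''}) : fgen M ->
  ses g h -> ses (xtens_map (idfun : {linear M -> M}) g) (xtens_map idfun h).
Proof.
move=> /fgen_fd/fgen_dual_basis[n [e [d ed]]]; exact: xtens_ses_coords.
Qed.
End ExternalTensorExact.

Section ExternalTensorSwap.
Variables (F : fieldType) (B C : fdalg F).

(** Only an additive map, because its source and target are modules over the different rings
    [talg B C] and [talg C B]. *)
Definition xswap (M : lmodType B) (N : lmodType C) : xtens M N -> xtens N M :=
  tlift (fun m n => xpure n m).
Lemma xswap_balanced (M : lmodType B) (N : lmodType C) :
  balanced (@rscal F B M) (@lscal F C N) (fun m n => xpure n m).
Proof.
by split=> [m m' n|m n n'|m k n]; rewrite ?xpureDr ?xpureDl // /rscal -xpureS.
Qed.
Lemma xswapD (M : lmodType B) (N : lmodType C) : {morph @xswap M N : x y / x + y}.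
Proof. exact: (tliftD (xswap_balanced M N)). Qed.
Lemma xswap_pure (M : lmodType B) (N : lmodType C) m n :
  xswap (xpure m n : xtens M N) = xpure n m.
Proof. exact: (tlift_pure (xswap_balanced M N)). Qed.
End ExternalTensorSwap.

Lemma xswapK (F : fieldType) (B C : fdalg F) (M : lmodType B) (N : lmodType C)
  (x : xtens M N) : xswap (xswap x) = x.
Proof.
move: x; apply: xtens_addE => [x y|//|m n]; first by rewrite !xswapD.
by rewrite !xswap_pure.
Qed.

Lemma xswap_map (F : fieldType) (B C : fdalg F) (M M' : lmodType B)
    (N N' : lmodType C) (g : {linear M -> M'}) (h : {linear N -> N'}) x :
  xswap (xtens_map g h x) = xtens_map h g (xswap x).
Proof.
move: x; apply: xtens_addE => [x y|x y|m n].
- by rewrite linearD xswapD.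
- by rewrite xswapD linearD.
by rewrite xtens_map_pure !xswap_pure xtens_map_pure.
Qed.

(** Exactness concerns the underlying additive maps alone, so exactness in the other variable is
    carried over by [xswap]. *)
Lemma xtens_ses_l (F : fieldType) (B C : fdalg F) (N : lmodType C)
    (M' M M'' : lmodType B) (g : {linear M' -> M}) (h : {linear M -> M''}) :
  fgen N -> ses g h ->
  ses (xtens_map g (idfun : {linear N -> N})) (xtens_map h idfun).
Proof.
move=> fN /(xtens_ses fN)[gI gh hs]; split=> [x y xy|x|z].
- by rewrite -[x]xswapK -[y]xswapK; congr xswap; apply: gI; rewrite -!xswap_map xy.
- split=> [hx|[y ->]].
    have /gh[y yE] : xtens_map idfun h (xswap x) = 0.
      by rewrite -xswap_map hx; apply: (addIr (xswap 0)); rewrite -xswapD !add0r.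
    by exists (xswap y); rewrite -xswap_map -yE xswapK.
  rewrite -[LHS]xswapK [xswap (xtens_map h _ _)]xswap_map.
  rewrite [xswap (xtens_map g _ _)]xswap_map.
  have -> : xtens_map idfun h (xtens_map idfun g (xswap y)) = 0 by apply/gh; eexists.
  by apply: (addIr (xswap 0)); rewrite -xswapD !add0r.
have [y yE] := hs (xswap z); exists (xswap y).
by rewrite -xswap_map yE xswapK.
Qed.

Lemma happZ (R : pzRingType) (M N : lmodType R) (f : homz M N) a x :
  happ f (a *: x) = a *: happ f x.
Proof. exact: (linearZ_LR (f : {linear _ -> _})). Qed.
Lemma happ_sum (R : pzRingType) (M N : lmodType R) (I : Type) (r : seq I)
    (Q : pred I) (f : I -> homz M N) x :
  happ (\sum_(i <- r | Q i) f i) x = \sum_(i <- r | Q i) happ (f i) x.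
Proof. by apply: (big_morph (fun g : homz M N => happ g x)). Qed.
Lemma happDr (R : pzRingType) (M N : lmodType R) (f : homz M N) :
  {morph happ f : x y / x + y}.
Proof. exact: (linearD (f : {linear _ -> _})). Qed.
Lemma happ0r (R : pzRingType) (M N : lmodType R) (f : homz M N) : happ f 0 = 0.
Proof. exact: (linear0 (f : {linear _ -> _})). Qed.

(** A dual basis makes W a retract of some C^n, and this remains true after restriction to B. *)
Lemma projective_res (B C : pzRingType) (f : {rmorphism B -> C}) (W : lmodType C) :
  projective (res f C^o) -> projective W -> fgen W -> projective (res f W).
Proof.
move=> pC pW fW; have [n [e [d ed]]] := projective_dual_basis pW fW.
pose b i (c : C^o) : W := (c : C) *: e i.
have bD i : {morph b i : x y / x + y} by move=> x y; exact: scalerDl.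
have bZ i (a : C) x : b i (a *: x) = a *: b i x.
  by rewrite /b -[a *: x]/(a * x) -scalerA.
apply: (projective_coords (a := fun i => res_map f (d i))
  (b := fun i => res_map f (lin_of (bD i) (bZ i)))) => [i|x]; first exact: pC.
exact: ed.
Qed.

Section TensorProjective.
Variables (F : fieldType) (B C : fdalg F).

Lemma tinlr_scale (Z : lmodType (talg B C)) b c (z : Z) :
  tinl B C b *: (tinr B C c *: z) = (tp b c : talg B C) *: z.
Proof. by rewrite scalerA /= /tinl_fun /tinr_fun [_ * _]tpM mul1r mulr1. Qed.
Lemma tinrl_scale (Z : lmodType (talg B C)) b c (z : Z) :
  tinr B C c *: (tinl B C b *: z) = (tp b c : talg B C) *: z.
Proof. by rewrite scalerA /= /tinl_fun /tinr_fun [_ * _]tpM mul1r mulr1. Qed.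

Lemma homr_scaleE (P : lmodType C) (W : lmodType (talg B C)) b (f : homr P W) x :
  happ (b *: f) x = tinl B C b *: (happ f x : W).
Proof. by []. Qed.

Lemma homr_map_surj (P : lmodType C) (W W' : lmodType (talg B C))
    (g : {linear W -> W'}) : projective P -> (forall y, exists x, g x = y) ->
  forall f : homr P W', exists h, homr_map P g h = f.
Proof.
move=> pP gs f; have [h hE] := pP _ _ (res_map (tinr B C) g) f gs.
by exists h; apply: lin_ext.
Qed.

Section Curry.
Variables (M : lmodType B) (N : lmodType C) (Z : lmodType (talg B C)).
Variable h : {linear (xtens M N : lmodType (talg B C)) -> Z}.
Definition curry_fun (m : M) (n : N) : res (tinr B C) Z := h (xpure m n).
Lemma curry_funD m : {morph curry_fun m : x y / x + y}.
Proof. by move=> x y; rewrite /curry_fun xpureDr linearD. Qed.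
Lemma curry_funZ m a x : curry_fun m (a *: x) = a *: curry_fun m x.
Proof.
rewrite res_scaleE /curry_fun -linearZ /= /tinr_fun.
by rewrite -{1}[m]scale1r xpureZ.
Qed.
Definition curry_hom m : homr N Z := lin_of (curry_funD m) (curry_funZ m).
Lemma curry_homD : {morph curry_hom : x y / x + y}.
Proof.
by move=> x y; apply: lin_ext => n /=; rewrite /lin_of_fun /curry_fun xpureDl linearD.
Qed.
Lemma curry_homZ b x : curry_hom (b *: x) = b *: curry_hom x.
Proof.
apply: lin_ext => n /=; rewrite /lin_of_fun /curry_fun /lact_fun -linearZ /=.
by rewrite /tinl_fun -xpureZ scale1r.
Qed.
(** One direction of the bijection between Hom_(B (x) C)(M (x) N, Z) and Hom_B(M, Hom_C(N, Z)). *)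
Definition curry : {linear M -> homr N Z} := lin_of curry_homD curry_homZ.
End Curry.

(** The lift is found in two stages: Hom_C(N, g) is surjective because N is projective, and then M
    lifts the curried map through it. *)
Lemma projective_xtens (M : lmodType B) (N : lmodType C) :
  projective M -> projective N -> projective (xtens M N : lmodType (talg B C)).
Proof.
move=> pM pN L L' g f gs.
have [k kP] := pM _ _ (homr_map N g) (curry f) (homr_map_surj pN gs).
pose u m n : L := happ (k m) n.
have uDl n : {morph u^~ n : x y / x + y} by move=> x y; rewrite /u linearD.
have uDr m : {morph u m : x y / x + y} by move=> x y; exact: (happDr (k m)).
have uZ b c m n : u (b *: m) (c *: n) = (tp b c : talg B C) *: u m n.
  rewrite /u (linearZ_LR k b m) homr_scaleE happZ res_scaleE.
  exact: tinlr_scale.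
exists (xtens_lift uDl uDr uZ); apply: xtens_addE => [x y|x y|m n].
- by rewrite !linearD.
- by rewrite linearD.
rewrite xtens_liftE -[LHS]/(happ (homr_map N g (k m)) n).
by rewrite kP.
Qed.

(** An F-basis e_i of C presents B (x) C over B by finitely many copies of B: the coordinate maps
    are b (x) c |-> d_i(c) b, and the way back is b |-> b (x) e_i. *)
Lemma projective_res_tinl : projective (res (tinl B C) (talg B C)^o).
Proof.
have [n [e [d ed]]] := fgen_dual_basis (alg_fin C).
pose a i (t : res (tinl B C) (talg B C)^o) : B^o :=
  tlift (fun (b : B^o) (c : C^o) => scal B (d i c) * b : B^o) (t : tring B C).
have ab i : balanced (@rscal F B B^o) (@lscal F C C^o)
    (fun (b : B^o) (c : C^o) => scal B (d i c) * b : B^o).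
  split=> [b b' c|b c c'|b k c]; rewrite ?mulrDr //.
    by rewrite (linearD (d i)) rmorphD mulrDl.
  rewrite /rscal /lscal; have -> : d i (scal C k *: c) = k * (d i c : F).
    exact: (linearZ_LR (d i) k c).
  by rewrite -[scal B k *: b]/(scal B k * b) mulrA -rmorphM mulrC.
have aE i b c : a i (tp b c) = scal B (d i c) * b by exact: (tlift_pure (ab i)).
have aD i : {morph a i : x y / x + y} by exact: (tliftD (ab i)).
have aZ i k x : a i (k *: x) = k *: a i x.
  elim/tring_ind: x => [s t es et|b c]; first by rewrite scalerDr !aD es et scalerDr.
  rewrite res_scaleE -[_ *: _]/(tp k 1 * tp b c : talg B C) [_ * _]tpM mul1r !aE.
  by rewrite -[RHS]/(k * _) !mulrA scal_central.
pose b i (x : B^o) : res (tinl B C) (talg B C)^o := tp x (e i).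
have bD i : {morph b i : x y / x + y} by move=> x y; exact: tpDl.
have bZ i k x : b i (k *: x) = k *: b i x.
  by rewrite res_scaleE -[RHS]/(tp k 1 * tp x (e i) : talg B C) [RHS]tpM mul1r.
apply: (projective_coords (a := fun i => lin_of (aD i) (aZ i))
  (b := fun i => lin_of (bD i) (bZ i))) => [i|x]; first exact: projective_regular.
elim/tring_ind: x => [s t es et|k c].
  rewrite {1}es {1}et -big_split; apply: eq_bigr => i _.
  by rewrite !linearD.
transitivity (tp k (\sum_i (d i c : F) *: e i) : talg B C).
  by rewrite -ed.
rewrite /tp (big_morph (fun c : C^o => xpure (k : B^o) c) (xpureDr _) (tpure0r _ _ _)).
apply: eq_bigr => i _; rewrite /lin_of_fun /= /lin_of_fun aE.
exact: esym (tpS _ _ _).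
Qed.

(** A dual basis (e, d) of P makes Hom_C(P, W) a retract of W^n over B, by f |-> (f(e_i))_i and w
    |-> (x |-> d_i(x) w). As a B-module W is projective because B (x) C is. *)
Lemma projective_homr (P : lmodType C) (W : lmodType (talg B C)) :
  projective P -> fgen P -> projective W -> fgen W -> projective (homr P W).
Proof.
move=> pP fP pW fW; have [n [e [d ed]]] := projective_dual_basis pP fP.
have pW' := projective_res projective_res_tinl pW fW.
pose a i (f : homr P W) : res (tinl B C) W := happ f (e i).
have aD i : {morph a i : x y / x + y} by [].
have aZ i b f : a i (b *: f) = b *: a i f by [].
pose b i (w : res (tinl B C) W) (x : P) : res (tinr B C) W :=
  tinr B C (d i x : C) *: (w : W).
have bD1 i w : {morph b i w : x y / x + y}.
  by move=> x y; rewrite /b linearD rmorphD [LHS]scalerDl.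
have bZ1 i w c x : b i w (c *: x) = c *: b i w x.
  rewrite res_scaleE /b dualZ rmorphM.
  by rewrite [RHS]scalerA.
pose b' i w : homr P W := lin_of (bD1 i w) (bZ1 i w).
have bD i : {morph b' i : x y / x + y}.
  by move=> x y; apply: lin_ext => p; exact: scalerDr.
have bZ i c w : b' i (c *: w) = c *: b' i w.
  apply: lin_ext => p; rewrite -[RHS]/(tinl B C c *: (b i w p : W)).
  by rewrite -[LHS]/(tinr B C _ *: (tinl B C c *: (w : W))) tinlr_scale tinrl_scale.
apply: (projective_coords (a := fun i => lin_of (aD i) (aZ i))
  (b := fun i => lin_of (bD i) (bZ i))) => [i|f]; first exact: pW'.
apply: lin_ext => p; rewrite {1}[p]ed linear_sum.
rewrite -[RHS]/(happ _ p) happ_sum.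
by apply: eq_bigr => i _; rewrite linearZ.
Qed.

(** This is what makes [Res P] exact. Exactness in the middle is [ses_factor]; surjectivity is the
    projectivity of P. *)
Lemma homr_ses (P : lmodType C) (W' W W'' : lmodType (talg B C))
    (g : {linear W' -> W}) (h : {linear W -> W''}) : projective P ->
  ses g h -> ses (homr_map P g) (homr_map P h).
Proof.
move=> pP gh; have [gI gk hs] := gh; split=> [x y xy|f|f]; last exact: homr_map_surj.
  by apply: lin_ext => p; apply: gI; exact: (congr1 (fun f => happ f p) xy).
split=> [hf|[f' ->]]; last first.
  by apply: lin_ext => p; apply/gk; exists (happ f' p).
have [p|k kE] := @ses_factor _ _ _ _ _ (res_map (tinr B C) g)
    (res_map (tinr B C) h) f gh.
  exact: (congr1 (fun f => happ f p) hf).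
by exists k; apply: lin_ext.
Qed.
End TensorProjective.

(** * Functors between graded module categories *)

Lemma dmap_ses (R : pzRingType) (I : choiceType) (M' M M'' : I -> lmodType R)
    (g : forall i, {linear M' i -> M i}) (h : forall i, {linear M i -> M'' i}) :
  (forall i, ses (g i) (h i)) -> ses (dmap g) (dmap h).
Proof.
move=> gh; split=> [x y xy|x|z].
- apply: dsum_ext => i; have [gI _ _] := gh i; apply: gI.
  exact: (congr1 (fun x : dsumm M => dval x i) xy).
- split=> [hx|[y ->]]; last first.
    by apply: dsum_ext => i; have [_ e _] := gh i; apply/e; exists (dval y i).
  have ex i : exists y, dval x i = g i y.
    have [_ e _] := gh i; apply/e.
    exact: (congr1 (fun x : dsumm M'' => dval x i) hx).
  pose y i := projT1 (cid (ex i)).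
  have yE i : dval x i = g i (y i) by exact: (projT2 (cid (ex i))).
  have [s s0] := dsupp x.
  have y0 i : i \notin s -> y i = 0.
    by move=> /s0 xi; have [gI _ _] := gh i; apply: gI; rewrite -yE xi linear0.
  exists (DSum (ex_intro _ s y0)); apply: dsum_ext => i; exact: yE.
(* Taking the preimage 0 wherever z vanishes keeps the family of preimages finitely supported. *)
have ex i : exists x, h i x = dval z i /\ (dval z i = 0 -> x = 0).
  have [zi|zi] := pselect (dval z i = 0).
    by exists 0; rewrite zi linear0.
  by have [_ _ /(_ (dval z i))[x xE]] := gh i; exists x.
pose x i := projT1 (cid (ex i)).
have xE i : h i (x i) = dval z i /\ (dval z i = 0 -> x i = 0).
  exact: (projT2 (cid (ex i))).
have [s s0] := dsupp z.
have x0 i : i \notin s -> x i = 0 by move=> /s0; exact: (xE i).2.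
exists (DSum (ex_intro _ s x0)); apply: dsum_ext => i; exact: (xE i).1.
Qed.

Section NatIso.
Variables C D E : category.

Lemma natiso_sym (T T' : functor C D) : natiso T T' -> natiso T' T.
Proof.
move=> [eta [theta [e1 e2 nat]]]; exists theta, eta; split=> // X Y f.
rewrite -[LHS]compc1 -(e2 X) compcA -[compc (compc (theta Y) _) _]compcA -nat.
by rewrite !compcA e1 comp1c.
Qed.
Lemma natiso_trans (T T' T'' : functor C D) :
  natiso T T' -> natiso T' T'' -> natiso T T''.
Proof.
move=> [e1 [t1 [a1 b1 n1]]] [e2 [t2 [a2 b2 n2]]].
exists (fun X => compc (e2 X) (e1 X)), (fun X => compc (t1 X) (t2 X)); split.
- by move=> X; rewrite compcA -[compc (compc (t1 X) _) _]compcA a2 compc1.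
- by move=> X; rewrite compcA -[compc (compc (e2 X) _) _]compcA b1 compc1.
by move=> X Y f; rewrite -compcA n1 compcA n2 compcA.
Qed.
Lemma natiso_compl (G : functor D E) (T T' : functor C D) :
  natiso T T' -> natiso (G \of T) (G \of T').
Proof.
move=> [eta [theta [e1 e2 nat]]].
exists (fun X => fmor G (eta X)), (fun X => fmor G (theta X)).
split=> [X|X|X Y f] /=.
- by rewrite -fmorM e1 fmor1.
- by rewrite -fmorM e2 fmor1.
by rewrite -!fmorM nat.
Qed.
Lemma natiso_compr (G G' : functor D E) (T : functor C D) :
  natiso G G' -> natiso (G \of T) (G' \of T).
Proof.
move=> [eta [theta [e1 e2 nat]]].
by exists (fun X => eta (T X)), (fun X => theta (T X)); split=> *; rewrite /= ?nat.
Qed.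
Lemma natiso_full (S : C -> Prop) (T T' : functor C C)
    (TS : forall X, S X -> S (T X)) (TS' : forall X, S X -> S (T' X)) :
  natiso T T' -> natiso (frestr TS) (frestr TS').
Proof.
move=> [eta [theta [e1 e2 nat]]].
exists (fun X => eta (sval X)), (fun X => theta (sval X)).
by split=> [X|X|X Y f]; [exact: e1|exact: e2|exact: nat].
Qed.
End NatIso.

Section LinearInverse.
Variables (R : pzRingType) (M N : lmodType R) (f : {linear M -> N}) (g : N -> M).
Hypotheses (fK : cancel f g) (gK : cancel g f).
Lemma lin_invD : {morph g : x y / x + y}.
Proof. by move=> x y; rewrite -{1}[x]gK -{1}[y]gK -linearD fK. Qed.
Lemma lin_invZ a x : g (a *: x) = a *: g x.
Proof. by rewrite -{1}[x]gK -linearZ fK. Qed.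
Definition lin_inv : {linear N -> M} := lin_of lin_invD lin_invZ.
End LinearInverse.

Section GradedFunctors.
Variables (F : fieldType) (I J : choiceType).
Variables (B : I -> fdalg F) (C : J -> fdalg F).

(** The inverse of a bijective linear map is linear, and [natiso] asks for naturality in one
    direction, so a natural family of linear bijections suffices. All three isomorphisms of functors
    are obtained from such families. *)
Lemma natiso_bij (T T' : functor (modc B) (modc C))
    (eta : forall X : modc B, ghom (T X) (T' X)) :
  (forall X i, bijective (eta X i)) ->
  (forall (X Y : modc B) (f : ghom X Y) i x,
    eta Y i (fmor T f i x) = (fmor T' f : ghom _ _) i (eta X i x)) ->
  natiso T T'.
Proof.
move=> bij nat.
have inv X i : {g | cancel (eta X i) g & cancel g (eta X i)}.
  by apply: cid2; have [g gK Kg] := bij X i; exists g.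
pose theta X i := let: exist2 g fK gK := inv X i in lin_inv fK gK.
have tK X i x : theta X i (eta X i x) = x by rewrite /theta; case: (inv X i).
have Kt X i x : eta X i (theta X i x) = x by rewrite /theta; case: (inv X i).
exists eta, theta; split=> [X|X|X Y f]; apply: ghom_ext => i x.
- exact: tK.
- exact: Kt.
exact: nat.
Qed.

Section IsoProperties.
Variables (T T' : functor (modc B) (modc C)) (TT' : natiso T T').

Lemma natiso_isom X i : exists f : {linear T X i -> T' X i}, bijective f.
Proof.
have [eta [theta [e1 e2 _]]] := TT'.
exists (eta X i : {linear _ -> _}), (theta X i : {linear _ -> _}) => x.
  exact: (congr1 (fun h : ghom (T X) (T X) => h i x) (e1 X)).
exact: (congr1 (fun h : ghom (T' X) (T' X) => h i x) (e2 X)).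
Qed.

Lemma natiso_gproj X : gproj (T X) -> gproj (T' X).
Proof.
by move=> pT i; have [f fb] := natiso_isom X i; apply: projective_bij fb _; exact: pT.
Qed.

(** Each [fmor T' f] is [fmor T f] conjugated by the isomorphism, and conjugation preserves the
    three conditions in [ses]. *)
Lemma natiso_exact : exact_functor T -> exact_functor T'.
Proof.
have [eta [theta [e1 e2 nat]]] := TT'.
have tK X i x : (theta X : ghom _ _) i ((eta X : ghom _ _) i x) = x.
  exact: (congr1 (fun h : ghom (T X) (T X) => h i x) (e1 X)).
have Kt X i x : (eta X : ghom _ _) i ((theta X : ghom _ _) i x) = x.
  exact: (congr1 (fun h : ghom (T' X) (T' X) => h i x) (e2 X)).
have nt (X Y : modc B) (f : ghom X Y) i x : (fmor T' f : ghom _ _) i x =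
    (eta Y : ghom _ _) i ((fmor T f : ghom _ _) i ((theta X : ghom _ _) i x)).
  rewrite -{1}[x]Kt; apply: esym.
  exact: (congr1 (fun h : ghom _ _ => h i _) (nat X Y f)).
move=> ex X' X X'' f g fg i; have [fI ker gs] := ex _ _ _ _ _ fg i.
split=> [x y|x|z].
- rewrite !nt => /(can_inj (tK _ _)) /fI /(can_inj (Kt _ _)); exact.
- rewrite nt; split=> [gx|[y ->]].
    have /ker[y yE] : (fmor T g : ghom _ _) i ((theta X : ghom _ _) i x) = 0.
      by rewrite -[LHS]tK gx linear0.
    by exists ((eta X' : ghom _ _) i y); rewrite nt tK -yE Kt.
  rewrite nt tK; have -> : (fmor T g : ghom _ _) i ((fmor T f : ghom _ _) i
      ((theta X' : ghom _ _) i y)) = 0 by apply/ker; eexists.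
  exact: linear0.
have [x xE] := gs ((theta X'' : ghom _ _) i z).
by exists ((eta X : ghom _ _) i x); rewrite nt tK xE Kt.
Qed.
End IsoProperties.

Lemma exact_Tensf (X : gmod B) : exact_functor (Tensf C X).
Proof. by move=> Y' Y Y'' f g fg [i j]; apply: xtens_ses; [exact: fgP|exact: fg]. Qed.

Lemma gproj_gtens (X : gmod B) (Y : gmod C) : gproj X -> gproj Y -> gproj (gtens X Y).
Proof. by move=> pX pY [i j]; apply: projective_xtens; [exact: pX|exact: pY]. Qed.

Lemma exact_Homf (P : gmod C) : gproj P -> exact_functor (Homf B P).
Proof.
move=> pP W' W W'' f g fg i; apply: dmap_ses => j.
by apply: homr_ses; [exact: pP|exact: fg].
Qed.

Lemma gproj_Homf (P : gmod C) (W : gmod (talgs B C)) :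
  gproj P -> gproj W -> gproj (Homf B P W).
Proof.
move=> pP pW i; apply: projective_dsumm => j.
by apply: projective_homr;
  [exact: pP|exact: fgP|exact: (pW (i, j))|exact: (fgP (W (i, j)))].
Qed.

Section Push.
Variables (t : I -> J) (f : forall i, alghom (B i) (C (t i))).

(** [fibre_hom] is [f] transported along t i = j; eliminating that equality carries any property of
    the [f i] over to it. *)
Lemma fibre_homP (Q : forall i j, alghom (B i) (C j) -> Prop) :
  (forall i, Q i (t i) (f i)) ->
  forall j (k : {i : I | t i == j}), Q (val k) j (fibre_hom f k).
Proof. move=> Qf j [i ti]; rewrite /fibre_hom /=.
by move: (eqP _) => e; case: _ / e. Qed.

Lemma exact_Indf : (forall i, projective (rres (f i))) -> exact_functor (Indf f).
Proof.
move=> pf X' X X'' g h gh j; apply: dmap_ses => k.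
apply: ind_ses; last exact: gh.
by apply: (fibre_homP (Q := fun i j h => projective (rres h))).
Qed.

Lemma gproj_Indf X : gproj X -> gproj (Indf f X).
Proof.
by move=> pX j; apply: projective_dsumm => k; apply: projective_ind; exact: pX.
Qed.

Lemma exact_Resf (tfin : finite_fibres t) : exact_functor (Resf f tfin).
Proof. by move=> X' X X'' g h gh i; exact: gh. Qed.

Lemma gproj_Resf (tfin : finite_fibres t) Y :
  (forall i, projective (res (f i) (C (t i))^o)) -> gproj Y -> gproj (Resf f tfin Y).
Proof.
by move=> pf pY i; apply: projective_res; [exact: pf|exact: pY|exact: fgP].
Qed.
End Push.
End GradedFunctors.

Lemma exact_comp (F : fieldType) (I J K : choiceType) (B : I -> fdalg F)
    (C : J -> fdalg F) (D : K -> fdalg F) (T : functor (modc B) (modc C))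
    (T' : functor (modc C) (modc D)) :
  exact_functor T -> exact_functor T' -> exact_functor (T' \of T).
Proof. by move=> e e' X' X X'' f g fg; apply: e'; exact: e. Qed.

(** * Universal property of graded induction *)

Section PushUniversal.
Variables (F : fieldType) (I J : choiceType).
Variables (B : I -> fdalg F) (C : J -> fdalg F) (t : I -> J).
Variable f : forall i, alghom (B i) (C (t i)).

(** The same transport as in [fibre_hom], but indexed by a proof of equality that can be eliminated
    or replaced by another one. *)
Definition fib_hom i j (e : t i = j) : alghom (B i) (C j) :=
  match e in _ = j' return alghom (B i) (C j') with erefl => f i end.

Section Object.
Variables (X : gmod B) (j : J).

Definition fidx i (e : t i = j) : {i : I | t i == j} := exist _ i (introT eqP e).
Lemma fibre_homE i (e : t i = j) : fibre_hom f (fidx e) = fib_hom e.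
Proof.
rewrite /fibre_hom /=; have -> : eqP (valP (fidx e)) = e by exact: eq_irrelevance.
by [].
Qed.

Definition ib i (e : t i = j) (x : X i) : Indf f X j :=
  dinj (i := fidx e) (ipure (fibre_hom f (fidx e)) 1 x).

Lemma ibD i (e : t i = j) : {morph ib e : x y / x + y}.
Proof. by move=> x y; rewrite /ib ipureD dinjD. Qed.
Lemma ibZ i (e : t i = j) b x : ib e (b *: x) = fib_hom e b *: ib e x.
Proof.
rewrite /ib -fibre_homE -dinjZ ind_scaleE mulr1.
by rewrite -(mul1r (fibre_hom f (fidx e) b)) ipureS.
Qed.

Lemma fidxP (q : {i : I | t i == j}) : exists e : t (val q) = j, q = fidx e.
Proof. by case: q => i e0; exists (eqP e0); apply: val_inj. Qed.

Lemma Indf_addE (Z : zmodType) (g h : Indf f X j -> Z) :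
  {morph g : x y / x + y} -> {morph h : x y / x + y} ->
  (forall i (e : t i = j) c x, g (c *: ib e x) = h (c *: ib e x)) -> g =1 h.
Proof.
move=> gD hD gh; apply: dsum_addE => // q.
have [e ->] := fidxP q.
apply: ind_ext => [x y|x y|c x]; rewrite ?dinjD ?gD ?hD //.
have := gh _ e c x.
by rewrite /ib -dinjZ ind_scaleE mulr1.
Qed.

(** The coefficient c is an argument of [b] because Z is only an abelian group. The map [xi] below,
    whose target is not a module over the ring of its source, is built in this generality. *)
Lemma Indf_lift_add_ex (Z : zmodType) (b : forall i (e : t i = j), C j -> X i -> Z) :
  (forall i (e : t i = j), balanced (ind_ra (fib_hom e)) (@ind_la _ (X i)) (b i e)) ->
  exists2 h : Indf f X j -> Z, {morph h : x y / x + y} &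
    forall i (e : t i = j) c x, h (c *: ib e x) = b i e c x.
Proof.
move=> bb.
have bb' (q : {i : I | t i == j}) :
    balanced (ind_ra (fibre_hom f q)) (@ind_la _ (X (val q)))
      (b (val q) (eqP (valP q))) by exact: bb.
pose h q : ind (fibre_hom f q) (X (val q)) -> Z := tlift (b (val q) (eqP (valP q))).
have hD q : {morph h q : x y / x + y} by exact: (tliftD (bb' q)).
exists (dlift h) => [|i e c x]; first exact: (dliftD hD).
rewrite /ib -dinjZ ind_scaleE mulr1 (dlift_dinj hD).
rewrite [LHS](tlift_pure (bb' (fidx e))).
by have -> : eqP (valP (fidx e)) = e by exact: eq_irrelevance.
Qed.

Section Lift.
Variables (Z : lmodType (C j)) (b : forall i (e : t i = j), X i -> Z).
Hypotheses (bD : forall i (e : t i = j), {morph b e : x y / x + y})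
  (bZ : forall i (e : t i = j) c x, b e (c *: x) = fib_hom e c *: b e x).

Lemma Indf_lift_ex : exists h : {linear Indf f X j -> Z},
  forall i (e : t i = j) x, h (ib e x) = b e x.
Proof.
have bb i (e : t i = j) : balanced (ind_ra (fib_hom e)) (@ind_la _ (X i))
    (fun c x => c *: b e x).
  split=> [c c' x|c x x'|c a x]; first exact: scalerDl.
    by rewrite bD scalerDr.
  by rewrite /ind_ra /ind_la bZ scalerA.
have [h hD hE] := Indf_lift_add_ex bb.
have hZ a x : h (a *: x) = a *: h x.
  move: x; apply: Indf_addE => [x y|x y|i e c x].
  - by rewrite scalerDr hD.
  - by rewrite hD scalerDr.
  by rewrite scalerA !hE scalerA.
exists (lin_of hD hZ) => i e x.
by rewrite -[LHS]/(h _) -[ib e x]scale1r hE scale1r.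
Qed.
Definition Indf_lift : {linear Indf f X j -> Z} := projT1 (cid Indf_lift_ex).
Lemma Indf_liftE i (e : t i = j) x : Indf_lift (ib e x) = b e x.
Proof. exact: (projT2 (cid Indf_lift_ex)). Qed.
End Lift.
End Object.

Section Map.
Variables (X Y : gmod B) (h : ghom X Y) (j : J).
Definition Indf_mor : {linear Indf f X j -> Indf f Y j} :=
  (fmor (Indf f) h : ghom _ _) j.
Lemma Indf_morE i (e : t i = j) x : Indf_mor (ib e x) = ib e (h i x).
Proof. by rewrite [LHS]dmap_dinj ind_map_pure. Qed.
End Map.
End PushUniversal.

Section TowerInduction.
Variables (F : fieldType) (A : tower F).

(* The codomain is transported along m + n = j, so that later statements need no
   casts between A (m + (n + k)) and A (m + n + k). *)
Definition rhoc m n j (e : (m + n)%N = j) : alghom (talg (A m) (A n)) (A j) :=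
  fib_hom (rhop A) (i := (m, n)) e.

Lemma rhoc_ecast m n j (e : (m + n)%N = j) t :
  rhoc e t = ecast i (tw A i) e (rho A m n t).
Proof. by case: _ / e. Qed.

(** Eliminating e1, e2 and e3 leaves a single equality, which by uniqueness of equality proofs is
    the one in the cast of [rho_assoc]. *)
Lemma rhoc_assoc i k l ik kl n (e1 : (i + k)%N = ik) (e2 : (k + l)%N = kl)
    (e3 : (ik + l)%N = n) (e4 : (i + kl)%N = n) a b c :
  rhoc e3 (tp (rhoc e1 (tp a b)) c) = rhoc e4 (tp a (rhoc e2 (tp b c))).
Proof.
move: e3 e4; case: _ / e1; case: _ / e2 => e3; case: _ / e3 => e4.
rewrite [RHS]rhoc_ecast (eq_irrelevance e4 (addnA i k l)); exact: rho_assoc.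
Qed.

Section Universal.
Variables (X Y : gmod A) (n : nat).
Notation XY := (nabla A (gtens X Y) n).

Definition nb i k (e : (i + k)%N = n) (x : X i) (y : Y k) : XY :=
  ib (rhop A) (X := gtens X Y) (i := (i, k)) e (xpure x y).

Lemma nbDl i k (e : (i + k)%N = n) y : {morph (nb e)^~ y : x x' / x + x'}.
Proof. by move=> x x'; rewrite /nb xpureDl ibD. Qed.
Lemma nbDr i k (e : (i + k)%N = n) x : {morph nb e x : y y' / y + y'}.
Proof. by move=> y y'; rewrite /nb xpureDr ibD. Qed.
Lemma nb_tp i k (e : (i + k)%N = n) a b x y :
  nb e (a *: x) (b *: y) = rhoc e (tp a b) *: nb e x y.
Proof. by rewrite /nb xpureZ ibZ. Qed.

Lemma nabla_addE (Z : zmodType) (g h : XY -> Z) :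
  {morph g : x y / x + y} -> {morph h : x y / x + y} ->
  (forall i k (e : (i + k)%N = n) c x y, g (c *: nb e x y) = h (c *: nb e x y)) ->
  g =1 h.
Proof.
move=> gD hD gh; apply: (Indf_addE gD hD) => -[i k] e c.
apply: xtens_addE => [x y|x y|x y]; last exact: gh.
- by rewrite ibD scalerDr gD.
- by rewrite ibD scalerDr hD.
Qed.

Lemma nabla_eq (Z : lmodType (A n)) (g h : {linear XY -> Z}) :
  (forall i k (e : (i + k)%N = n) x y, g (nb e x y) = h (nb e x y)) -> g =1 h.
Proof.
move=> gh; apply: nabla_addE => [||i k e c x y]; [exact: linearD|exact: linearD|].
by rewrite !linearZ gh.
Qed.

Section Lift.
Variables (Z : lmodType (A n)).
Variable b : forall i k (e : (i + k)%N = n), X i -> Y k -> Z.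
Hypotheses (bDl : forall i k (e : (i + k)%N = n) y, {morph (b e)^~ y : x x' / x + x'})
  (bDr : forall i k (e : (i + k)%N = n) x, {morph b e x : y y' / y + y'})
  (bZ : forall i k (e : (i + k)%N = n) c d x y,
     b e (c *: x) (d *: y) = rhoc e (tp c d) *: b e x y).

Definition nabla_lift_comp i k (e : (i + k)%N = n) :
    {linear (xtens (X i) (Y k) : lmodType (talg (A i) (A k))) -> res (rhoc e) Z} :=
  @xtens_lift F (A i) (A k) (X i) (Y k) (res (rhoc e) Z) (b e) (bDl e) (bDr e) (bZ e).
Definition nabla_lift_val p : forall e : addp p = n, gtens X Y p -> Z :=
  match p with (i, k) => fun e => @nabla_lift_comp i k e end.
Lemma nabla_lift_valD p (e : addp p = n) : {morph nabla_lift_val e : x y / x + y}.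
Proof. case: p e => i k e; exact: (linearD (nabla_lift_comp e)). Qed.
Lemma nabla_lift_valZ p (e : addp p = n) c x :
  nabla_lift_val e (c *: x) = fib_hom (rhop A) e c *: nabla_lift_val e x.
Proof. case: p e c x => i k e; exact: (linearZ_LR (nabla_lift_comp e)). Qed.
Definition nabla_lift : {linear XY -> Z} := Indf_lift nabla_lift_valD nabla_lift_valZ.
Lemma nabla_liftE i k (e : (i + k)%N = n) x y : nabla_lift (nb e x y) = b e x y.
Proof.
rewrite /nabla_lift /nb Indf_liftE.
exact: (@xtens_liftE F (A i) (A k) (X i) (Y k) (res (rhoc e) Z) (b e)
  (bDl e) (bDr e) (bZ e) x y).
Qed.
End Lift.
End Universal.

Section InductionMap.
Variables (M X Y : gmod A) (f : ghom X Y) (n : nat).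
Definition Ind_mor : {linear nabla A (gtens M X) n -> nabla A (gtens M Y) n} :=
  Indf_mor (rhop A) (gtens_mor M f) n.
Lemma Ind_morE i k (e : (i + k)%N = n) (m : M i) (x : X k) :
  Ind_mor (nb e m x) = nb e m (f k x).
Proof.
rewrite /Ind_mor Indf_morE; congr (ib _ _ _); exact: xtens_map_pure.
Qed.
End InductionMap.
End TowerInduction.
Arguments rhoc {F A m n j} e.

(** * Composition of induction functors *)

Lemma lin_additive (R : pzRingType) (M N : lmodType R) (h : {linear M -> N}) :
  {morph h : x y / x + y}.
Proof. exact: linearD. Qed.

Section InductionAssociativity.
Variables (F : fieldType) (A : tower F).

Local Opaque nabla nb gtens nabla_lift.

Lemma rhocl_rhocr i j n (e : (i + j)%N = n) (Z : lmodType (A n)) (a : A i) (b : A j)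
    (z : Z) :
  rhoc e (tp a 1) *: (rhoc e (tp 1 b) *: z) = rhoc e (tp a b) *: z.
Proof. by rewrite scalerA -rmorphM [tp _ _ * _]tpM mul1r mulr1. Qed.
Lemma rhocr_rhocl i j n (e : (i + j)%N = n) (Z : lmodType (A n)) (a : A i) (b : A j)
    (z : Z) :
  rhoc e (tp 1 b) *: (rhoc e (tp a 1) *: z) = rhoc e (tp a b) *: z.
Proof. by rewrite scalerA -rmorphM [tp _ _ * _]tpM mul1r mulr1. Qed.

(** Restriction along [rhor e] or [rhol e] turns a degree n module into a module over one factor.
    The lifts over an inner induction take values there. *)
Definition rhor i j n (e : (i + j)%N = n) : alghom (A j) (A n) :=
  acomp (rhoc e) (tinr (A i) (A j)).
Definition rhol i j n (e : (i + j)%N = n) : alghom (A i) (A n) :=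
  acomp (rhoc e) (tinl (A i) (A j)).

Variables (M N X : gmod A).
Notation L := (nabla A (gtens M (nabla A (gtens N X)))).
Notation R := (nabla A (gtens (nabla A (gtens M N)) X)).

Lemma addn_assocr i j k l n (e : (i + j)%N = n) (e' : (k + l)%N = j) :
  (i + k + l)%N = n.
Proof. by rewrite -addnA e' e. Qed.
Lemma addn_assocl i j k l n (e : (j + l)%N = n) (e' : (i + k)%N = j) :
  (i + (k + l))%N = n.
Proof. by rewrite addnA e' e. Qed.

Section Forward.
Variable n : nat.

Section Inner.
Variables (i j : nat) (e : (i + j)%N = n) (m : M i).
(** The map m (x) (x (x) y) |-> (m (x) x) (x) y is built in two stages: for fixed m it is lifted
    over the inner induction as an A_j-linear map, and the result is then lifted over the outer
    one. *)
Definition ind_assoc_b k l (e' : (k + l)%N = j) (x : N k) (y : X l) :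
  res (rhor e) (R n) :=
  nb (addn_assocr e e') (nb erefl m x) y.
Lemma ind_assoc_bDl k l (e' : (k + l)%N = j) y :
  {morph (ind_assoc_b e')^~ y : x x' / x + x'}.
Proof. by move=> x x'; rewrite /ind_assoc_b nbDr nbDl. Qed.
Lemma ind_assoc_bDr k l (e' : (k + l)%N = j) x :
  {morph ind_assoc_b e' x : x x' / x + x'}.
Proof. by move=> y y'; rewrite /ind_assoc_b nbDr. Qed.
Lemma ind_assoc_bZ k l (e' : (k + l)%N = j) c d x y :
  ind_assoc_b e' (c *: x) (d *: y) = rhoc e' (tp c d) *: ind_assoc_b e' x y.
Proof.
rewrite res_scaleE /ind_assoc_b -{1}[m]scale1r nb_tp nb_tp.
by rewrite (rhoc_assoc erefl e' _ e).
Qed.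
Definition ind_assoc_in : {linear nabla A (gtens N X) j -> res (rhor e) (R n)} :=
  nabla_lift (Z := res (rhor e) (R n)) ind_assoc_bDl ind_assoc_bDr ind_assoc_bZ.
Lemma ind_assoc_inE k l (e' : (k + l)%N = j) x y :
  ind_assoc_in (nb e' x y) = nb (addn_assocr e e') (nb erefl m x) y.
Proof. exact: (nabla_liftE
  (Z := res (rhor e) (R n)) ind_assoc_bDl ind_assoc_bDr ind_assoc_bZ). Qed.
End Inner.

Definition ind_assoc_o i j (e : (i + j)%N = n) (m : M i) (z : nabla A (gtens N X) j) :
  R n :=
  ind_assoc_in e m z.
Lemma ind_assoc_oE i j k l (e : (i + j)%N = n) (e' : (k + l)%N = j) m c x y :
  ind_assoc_o e m (c *: nb e' x y) =
  rhoc e (tp 1 c) *: nb (addn_assocr e e') (nb erefl m x) y.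
Proof. by rewrite /ind_assoc_o linearZ /= ind_assoc_inE. Qed.
Lemma ind_assoc_oDr i j (e : (i + j)%N = n) m : {morph ind_assoc_o e m : x x' / x + x'}.
Proof. exact: (lin_additive (ind_assoc_in e m)). Qed.
Lemma ind_assoc_oDl i j (e : (i + j)%N = n) z :
  {morph (ind_assoc_o e)^~ z : x x' / x + x'}.
Proof.
move=> m m'; move: z; apply: nabla_addE => [z z'|z z'|k l e' c x y].
- exact: ind_assoc_oDr.
- by rewrite (ind_assoc_oDr e m) (ind_assoc_oDr e m') addrACA.
apply: etrans (ind_assoc_oE _ _ _ _ _ _) _; rewrite nbDl nbDl scalerDr.
by apply: esym; congr (_ + _); exact: ind_assoc_oE.
Qed.
(** A_j-linearity is part of the inner lift. A_i-linearity is checked on generators: the actions of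
    A_i and A_j commute, and [rhoc_assoc] moves c onto m. *)
Lemma ind_assoc_oZ i j (e : (i + j)%N = n) c d m z :
  ind_assoc_o e (c *: m) (d *: z) = rhoc e (tp c d) *: ind_assoc_o e m z.
Proof.
rewrite /ind_assoc_o (linearZ_LR (ind_assoc_in e _)) res_scaleE -rhocr_rhocl;
  congr (_ *: _).
move: z; apply: nabla_addE => [z z'|z z'|k l e' a x y].
- exact: ind_assoc_oDr.
- by rewrite (lin_additive (ind_assoc_in e m)) scalerDr.
apply: etrans (ind_assoc_oE _ _ _ _ _ _) _; apply: esym.
apply: etrans (congr1 ( *:%R _) (ind_assoc_oE _ _ _ _ _ _)) _; apply: esym.
rewrite [RHS]rhocl_rhocr -[RHS]rhocr_rhocl; congr (_ *: _).
rewrite -{1}[x]scale1r -{1}[y]scale1r !nb_tp (rhoc_assoc erefl e' _ e).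
by rewrite rmorph1.
Qed.
Definition ind_assoc : {linear L n -> R n} :=
  nabla_lift ind_assoc_oDl ind_assoc_oDr ind_assoc_oZ.
Lemma ind_assocE i j k l (e : (i + j)%N = n) (e' : (k + l)%N = j) m x y :
  ind_assoc (nb e m (nb e' x y)) = nb (addn_assocr e e') (nb erefl m x) y.
Proof. by rewrite /ind_assoc nabla_liftE; exact: ind_assoc_inE. Qed.
End Forward.

Section Backward.
Variable n : nat.

Section Inner.
Variables (j l : nat) (e : (j + l)%N = n) (y : X l).
(** The inverse is built symmetrically, with y fixed during the lift over the inner induction of M
    and N. *)
Definition ind_assocV_b i k (e' : (i + k)%N = j) (m : M i) (x : N k) :
  res (rhol e) (L n) :=
  nb (addn_assocl e e') m (nb erefl x y).
Lemma ind_assocV_bDl i k (e' : (i + k)%N = j) x :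
  {morph (ind_assocV_b e')^~ x : x x' / x + x'}.
Proof. by move=> m m'; rewrite /ind_assocV_b nbDl. Qed.
Lemma ind_assocV_bDr i k (e' : (i + k)%N = j) m :
  {morph ind_assocV_b e' m : x x' / x + x'}.
Proof. by move=> x x'; rewrite /ind_assocV_b nbDl nbDr. Qed.
Lemma ind_assocV_bZ i k (e' : (i + k)%N = j) c d m x :
  ind_assocV_b e' (c *: m) (d *: x) = rhoc e' (tp c d) *: ind_assocV_b e' m x.
Proof.
rewrite res_scaleE /ind_assocV_b -{1}[y]scale1r nb_tp nb_tp.
by rewrite -(rhoc_assoc e' erefl e).
Qed.
Definition ind_assocV_in : {linear nabla A (gtens M N) j -> res (rhol e) (L n)} :=
  nabla_lift (Z := res (rhol e) (L n)) ind_assocV_bDl ind_assocV_bDr ind_assocV_bZ.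
Lemma ind_assocV_inE i k (e' : (i + k)%N = j) m x :
  ind_assocV_in (nb e' m x) = nb (addn_assocl e e') m (nb erefl x y).
Proof. exact: (nabla_liftE
  (Z := res (rhol e) (L n)) ind_assocV_bDl ind_assocV_bDr ind_assocV_bZ). Qed.
End Inner.

Definition ind_assocV_o j l (e : (j + l)%N = n) (z : nabla A (gtens M N) j) (y : X l) :
  L n :=
  ind_assocV_in e y z.
Lemma ind_assocV_oE i j k l (e : (j + l)%N = n) (e' : (i + k)%N = j) c m x y :
  ind_assocV_o e (c *: nb e' m x) y =
  rhoc e (tp c 1) *: nb (addn_assocl e e') m (nb erefl x y).
Proof. by rewrite /ind_assocV_o linearZ /= ind_assocV_inE. Qed.
Lemma ind_assocV_oDl j l (e : (j + l)%N = n) y :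
  {morph (ind_assocV_o e)^~ y : x x' / x + x'}.
Proof. exact: (lin_additive (ind_assocV_in e y)). Qed.
Lemma ind_assocV_oDr j l (e : (j + l)%N = n) z :
  {morph ind_assocV_o e z : x x' / x + x'}.
Proof.
move=> y y'; move: z; apply: nabla_addE => [z z'|z z'|i k e' c m x].
- exact: ind_assocV_oDl.
- by rewrite (ind_assocV_oDl e y) (ind_assocV_oDl e y') addrACA.
apply: etrans (ind_assocV_oE _ _ _ _ _ _) _; rewrite nbDr nbDr scalerDr.
by apply: esym; congr (_ + _); exact: ind_assocV_oE.
Qed.
Lemma ind_assocV_oZ j l (e : (j + l)%N = n) c d z y :
  ind_assocV_o e (c *: z) (d *: y) = rhoc e (tp c d) *: ind_assocV_o e z y.
Proof.
rewrite /ind_assocV_o (linearZ_LR (ind_assocV_in e _)) res_scaleE -rhocl_rhocr;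
  congr (_ *: _).
move: z; apply: nabla_addE => [z z'|z z'|i k e' a m x].
- exact: ind_assocV_oDl.
- by rewrite (lin_additive (ind_assocV_in e y)) scalerDr.
apply: etrans (ind_assocV_oE _ _ _ _ _ _) _; apply: esym.
apply: etrans (congr1 ( *:%R _) (ind_assocV_oE _ _ _ _ _ _)) _; apply: esym.
rewrite [RHS]rhocr_rhocl -[RHS]rhocl_rhocr; congr (_ *: _).
rewrite -{1}[m]scale1r -{1}[x]scale1r !nb_tp -(rhoc_assoc e' erefl e).
by rewrite rmorph1.
Qed.
Definition ind_assocV : {linear R n -> L n} :=
  nabla_lift ind_assocV_oDl ind_assocV_oDr ind_assocV_oZ.
Lemma ind_assocVE i j k l (e : (j + l)%N = n) (e' : (i + k)%N = j) m x y :
  ind_assocV (nb e (nb e' m x) y) = nb (addn_assocl e e') m (nb erefl x y).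
Proof. by rewrite /ind_assocV nabla_liftE; exact: ind_assocV_inE. Qed.
End Backward.
End InductionAssociativity.

Section InductionComposition.
Variables (F : fieldType) (A : tower F) (M N : gmod A).
Local Opaque nabla nb Ind_mor ind_assoc ind_assocV gtens.

(** A round trip through the associativity maps returns the generator with its inner degree equality
    replaced by [erefl]; the element is the same. *)
Lemma nb_nbr (X : gmod A) n i j k l (e : (i + j)%N = n) (e' : (k + l)%N = j)
    (e1 : (i + (k + l))%N = n) (m : M i) (x : N k) (y : X l) :
  nb e m (nb e' x y : nabla A (gtens N X) j) = nb e1 m (nb erefl x y).
Proof. by case: _ / e' e => e; rewrite (eq_irrelevance e1 e). Qed.
Lemma nb_nbl (X : gmod A) n i j k l (e : (j + l)%N = n) (e' : (i + k)%N = j)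
    (e1 : (i + k + l)%N = n) (m : M i) (x : N k) (y : X l) :
  nb e (nb e' m x : nabla A (gtens M N) j) y = nb e1 (nb erefl m x) y.
Proof. by case: _ / e' e => e; rewrite (eq_irrelevance e1 e). Qed.

Lemma ind_assocK X n : cancel (@ind_assoc F A M N X n) (@ind_assocV F A M N X n).
Proof.
apply: (nabla_eq (g := @ind_assocV F A M N X n \o @ind_assoc F A M N X n
    : {linear _ -> _})
  (h := idfun)) => i j e m z /=.
move: z; apply: nabla_addE => [z z'|z z'|k l e' c x y].
- by rewrite nbDr !linearD.
- by rewrite nbDr.
rewrite -{1 2}[m]scale1r nb_tp !linearZ; congr (_ *: _).
rewrite (ind_assocE e e' m x y) (ind_assocVE (addn_assocr e e') erefl m x y);
  exact: esym (nb_nbr _ _ _ _ _ _).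
Qed.

Lemma ind_assocVK X n : cancel (@ind_assocV F A M N X n) (@ind_assoc F A M N X n).
Proof.
apply: (nabla_eq (g := @ind_assoc F A M N X n \o @ind_assocV F A M N X n
    : {linear _ -> _})
  (h := idfun)) => j l e z y /=.
move: z; apply: nabla_addE => [z z'|z z'|i k e' c m x].
- by rewrite nbDl !linearD.
- by rewrite nbDl.
rewrite -{1 2}[y]scale1r nb_tp !linearZ; congr (_ *: _).
rewrite (ind_assocVE e e' m x y) (ind_assocE (addn_assocl e e') erefl m x y);
  exact: esym (nb_nbl _ _ _ _ _ _).
Qed.

Lemma ind_assoc_nbZ (X : gmod A) n i j (e : (i + j)%N = n) m c z :
  ind_assoc M N X n (nb e m (c *: z)) = rhoc e (tp 1 c) *: ind_assoc M N X n (nb e m z).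
Proof. by rewrite -{1}[m]scale1r nb_tp linearZ. Qed.

Section Naturality.
Variables (X Y : gmod A) (f : ghom X Y) (n : nat).
Notation L Z := (nabla A (gtens M (nabla A (gtens N Z)))).
Notation R Z := (nabla A (gtens (nabla A (gtens M N)) Z)).
Variables (h : forall j, {linear nabla A (gtens N X) j -> nabla A (gtens N Y) j}).
Variables (h1 : {linear L X n -> L Y n}) (h2 : {linear R X n -> R Y n}).
Hypothesis hE : forall j k l (e : (k + l)%N = j) x y, h j (nb e x y) = nb e x (f l y).
Hypothesis h1E : forall i j (e : (i + j)%N = n) m z, h1 (nb e m z) = nb e m (h j z).
Hypothesis h2E : forall j l (e : (j + l)%N = n) z y, h2 (nb e z y) = nb e z (f l y).
(** Here h, h1 and h2 stand for the maps that f induces on the inner, left and right inductions;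
    they enter only through their values on generators. *)
Lemma ind_assoc_natural z : ind_assoc M N Y n (h1 z) = h2 (ind_assoc M N X n z).
Proof.
move: z; apply: (nabla_eq (g := ind_assoc M N Y n \o h1 : {linear _ -> _})
  (h := h2 \o ind_assoc M N X n : {linear _ -> _})) => i j e m z.
apply: etrans (congr1 (ind_assoc M N Y n) (h1E e m z)) _.
move: z; apply: nabla_addE => [z z'|z z'|k l e' c x y].
- by rewrite (linearD (h j)) nbDr (linearD (ind_assoc M N Y n)).
- by rewrite nbDr !linearD.
transitivity (rhoc e (tp 1 c) *: nb (addn_assocr e e') (nb erefl m x) (f l y)).
  by rewrite (linearZ_LR (h j)) ind_assoc_nbZ hE ind_assocE.
apply: esym; apply: etrans (congr1 h2 (ind_assoc_nbZ _ _ _ _)) _.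
rewrite (linearZ_LR h2); congr (_ *: _).
apply: etrans (congr1 h2 (ind_assocE _ _ _ _ _)) _; exact: h2E.
Qed.
End Naturality.

Local Transparent nabla nb Ind_mor gtens nabla_lift.

Lemma Ind_comp : natiso (Ind M \of Ind N) (Ind (nabla A (gtens M N))).
Proof.
apply: (@natiso_bij F _ _ A A (Ind M \of Ind N) (Ind (nabla A (gtens M N)))
  (fun X n => ind_assoc M N X n)) => [X n|X Y f n x].
  by exists (ind_assocV M N X n); [exact: ind_assocK|exact: ind_assocVK].
exact: (ind_assoc_natural (h := fun j => Ind_mor N f j)
  (h1 := @Ind_mor F A M (nabla A (gtens N X)) (nabla A (gtens N Y))
    (fun j => Ind_mor N f j) n)
  (h2 := Ind_mor (nabla A (gtens M N)) f n)
  (fun j => @Ind_morE F A N X Y f j)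
  (@Ind_morE F A M (nabla A (gtens N X)) (nabla A (gtens N Y))
    (fun j => Ind_mor N f j) n)
  (@Ind_morE F A (nabla A (gtens M N)) X Y f n) x).
Qed.
End InductionComposition.

(** * Hom out of a projective module and induction *)

Section RankOne.
Variables (R : pzRingType) (P V : lmodType R).
(** The rank one operator attached to a functional d on P and a vector v. *)
Definition rank1_fun (d : {linear P -> R^o}) (v : V) (x : P) : V := (d x : R) *: v.
Lemma rank1_funD d v : {morph rank1_fun d v : x y / x + y}.
Proof. by move=> x y; rewrite /rank1_fun linearD scalerDl. Qed.
Lemma rank1_funZ d v a x : rank1_fun d v (a *: x) = a *: rank1_fun d v x.
Proof. by rewrite /rank1_fun dualZ scalerA. Qed.
Definition rank1 d v : homz P V := lin_of (rank1_funD d v) (rank1_funZ d v).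
Lemma rank1E d v x : happ (rank1 d v) x = (d x : R) *: v.
Proof. by []. Qed.
Lemma rank1D d : {morph rank1 d : x y / x + y}.
Proof. by move=> x y; apply: happ_eq => p; exact: scalerDr. Qed.
(** This is where projectivity of P helps: maps out of P are sums of rank one operators, and those
    pass through an induction on the target. *)
Lemma rank1_dual_basis n (e : 'I_n -> P) (d : 'I_n -> {linear P -> R^o})
    (f : homz P V) : dual_basis e d -> f = \sum_i rank1 (d i) (happ f (e i)).
Proof.
move=> ed; apply: happ_eq => x; rewrite happ_sum {1}[x]ed.
rewrite (big_morph (happ f) (happDr f) (linear0 (f : {linear _ -> _}))).
by apply: eq_bigr => i _; rewrite happZ.
Qed.
End RankOne.

Section HomInduction.
Variables (F : fieldType) (A : tower F).
Local Notation A2 := (A2 A).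
Local Notation A4 := (A4 A).
Local Notation nabla2 := (nabla2 A).
Local Notation nabla := (nabla A).

Lemma pair_fin (p : nat * nat) : finite_fibres (pair p : nat * nat -> _).
Proof. by move=> q; exists [:: q.2] => i <-; rewrite inE. Qed.

(* The modules W_(p, q) for fixed p, as a graded module over the second factor;
   the first factor acts on it by endomorphisms. *)
Definition fixl p : functor (modc A4) (modc A2) :=
  Resf (t := pair p) (fun q => tinr (A2 p) (A2 q)) (pair_fin p).
Definition fixl_act (W : gmod A4) p (b : A2 p) : ghom (fixl p W) (fixl p W) :=
  fun q => lact (W (p, q)) b.

Definition rp p i (e : addp p = i) : alghom (A2 p) (A i) := fib_hom (rhop A) e.

Lemma addp2_eq p q i j (ep : addp p = i) (er : addp q = j) :
  addp2 (p, q) = (i, j).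
Proof. by rewrite /addp2 ep er. Qed.

Lemma fib_hom2 p q i j (ep : addp p = i) (er : addp q = j) b b' :
  fib_hom (rhop2 A) (addp2_eq ep er) (tp b b') = tp (rp ep b) (rp er b').
Proof.
move: (addp2_eq ep er); case: _ / ep; case: _ / er => e.
rewrite (eq_irrelevance e erefl) /= alift_tp /= /tinl_fun /tinr_fun.
by rewrite [_ * _]tpM mul1r mulr1.
Qed.

Section Object.
Variables (W : gmod A4).

Definition ib2 p q i j (ep : addp p = i) (er : addp q = j) (w : W (p, q)) :
  nabla2 W (i, j) := ib (rhop2 A) (addp2_eq ep er) w.
Definition tens2 i j (s : A i) (d : A j) (z : nabla2 W (i, j)) : nabla2 W (i, j) :=
  (tp s d : talg (A i) (A j)) *: z.

Lemma ib2D p q i j (ep : addp p = i) (er : addp q = j) :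
  {morph ib2 ep er : x y / x + y}.
Proof. exact: ibD. Qed.
Lemma ib2Z p q i j (ep : addp p = i) (er : addp q = j) b b' w :
  ib2 ep er ((tp b b' : talg (A2 p) (A2 q)) *: w) =
  tens2 (rp ep b) (rp er b') (ib2 ep er w).
Proof. by rewrite /ib2 /tens2 -fib_hom2 -ibZ. Qed.
Lemma tens2D i j s d : {morph @tens2 i j s d : x y / x + y}.
Proof. by move=> x y; exact: scalerDr. Qed.
Lemma tens2M i j (s s' : A i) (d d' : A j) z :
  tens2 s d (tens2 s' d' z) = tens2 (s * s') (d * d') z.
Proof. by rewrite /tens2 scalerA [_ * _]tpM. Qed.
Lemma tinl_tens2 i j (s : A i) (z : nabla2 W (i, j)) :
  tinl (A i) (A j) s *: z = tens2 s 1 z.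
Proof. by []. Qed.
Lemma tinr_tens2 i j (d : A j) (z : res (tinr (A i) (A j)) (nabla2 W (i, j))) :
  d *: z = tens2 1 d z.
Proof. by []. Qed.

Lemma nabla2_addE i j (Z : zmodType) (g h : nabla2 W (i, j) -> Z) :
  {morph g : x y / x + y} -> {morph h : x y / x + y} ->
  (forall p q (ep : addp p = i) (er : addp q = j) s d w,
     g (tens2 s d (ib2 ep er w)) = h (tens2 s d (ib2 ep er w))) ->
  g =1 h.
Proof.
move=> gD hD gh; apply: (Indf_addE gD hD) => -[p q] e c w.
have [ep er] : addp p = i /\ addp q = j by move: e => [-> ->].
rewrite (eq_irrelevance e (addp2_eq ep er)).
elim/tring_ind: c => [c c' ec ec'|s d]; first by rewrite scalerDl gD ec ec' hD.
exact: gh.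
Qed.

(** The conditions on b say that it is additive in each argument, balanced over F between s and d,
    and balanced over [A2 p] (x) [A2 q] between (s, d) and w. *)
Lemma nabla2_lift_add i j (Z : zmodType)
    (b : forall p q (ep : addp p = i) (er : addp q = j), A i -> A j -> W (p, q) -> Z) :
  (forall p q (ep : addp p = i) (er : addp q = j),
    [/\ forall d w, {morph (fun s => b p q ep er s d w) : x y / x + y},
        forall s w, {morph (fun d => b p q ep er s d w) : x y / x + y},
        forall s d, {morph b p q ep er s d : x y / x + y},
        forall s k d w, b p q ep er (scal (A i) k * s) d w =
          b p q ep er s (scal (A j) k * d) w &
        forall s a d a' w, b p q ep er (s * rp ep a) (d * rp er a') w =
          b p q ep er s d ((tp a a' : talg (A2 p) (A2 q)) *: w)]) ->
  exists2 h : nabla2 W (i, j) -> Z, {morph h : x y / x + y} &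
    forall p q (ep : addp p = i) (er : addp q = j) s d w,
      h (tens2 s d (ib2 ep er w)) = b p q ep er s d w.
Proof.
move=> bb.
pose e1 (p q : nat * nat) (e : addp2 (p, q) = (i, j)) : addp p = i :=
  congr1 fst e.
pose e2 (p q : nat * nat) (e : addp2 (p, q) = (i, j)) : addp q = j :=
  congr1 snd e.
have eE p q (e : addp2 (p, q) = (i, j)) : e = addp2_eq (e1 p q e) (e2 p q e).
  exact: eq_irrelevance.
(* A coefficient is an arbitrary element of A_i (x) A_j; a tensor lift extends b to it from the pure
   coefficients s (x) d. *)
pose b' (r : (nat * nat) * (nat * nat)) : forall (e : addp2 r = (i, j))
    (c : talg (A i) (A j)) (w : W r), Z :=
  match r with (p, q) => fun e (c : tring (A i) (A j)) w =>
    tlift (fun (s : (A i)^o) (d : (A j)^o) => b p q (e1 p q e) (e2 p q e) s d w) c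
  end.
have bal p q (e : addp2 (p, q) = (i, j)) w :
    balanced (@rscal F (A i) (A i)^o) (@lscal F (A j) (A j)^o)
    (fun (s : (A i)^o) (d : (A j)^o) => b p q (e1 p q e) (e2 p q e) s d w).
  have [h1 h2 h3 h4 _] := bb p q (e1 p q e) (e2 p q e).
  split=> [s s' d|s d d'|s k d]; [exact: h1|exact: h2|exact: h4].
have b'tp p q (e : addp2 (p, q) = (i, j)) s d w :
    b' (p, q) e (tp s d) w = b p q (e1 p q e) (e2 p q e) s d w.
  exact: (tlift_pure (bal p q e w)).
have b'Dl p q (e : addp2 (p, q) = (i, j)) w :
    {morph (b' (p, q) e)^~ w : c c' / c + c'}.
  exact: (tliftD (bal p q e w)).
have b'Dr p q (e : addp2 (p, q) = (i, j)) c : {morph b' (p, q) e c : w w' / w + w'}.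
  move=> w w'; elim/tring_ind: c => [c c' ec ec'|s d].
    by rewrite !b'Dl ec ec' addrACA.
  by rewrite !b'tp; have [_ _ h3 _ _] := bb p q (e1 p q e) (e2 p q e); exact: h3.
have [] := @Indf_lift_add_ex F _ _ _ _ _ (rhop2 A) W (i, j) Z b'.
  move=> [p q] e; split=> [c c' w|c w w'|c a w]; [exact: b'Dl|exact: b'Dr|].
  rewrite /ind_ra /ind_la.
  elim/tring_ind: c => [c c' ec ec'|s d]; first by rewrite mulrDl !b'Dl ec ec'.
  elim/tring_ind: a => [a a' ea ea'|a a'].
    by rewrite rmorphD mulrDr b'Dl ea ea' scalerDl b'Dr.
  have -> : fib_hom (rhop2 A) e (tp a a') = tp (rp (e1 p q e) a) (rp (e2 p q e) a').
    by rewrite [in LHS](eE p q e) fib_hom2.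
  rewrite [tp s d * _]tpM !b'tp.
  by have [_ _ _ _ h5] := bb p q (e1 p q e) (e2 p q e); exact: h5.
move=> h hD hE; exists h => // p q ep er s d w.
have -> : ep = e1 p q (addp2_eq ep er) by exact: eq_irrelevance.
have -> : er = e2 p q (addp2_eq (e1 p q (addp2_eq ep er)) er).
  exact: eq_irrelevance.
rewrite /tens2 /ib2 hE b'tp.
by congr (b _ _ _ _ _ _ _); exact: eq_irrelevance.
Qed.
End Object.
End HomInduction.
Arguments rp {F A p i} e.

Section PushMapLaws.
Variables (F : fieldType) (I J : choiceType).
Variables (B : I -> fdalg F) (C : J -> fdalg F) (t : I -> J).
Variable f : forall i, alghom (B i) (C (t i)).
Local Opaque Indf ib Indf_mor.

Lemma Indf_mor_add (X Y : gmod B) (u v w : ghom X Y) j z :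
  (forall i x, w i x = u i x + v i x) ->
  Indf_mor f w j z = Indf_mor f u j z + Indf_mor f v j z.
Proof.
move=> wE; move: z; apply: Indf_addE => [x y|x y|i e c x].
- exact: linearD.
- by rewrite !linearD addrACA.
rewrite !linearZ !Indf_morE wE ibD; exact: scalerDr.
Qed.

Lemma Indf_mor_comp (X Y Z : gmod B) (v : ghom Y Z) (u : ghom X Y)
    (w : ghom X Z) j z : (forall i x, w i x = v i (u i x)) ->
  Indf_mor f w j z = Indf_mor f v j (Indf_mor f u j z).
Proof.
move=> wE; move: z; apply: Indf_addE => [x y|x y|i e c x].
- exact: linearD.
- by rewrite !linearD.
by rewrite !linearZ !Indf_morE wE.
Qed.
End PushMapLaws.

(** * Comparison of nabla Hom(Q, -) with Hom(P, nabla2 -) *)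

Section HomInductionIso.
Variables (F : fieldType) (A : tower F) (P : gmod A) (Q : gmod (A2 A)).
Variable eta : ghom P (nabla A Q).
Hypothesis eta_bij : forall Y : gmod (A2 A),
  bijective (fun (u : ghom Q Y) j => Indf_mor (rhop A) u j \o eta j : {linear _ -> _}).
Local Notation A2 := (A2 A).
Local Notation A4 := (A4 A).
Local Notation nabla2 := (nabla2 A).
Local Notation nabla := (nabla A).

Section Object.
Variable W : gmod A4.

Section Unit.
Variable p : nat * nat.
Notation D := (Homf A2 Q W p).
(** Morphisms of graded modules from P to nabla W_(p, -). All degrees j appear together because the
    adjunction does not match single degrees of P with single degrees of Q. *)
Definition hom_sum : zmodType :=
  dsum (fun j => homz (P j) (nabla (fixl A p W) j)).

(** Q has finite support, so the finitely supported families in D are all the morphisms Q -> W_(p,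
    -). *)
Definition family_of (g : D) : ghom Q (fixl A p W) := fun q => dval g q.
Definition adj_map_val (g : D) j : homz (P j) (nabla (fixl A p W) j) :=
  Indf_mor (rhop A) (family_of g) j \o eta j : {linear _ -> _}.
Lemma adj_map_supp (g : D) :
  exists s : seq nat, forall j, j \notin s -> adj_map_val g j = 0.
Proof.
have [s s0] := gsupp P; exists s => j /s0 P0; apply: happ_eq => x.
by rewrite (P0 x) !happ0r.
Qed.
Definition adj_map (g : D) : hom_sum := DSum (adj_map_supp g).
Lemma adj_mapE g j x : happ (dval (adj_map g) j) x =
  Indf_mor (rhop A) (family_of g) j (eta j x).
Proof. by []. Qed.

Lemma adj_mapD : {morph adj_map : g g' / g + g'}.
Proof.
move=> g g'; apply: dsum_ext => j; apply: happ_eq => x.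
rewrite adj_mapE (Indf_mor_add (u := family_of g) (v := family_of g')) //.
Qed.
(** Naturality of the adjunction, applied to the endomorphism by which b acts on W_(p, -). *)
Lemma adj_mapZ b g j x : happ (dval (adj_map (b *: g)) j) x =
  Indf_mor (rhop A) (fixl_act W b) j (happ (dval (adj_map g) j) x).
Proof.
by rewrite !adj_mapE (Indf_mor_comp (u := family_of g) (v := fixl_act W b)).
Qed.

Lemma adj_inv_ex : exists2 h : hom_sum -> D, cancel adj_map h & cancel h adj_map.
Proof.
have [k Kk kK] := eta_bij (fixl A p W).
have supp (y : hom_sum) : exists s : seq _, forall q, q \notin s ->
    (k (fun j => dval y j) q : homr (Q q) (W (p, q))) = 0.
  have [s s0] := gsupp Q; exists s => q /s0 Q0; apply: happ_eq => x.
  by rewrite (Q0 x) !happ0r.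
exists (fun y => DSum (supp y)) => [g|y].
  by apply: dsum_ext => q; rewrite -[RHS]/(family_of g q) -(Kk (family_of g)).
apply: dsum_ext => j; apply: happ_eq => x.
have := congr1 (fun h : ghom P (nabla (fixl A p W)) => h j x) (kK (fun j => dval y j)).
exact.
Qed.
Definition adj_inv : hom_sum -> D := projT1 (cid2 adj_inv_ex).
Lemma adj_mapK : cancel adj_map adj_inv. Proof. by rewrite /adj_inv; case: cid2. Qed.
Lemma adj_invK : cancel adj_inv adj_map. Proof. by rewrite /adj_inv; case: cid2. Qed.
Lemma adj_invD : {morph adj_inv : y y' / y + y'}.
Proof. by move=> y y'; rewrite -{1}[y]adj_invK -{1}[y']adj_invK -adj_mapD adj_mapK. Qed.
Lemma adj_invZ b (y y' : hom_sum) :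
  (forall j x, happ (dval y' j) x =
     Indf_mor (rhop A) (fixl_act W b) j (happ (dval y j) x)) ->
  adj_inv y' = b *: adj_inv y.
Proof.
move=> yy'; apply: (can_inj adj_mapK); rewrite adj_invK; apply: dsum_ext => j.
by apply: happ_eq => x; rewrite adj_mapZ adj_invK yy'.
Qed.
End Unit.

Section Kappa.
Variables (p : nat * nat) (i j : nat) (ep : addp p = i).
(* The map w |-> 1 (x) w induced by A_j -> A_i (x) A_j *)
Lemma kappa_ex : exists h : {linear nabla (fixl A p W) j ->
    res (tinr (A i) (A j)) (nabla2 W (i, j))},
  forall q (er : addp q = j) w, h (ib (rhop A) er w) = ib2 ep er w.
Proof.
pose b q (er : addp q = j) (w : fixl A p W q) :
  res (tinr (A i) (A j)) (nabla2 W (i, j)) := ib2 ep er (w : W (p, q)).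
have bD q (er : addp q = j) : {morph b q er : x y / x + y}.
  by move=> x y; exact: ib2D.
have bZ q (er : addp q = j) c w :
    b q er (c *: w) = fib_hom (rhop A) er c *: b q er w.
  apply: etrans (ib2Z ep er 1 c w) _.
  by rewrite rmorph1.
exists (Indf_lift bD bZ) => q er w; exact: Indf_liftE.
Qed.
Definition kappa := projT1 (cid kappa_ex).
Lemma kappaE q (er : addp q = j) w : kappa (ib (rhop A) er w) = ib2 ep er w.
Proof. exact: (projT2 (cid kappa_ex)). Qed.
Lemma kappaZ d v : kappa (d *: v) = tens2 1 d (kappa v).
Proof. exact: (linearZ_LR kappa d v). Qed.
Lemma kappa_act b v : kappa (Indf_mor (rhop A) (fixl_act W b) j v) =
  tens2 (rp ep b) 1 (kappa v).
Proof.
move: v; apply: Indf_addE => [x y|x y|q er d w].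
- by rewrite !linearD.
- by rewrite linearD tens2D.
rewrite (linearZ_LR (Indf_mor (rhop A) (fixl_act W b) j)) !kappaZ Indf_morE !kappaE.
rewrite (ib2Z ep er b 1 w) rmorph1 !tens2M.
by rewrite !mul1r !mulr1.
Qed.
End Kappa.

Local Notation L := (Homf A P (nabla2 W)).
Local Notation R := (nabla (Homf A2 Q W)).
Variable i : nat.
Lemma happ_dvalD j (v : P j) :
  {morph (fun G : L i => happ (dval G j) v : nabla2 W (i, j)) : x y / x + y}.
Proof.
move=> x y.
have -> : dval (x + y) j = dval x j + dval y j by reflexivity.
by rewrite happD.
Qed.
Local Opaque Indf ib Indf_mor ib2 tens2.

(* theta (s (x) g) sends x in P_j to s . kappa (adj_map g x) *)
Definition theta_val p (ep : addp p = i) (g : Homf A2 Q W p) j :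
    homr (P j) (nabla2 W (i, j)) :=
  @kappa p i j ep \o (dval (adj_map g) j : {linear _ -> _}) : {linear _ -> _}.
Lemma theta_supp p (ep : addp p = i) (g : Homf A2 Q W p) :
  exists s : seq nat, forall j, j \notin s -> theta_val ep g j = 0.
Proof.
have [s s0] := gsupp P; exists s => j /s0 P0; apply: happ_eq => x.
by rewrite (P0 x) !happ0r.
Qed.
Definition theta_o p (ep : addp p = i) (g : Homf A2 Q W p) : L i :=
  DSum (theta_supp ep g).
Lemma theta_oE p (ep : addp p = i) (g : Homf A2 Q W p) j x :
  happ (dval (theta_o ep g) j) x = kappa j ep (happ (dval (adj_map g) j) x).
Proof. by []. Qed.
Lemma theta_oD p (ep : addp p = i) : {morph theta_o ep : x y / x + y}.
Proof.
move=> g g'; apply: dsum_ext => j; apply: happ_eq => x.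
by rewrite theta_oE adj_mapD happD; exact: (linearD (kappa j ep)).
Qed.
Lemma theta_oZ p (ep : addp p = i) b g :
  theta_o ep (b *: g) = fib_hom (rhop A) ep b *: theta_o ep g.
Proof.
apply: dsum_ext => j; apply: happ_eq => x.
by rewrite theta_oE adj_mapZ kappa_act.
Qed.
Definition theta : {linear R i -> L i} := Indf_lift theta_oD theta_oZ.
Lemma thetaE p (ep : addp p = i) g : theta (ib (rhop A) ep g) = theta_o ep g.
Proof. exact: Indf_liftE. Qed.

Section Xi.
Variables (j : nat) (a : {linear P j -> (A j)^o}).

(* For a : P_j -> A_j, the element (s (x) d) (x) w is sent to s (x) g, where g is
   adjoint to the map x |-> a(x) d (x) w on P_j. *)
Definition xi_o p q (ep : addp p = i) (er : addp q = j) (s : A i) (d : A j)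
    (w : W (p, q)) : R i :=
  s *: ib (rhop A) ep (adj_inv (dinj (M := fun j => homz (P j) (nabla (fixl A p W) j))
    (rank1 a (d *: ib (rhop A) (X := fixl A p W) er w)))).

(** The action of b through the first factor commutes with d and with the functional a, so it passes
    through the inverse adjunction by [adj_invZ]. *)
Lemma xi_act p q (er : addp q = j) b (d : A j) (w : W (p, q)) :
  adj_inv (dinj (M := fun j => homz (P j) (nabla (fixl A p W) j))
    (rank1 a (d *: ib (rhop A) (X := fixl A p W) er
      (tinl (A2 p) (A2 q) b *: w : W (p, q))))) =
  b *: adj_inv (dinj (M := fun j => homz (P j) (nabla (fixl A p W) j))
    (rank1 a (d *: ib (rhop A) (X := fixl A p W) er w))).
Proof.
apply: adj_invZ => k; have [<- x|jk x] := eqVneq j k; last first.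
  by rewrite !dinj_other // linear0.
by rewrite !dinj_same !rank1E !linearZ Indf_morE.
Qed.

Lemma xi_ex : exists2 h : nabla2 W (i, j) -> R i, {morph h : x y / x + y} &
  forall p q (ep : addp p = i) (er : addp q = j) s d w,
    h (tens2 s d (ib2 ep er w)) = xi_o ep er s d w.
Proof.
apply: nabla2_lift_add => p q ep er; split.
- by move=> d w s s'; exact: scalerDl.
- move=> s w d d'; rewrite /xi_o scalerDl rank1D dinjD adj_invD ibD.
  exact: scalerDr.
- move=> s d w w'; rewrite /xi_o ibD scalerDr rank1D dinjD adj_invD ibD.
  exact: scalerDr.
(* The scalar k in A_i and in A_j is the image of the scalar in [A2 p] and in [A2 q]; either way it
   can be moved onto w, where both give the same element. *)
- move=> s k d w; rewrite /xi_o scal_central -scalerA -(ahom_scal (rp ep) k) -ibZ.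
  rewrite -xi_act scal_central -scalerA -(ahom_scal (rp er) k) -ibZ.
  congr (_ *: ib _ _ (adj_inv (dinj (rank1 _ (_ *: ib _ _ _))))).
  by rewrite res_scaleE !ahom_scal.
move=> s b d b' w; rewrite /xi_o -scalerA -ibZ -xi_act -scalerA -ibZ.
congr (_ *: ib _ _ (adj_inv (dinj (rank1 _ (_ *: ib _ _ _))))).
exact: (@tinrl_scale F (A2 p) (A2 q) (W (p, q)) b b' w).
Qed.
Definition xi : nabla2 W (i, j) -> R i := projT1 (cid2 xi_ex).
Lemma xiD : {morph xi : x y / x + y}.
Proof. by rewrite /xi; case: cid2. Qed.
Lemma xiE p q (ep : addp p = i) (er : addp q = j) s d w :
  xi (tens2 s d (ib2 ep er w)) = xi_o ep er s d w.
Proof. by rewrite /xi; case: cid2 => h hD hE; exact: hE. Qed.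

(** [theta] undoes the inverse adjunction inside [xi], so a generator gives x |-> s . (a(x) d . w),
    with s acting through the first factor and a(x) d through the second; the two factors
    commute. *)
Lemma theta_xi z : theta (xi z) =
  dinj (M := fun j => homr (P j) (nabla2 W (i, j)))
    (rank1 a (z : res (tinr (A i) (A j)) (nabla2 W (i, j)))).
Proof.
move: z; apply: nabla2_addE => [z z'|z z'|p q ep er s d w].
- by rewrite xiD linearD.
- by rewrite rank1D dinjD.
rewrite xiE /xi_o linearZ thetaE.
apply: dsum_ext => k; apply: happ_eq => x; rewrite homr_scaleE theta_oE adj_invK.
move: x; have [<- x|jk x] := eqVneq j k; last first.
  by rewrite !dinj_other // linear0 scaler0.
rewrite !dinj_same !rank1E linearZ kappaZ kappaE.
apply: etrans (tinl_tens2 _ _) _.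
apply: etrans (congr1 (tens2 s 1) (tinr_tens2 (a x : A j) _)) _.
apply: esym; apply: etrans (tinr_tens2 _ _) _.
by rewrite !tens2M !mul1r !mulr1.
Qed.

(** The counterpart of [theta_xi] for the other composite: on the elements produced by [kappa], the
    map [xi] reads off the adjoint of the rank one operator on v. *)
Lemma xi_kappa p (ep : addp p = i) s v :
  xi (tens2 s 1 (kappa j ep v)) = s *: ib (rhop A) ep
    (adj_inv (dinj (M := fun j => homz (P j) (nabla (fixl A p W) j)) (rank1 a v))).
Proof.
move: v; apply: Indf_addE => [v v'|v v'|q er d w].
- by rewrite linearD tens2D xiD.
- by rewrite rank1D dinjD adj_invD ibD; exact: scalerDr.
by rewrite kappaZ kappaE tens2M mulr1 mul1r xiE.
Qed.
End Xi.

(* The inverse sends G to the sum of the xi_a (G_j e) over the pairs (e, a) of a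
   dual basis of each P_j. *)
Lemma theta_bij : gproj P -> bijective theta.
Proof.
move=> pP; pose db j := projective_dual_basis (pP j) (fgP (P j)).
have [n [e [d ed]]] : exists (n : nat -> nat) (e : forall j, 'I_(n j) -> P j)
    (d : forall j, 'I_(n j) -> {linear P j -> (A j)^o}),
    forall j, dual_basis (e j) (d j).
  exists (fun j => projT1 (cid (db j))), (fun j => projT1 (cid (projT2 (cid (db j))))).
  exists (fun j => projT1 (cid (projT2 (cid (projT2 (cid (db j))))))) => j.
  exact: (projT2 (cid (projT2 (cid (projT2 (cid (db j))))))).
have [s us s0] : exists2 s : seq nat, uniq s &
    forall j, j \notin s -> zero_module (P j).
  have [s s0] := gsupp P; exists (undup s); first exact: undup_uniq.
  by move=> j; rewrite mem_undup; exact: s0.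
pose inv (G : L i) : R i :=
  \sum_(j <- s) \sum_m xi (d j m) (happ (dval G j) (e j m)).
have xiS j a (I : Type) (r : seq I) (f : I -> nabla2 W (i, j)) :
    xi a (\sum_(k <- r) f k) = \sum_(k <- r) xi a (f k).
  apply: (big_morph _ (xiD a)).
  by apply: (addIr (xi a 0)); rewrite -xiD !add0r.
have invD : {morph inv : x y / x + y}.
  move=> x y; rewrite -big_split; apply: eq_bigr => j _; rewrite -big_split.
  by apply: eq_bigr => m _; rewrite (happ_dvalD (e j m) x y) xiD.
exists inv => [x|G].
  move: x; apply: Indf_addE => [x y|//|p ep c g]; first by rewrite linearD invD.
  rewrite linearZ thetaE -[in RHS](adj_mapK g).
  (* Once the adjoint of g is expanded into rank one operators, the two sides agree term by term by
     [xi_kappa]. *)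
  have -> : adj_map g = \sum_(j <- s) \sum_m
      dinj (M := fun j => homz (P j) (nabla (fixl A p W) j))
        (rank1 (d j m) (happ (dval (adj_map g) j) (e j m))).
    rewrite [LHS](dsumE (x := adj_map g) us) => [|j /s0 P0]; last first.
      by apply: happ_eq => x; rewrite (P0 x) !happ0r.
    apply: eq_bigr => j _; rewrite {1}(rank1_dual_basis (dval (adj_map g) j) (ed j)).
    exact: (@dinj_sum _ (fun j => homz (P j) (nabla (fixl A p W) j))).
  have psi0 : adj_inv (0 : hom_sum p) = 0.
    by apply: (addIr (adj_inv (0 : hom_sum p))); rewrite -adj_invD !add0r.
  have ib0 : ib (rhop A) ep (0 : Homf A2 Q W p) = 0.
    by apply: (addIr (ib (rhop A) ep 0)); rewrite -ibD !add0r.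
  rewrite (big_morph _ (@adj_invD p) psi0)
    (big_morph _ (@ibD _ _ _ _ _ _ _ _ _ _ ep) ib0).
  rewrite scaler_sumr; apply: eq_bigr => j _.
  rewrite (big_morph _ (@adj_invD p) psi0)
    (big_morph _ (@ibD _ _ _ _ _ _ _ _ _ _ ep) ib0).
  rewrite scaler_sumr; apply: eq_bigr => m _.
  by rewrite -xi_kappa.
rewrite linear_sum [RHS](dsumE (x := G) us) => [|j /s0 P0]; last first.
  by apply: happ_eq => x; rewrite (P0 x) !happ0r.
apply: eq_bigr => j _; rewrite linear_sum.
under eq_bigr => m _ do rewrite theta_xi.
apply: etrans (esym (@dinj_sum _ (fun j => homr (P j) (nabla2 W (i, j))) _ _ _ _)) _.
apply: (congr1 (@dinj _ (fun j => homr (P j) (nabla2 W (i, j))) j)).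
exact: esym (rank1_dual_basis (dval G j) (ed j)).
Qed.
End Object.

Section Naturality.
Variables (W W' : gmod A4) (h : ghom W W').

Lemma ib2_mor p q i j (ep : addp p = i) (er : addp q = j) w :
  Indf_mor (rhop2 A) h (i, j) (ib2 ep er w) = ib2 ep er (h (p, q) w).
Proof. exact: Indf_morE. Qed.
Lemma tens2_mor i j s d z : Indf_mor (rhop2 A) h (i, j) (tens2 s d z) =
  tens2 s d (Indf_mor (rhop2 A) h (i, j) z).
Proof. exact: linearZ_LR. Qed.
Definition fixl_mor p : ghom (fixl A p W) (fixl A p W') :=
  fmor (fixl A p) (h : chom (c := modc A4) W W').
Local Opaque Indf ib Indf_mor ib2 tens2.

Lemma kappa_mor p i j (ep : addp p = i) v :
  kappa W' j ep (Indf_mor (rhop A) (fixl_mor p) j v) =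
  Indf_mor (rhop2 A) h (i, j) (kappa W j ep v).
Proof.
move: v; apply: Indf_addE => [x y|x y|q er d w].
- by rewrite !linearD.
- by rewrite !linearD.
rewrite (linearZ_LR (Indf_mor (rhop A) (fixl_mor p) j)) !kappaZ Indf_morE.
by rewrite !kappaE tens2_mor ib2_mor.
Qed.

Lemma theta_natural i x :
  theta W' i (Indf_mor (rhop A) (ghomr_mor Q h) i x) =
  ghomr_mor P (Indf_mor (rhop2 A) h) i (theta W i x).
Proof.
move: x; apply: Indf_addE => [x y|x y|p ep c g].
- by rewrite !linearD.
- by rewrite !linearD.
rewrite !linearZ Indf_morE; congr (_ *: _).
rewrite !thetaE; apply: dsum_ext => j; apply: happ_eq => x.
rewrite theta_oE adj_mapE (Indf_mor_comp (u := family_of g) (v := fixl_mor p)) //.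
exact: kappa_mor.
Qed.
End Naturality.

Lemma Homf_nabla2 : gproj P ->
  natiso (nabla \of Homf A2 Q) (Homf A P \of nabla2).
Proof.
move=> pP.
apply: (@natiso_bij F _ _ A4 A (nabla \of Homf A2 Q) (Homf A P \of nabla2) theta)
  => [W i|W W' h i x]; first exact: theta_bij.
exact: theta_natural.
Qed.
End HomInductionIso.

(** The unit is the image of the identity of L X; by naturality in Y, the adjunction bijection is
    composition with it. *)
Lemma right_adjoint_unit (C D : category) (G : functor D C) (L : functor C D) :
  right_adjoint G L -> forall X, exists eta : chom X (G (L X)),
    forall Y, bijective (fun u : chom (L X) Y => compc (fmor G u) eta).
Proof.
move=> [phi [phi_bij phi_nat]] X; exists (phi X (L X) (idc _)) => Y.
have adj_mapE u : phi X Y u = compc (fmor G u) (phi X (L X) (idc _)).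
  have := phi_nat X X (L X) Y (idc X) u (idc (L X)).
  by rewrite fmor1 !compc1.
by apply: eq_bij (phi_bij X Y) _ adj_mapE.
Qed.

(** * The Mackey isomorphism *)

Section RestrictTensor.
Variables (F : fieldType) (B C D E : fdalg F) (f : alghom B D) (g : alghom C E).

Lemma thom_tp b c : thom f g (tp b c) = tp (f b) (g c).
Proof. by rewrite /= alift_tp /= /tinl_fun /tinr_fun [_ * _]tpM mul1r mulr1. Qed.

Variables (M : lmodType D) (N : lmodType E).
Notation V := (res (thom f g) (xtens M N : lmodType (talg D E))).
Notation U := (xtens (res f M) (res g N)).

Definition res_xpure (m : res f M) (n : res g N) : V := xpure (m : M) (n : N).
Lemma res_xpureDl n : {morph res_xpure^~ n : x y / x + y}.
Proof. by move=> x y; exact: (@xpureDl F D E M N n x y). Qed.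
Lemma res_xpureDr m : {morph res_xpure m : x y / x + y}.
Proof. by move=> x y; exact: (@xpureDr F D E M N m x y). Qed.
Lemma res_xpureZ b c m n :
  res_xpure (b *: m) (c *: n) = (tp b c : talg B C) *: res_xpure m n.
Proof. by rewrite [RHS]res_scaleE thom_tp /res_xpure -xpureZ. Qed.
Definition res_xtens : {linear (U : lmodType (talg B C)) -> V} :=
  xtens_lift res_xpureDl res_xpureDr res_xpureZ.
Lemma res_xtens_pure (m : M) (n : N) :
  res_xtens (xpure (m : res f M) (n : res g N)) = xpure m n.
Proof. exact: (xtens_liftE res_xpureDl res_xpureDr res_xpureZ m n). Qed.

(** Both sides are the tensor product over F of the same spaces: f and g respect scalars, so F acts
    identically through B, C and through D, E. *)
Lemma res_xtens_bij : bijective res_xtens.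
Proof.
pose k (m : M) (n : N) : U := xpure (m : res f M) (n : res g N).
have kb : balanced (@rscal F D M) (@lscal F E N) k.
  split=> [m m' n|m n n'|m a n]; [exact: xpureDl|exact: xpureDr|].
  rewrite /rscal /lscal -(ahom_scal f) -(ahom_scal g).
  exact: (@xpureS F B C (res f M) (res g N)).
exists (tlift k).
  apply: xtens_addE => [x y|//|m n]; first by rewrite linearD; exact: (tliftD kb).
  by rewrite res_xtens_pure; exact: (tlift_pure kb).
apply: (xtens_addE (g := fun x => res_xtens (tlift k x))) => [x y|//|m n].
  by rewrite (tliftD kb) linearD.
by rewrite [tlift k _](tlift_pure kb); exact: res_xtens_pure.
Qed.
End RestrictTensor.

Lemma res_xtens_map (F : fieldType) (B C D E : fdalg F) (f : alghom B D)
    (g : alghom C E) (M : lmodType D) (N N' : lmodType E) (h : {linear N -> N'})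
    (x : xtens (res f M) (res g N)) :
  res_xtens f g M N' (xtens_map idfun (res_map g h) x) =
  xtens_map (idfun : {linear M -> M}) h (res_xtens f g M N x).
Proof.
move: x; apply: xtens_addE => [x y|x y|m n].
- by rewrite !linearD.
- by rewrite [res_xtens _ _ _ _ _]linearD; exact: (linearD (xtens_map _ h)).
apply: etrans (congr1 (res_xtens f g M N') (xtens_map_pure _ _ _ _)) _.
apply: etrans (res_xtens_pure f g m (h n)) _; apply: esym.
apply: etrans (congr1 (xtens_map (idfun : {linear M -> M}) h)
  (res_xtens_pure f g m n)) _.
exact: xtens_map_pure.
Qed.

Section Mackey.
Variables (F : fieldType) (A : tower F).

(** Needed because the Mackey isomorphism restricts M (x) N as a whole, while [Res2] restricts M and
    N separately. *)
Lemma delta2_Tensf (M : gmod A) :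
  natiso (Tensf (A2 A) (delta A M) \of delta A) (delta2 A \of Tensf A M).
Proof.
pose eta (N : gmod A) (r : (nat * nat) * (nat * nat)) :=
  res_xtens (rhop A r.1) (rhop A r.2) (M (addp r.1)) (N (addp r.2)).
apply: (@natiso_bij F _ _ A (A4 A) (Tensf (A2 A) (delta A M) \of delta A)
  (delta2 A \of Tensf A M) eta) => [N r|N N' f r x]; first exact: res_xtens_bij.
exact: res_xtens_map.
Qed.

Lemma Res_Ind (c : algauts A) (M P : gmod A) : strong c -> gproj P ->
  natiso (Res P \of Ind M) (nabla A \of Res2 (Psi2DeltaPsiV c P) M).
Proof.
move=> [adj mac] pP.
have [eta eta_bij] := right_adjoint_unit adj P.
have HN := Homf_nabla2 (eta := eta) eta_bij pP.
set Q := Psi2DeltaPsiV c P in HN *.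
have e1 : natiso (Res P \of Ind M)
    (Homf A P \of (nabla2 A \of S23 A \of delta2 A) \of Tensf A M).
  have := natiso_compr (Tensf A M) (natiso_compl (Homf A P) mac).
  exact.
apply: natiso_trans e1 _.
have e2 : natiso (nabla A \of (Homf (A2 A) Q \of S23 A \of Tensf (A2 A) (delta A M)
    \of delta A)) (Homf A P \of nabla2 A \of
      (S23 A \of (Tensf (A2 A) (delta A M) \of delta A))).
  exact: (natiso_compr (S23 A \of (Tensf (A2 A) (delta A M) \of delta A)) HN).
apply: natiso_trans (natiso_sym e2).
(* What remains is to replace delta2 (M (x) N) by (delta M) (x) (delta N) under functors that no
   longer change. *)
have := natiso_compl (Homf A P \of nabla2 A \of S23 A) (natiso_sym (delta2_Tensf M)).
exact.
Qed.
End Mackey.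

(** * Composition of restriction functors *)

Section ComponentCast.
Variables (F : fieldType) (A : tower F).

(** Carries elements between N_(i + (p + q)), where maps out of nabla (P (x) Q) take values, and
    N_(i + p + q), where iterated restriction does. *)
Definition zcast (N : gmod A) m n (e : m = n) (x : N m) : N n :=
  match e in _ = k return N k with erefl => x end.
Lemma zcastD (N : gmod A) m n (e : m = n) : {morph @zcast N m n e : x y / x + y}.
Proof. by case: _ / e. Qed.
Lemma zcastZ (N : gmod A) i j m n (e1 : (i + j)%N = m) (e : m = n) t (x : N m) :
  zcast e (rhoc e1 t *: x) = rhoc (etrans e1 e) t *: zcast e x.
Proof. by case: _ / e. Qed.
Lemma zcast_trans (N : gmod A) m n k (e : m = n) (e' : n = k) (e'' : m = k) (x : N m) :
  zcast e' (zcast e x) = zcast e'' x.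
Proof. by case: _ / e' e''; case: _ / e => e''; rewrite (eq_irrelevance e'' erefl). Qed.
Lemma zcast_mor (N N' : gmod A) (f : ghom N N') m n (e : m = n) x :
  f n (zcast e x) = zcast e (f m x).
Proof. by case: _ / e. Qed.
End ComponentCast.

Lemma inj_surj_bij (T U : Type) (f : T -> U) :
  injective f -> (forall y, exists x, f x = y) -> bijective f.
Proof.
move=> fI /choice[g gK]; exists g => // x; exact/fI/gK.
Qed.

Section RestrictionComposition.
Variables (F : fieldType) (A : tower F) (P Q : gmod A).
Local Notation PQ := (nabla A (gtens P Q)).
Local Notation L N := (Res P (Res Q N)).
Local Notation R N := (Res PQ N).

Lemma res_tinr_scale (N : gmod A) i j (b : A j)
    (x : res (tinr (A i) (A j)) (delta A N (i, j))) :
  b *: x = (rhoc erefl (tp 1 b) *: (x : N (i + j)%N)) :> N (i + j)%N.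
Proof. by []. Qed.
Lemma res_tinl_scale (N : gmod A) i j (b : A i) (x : delta A N (i, j)) :
  tinl (A i) (A j) b *: x = (rhoc erefl (tp b 1) *: (x : N (i + j)%N)) :> N (i + j)%N.
Proof. by []. Qed.

Section Forward.
Variables (N : gmod A) (i : nat).

Section Values.
Variable G : R N i.
(** Currying: G is sent to x |-> (y |-> G(1 (x) (x (x) y))), up to the change of degree. *)
Definition hom_curry_val p (x : P p) q (y : Q q) :
    res (tinr (A (i + p)%N) (A q)) (delta A N ((i + p)%N, q)) :=
  zcast (addnA i p q) (happ (dval G (p + q)%N) (nb erefl x y)).
Lemma hom_curry_valDr p (x : P p) q : {morph @hom_curry_val p x q : y y' / y + y'}.
Proof. by move=> y y'; rewrite /hom_curry_val nbDr happDr; exact: zcastD. Qed.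
Lemma hom_curry_valDl p q (y : Q q) :
  {morph (fun x : P p => hom_curry_val x y) : x x' / x + x'}.
Proof. by move=> x x'; rewrite /hom_curry_val nbDl happDr; exact: zcastD. Qed.
(** By associativity of the tower, 1 . (a . b) and (1 . a) . b act identically on N. This single
    identity gives linearity in x and in y. *)
Lemma hom_curry_val_tp p (x : P p) q (y : Q q) a b :
  hom_curry_val (a *: x) (b *: y) =
  (rhoc erefl (tp (rhoc erefl (tp 1 a)) b) *: (hom_curry_val x y : N (i + p + q)%N)) :>
    N (i + p + q)%N.
Proof.
rewrite /hom_curry_val nb_tp happZ res_tinr_scale zcastZ; congr (_ *: _).
exact: esym (rhoc_assoc _ _ _ _ _ _ _).
Qed.
Lemma hom_curry_valZr p (x : P p) q b y :
  @hom_curry_val p x q (b *: y) = b *: hom_curry_val x y.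
Proof.
rewrite -{1}[x]scale1r.
by apply: etrans (hom_curry_val_tp _ _ _ _) _; rewrite tp1 rmorph1.
Qed.
Definition hom_curry2 p (x : P p) q : homr (Q q) (delta A N ((i + p)%N, q)) :=
  lin_of (hom_curry_valDr x (q := q)) (hom_curry_valZr x (q := q)).
Lemma hom_curry2_supp p (x : P p) :
  exists s : seq nat, forall q, q \notin s -> hom_curry2 x q = 0.
Proof.
have [s s0] := gsupp Q; exists s => q /s0 Q0; apply: happ_eq => y.
by rewrite (Q0 y) !happ0r.
Qed.
Definition hom_curry1 p (x : P p) : res (tinr (A i) (A p)) (delta A (Res Q N) (i, p)) :=
  DSum (hom_curry2_supp x).
Lemma hom_curry1D p : {morph @hom_curry1 p : x x' / x + x'}.
Proof.
move=> x x'; apply: dsum_ext => q; apply: happ_eq => y.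
by apply: etrans (hom_curry_valDl _ _ _) _.
Qed.
Lemma hom_curry1Z p a x : @hom_curry1 p (a *: x) = a *: hom_curry1 x.
Proof.
apply: dsum_ext => q; apply: happ_eq => y.
rewrite -[LHS]/(hom_curry_val (a *: x) y) -{1}[y]scale1r.
exact: hom_curry_val_tp.
Qed.
Definition hom_curry0 p : homr (P p) (delta A (Res Q N) (i, p)) :=
  lin_of (@hom_curry1D p) (@hom_curry1Z p).
Lemma hom_curry0_supp : exists s : seq nat, forall p, p \notin s -> hom_curry0 p = 0.
Proof.
have [s s0] := gsupp P; exists s => p /s0 P0; apply: happ_eq => x.
by rewrite (P0 x) !happ0r.
Qed.
Definition hom_curry_fun : L N i := DSum hom_curry0_supp.
Lemma hom_curryE p x q y :
  happ (dval (happ (dval hom_curry_fun p) x : Res Q N (i + p)%N) q) y =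
  hom_curry_val x y.
Proof. by []. Qed.
End Values.

Lemma Res_Res_ext (H H' : L N i) :
  (forall p x q y, happ (dval (happ (dval H p) x : Res Q N (i + p)%N) q) y =
     happ (dval (happ (dval H' p) x : Res Q N (i + p)%N) q) y) -> H = H'.
Proof.
move=> HH; apply: dsum_ext => p; apply: happ_eq => x.
by apply: dsum_ext => q; apply: happ_eq => y; exact: HH.
Qed.

Lemma hom_curry_funD : {morph hom_curry_fun : G G' / G + G'}.
Proof.
move=> G G'; apply: Res_Res_ext => p x q y.
rewrite hom_curryE /hom_curry_val.
have -> : dval (G + G') (p + q)%N = dval G (p + q)%N + dval G' (p + q)%N by reflexivity.
by rewrite happD; apply: etrans (zcastD _ _ _) _.
Qed.
Lemma hom_curry_funZ a G : hom_curry_fun (a *: G) = a *: hom_curry_fun G.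
Proof.
apply: Res_Res_ext => p x q y.
rewrite hom_curryE /hom_curry_val.
have -> : dval (a *: G) (p + q)%N = a *: dval G (p + q)%N by reflexivity.
rewrite homr_scaleE res_tinl_scale zcastZ.
have -> : rhoc (etrans erefl (addnA i p q)) (tp a 1) =
    rhoc erefl (tp (rhoc erefl (tp a 1)) 1) :> A (i + p + q)%N.
  by rewrite (rhoc_assoc erefl erefl erefl (etrans erefl (addnA i p q))) tp1 rmorph1.
by [].
Qed.
Definition hom_curry : {linear R N i -> L N i} := lin_of hom_curry_funD hom_curry_funZ.

Lemma hom_curry_inj : injective hom_curry.
Proof.
move=> G G' GG'; apply: dsum_ext => r; apply: lin_ext.
apply: nabla_eq => p q e x y; move: (e); case: _ / e => e.
rewrite (eq_irrelevance e erefl).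
have zz : hom_curry_val G x y = hom_curry_val G' x y.
  exact: (congr1 (fun H : L N i =>
    happ (dval (happ (dval H p) x : Res Q N (i + p)%N) q) y) GG').
(* Reversing the transport in [hom_curry_val] recovers the values of G and G' on generators. *)
have := congr1 (zcast (N := N) (esym (addnA i p q))) zz.
by rewrite /hom_curry_val !(zcast_trans _ _ (erefl (i + (p + q))%N)).
Qed.

Section Backward.
Variables (H : L N i) (r : nat).
Lemma assoc3 p q (e : (p + q)%N = r) : (i + p + q)%N = (i + r)%N.
Proof. by rewrite -addnA e. Qed.
Definition curried_val p q (x : P p) (y : Q q) : N (i + p + q)%N :=
  happ (dval (happ (dval H p) x : Res Q N (i + p)%N) q) y.
Definition hom_uncurry_val p q (e : (p + q)%N = r) (x : P p) (y : Q q) :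
    res (tinr (A i) (A r)) (delta A N (i, r)) :=
  zcast (assoc3 e) (curried_val x y).
Lemma hom_uncurry_valDl p q (e : (p + q)%N = r) y :
  {morph (hom_uncurry_val e)^~ y : x x' / x + x'}.
Proof.
move=> x x'; rewrite /hom_uncurry_val /curried_val happDr.
have -> : dval (happ (dval H p) x + happ (dval H p) x' : Res Q N (i + p)%N) q =
  dval (happ (dval H p) x : Res Q N (i + p)%N) q +
  dval (happ (dval H p) x' : Res Q N (i + p)%N) q
  by reflexivity.
by rewrite happD; exact: zcastD.
Qed.
Lemma hom_uncurry_valDr p q (e : (p + q)%N = r) x :
  {morph hom_uncurry_val e x : y y' / y + y'}.
Proof. by move=> y y'; rewrite /hom_uncurry_val /curried_val happDr; exact: zcastD. Qed.
Lemma curried_val_tp p q x y a b :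
  @curried_val p q (a *: x) (b *: y) =
  rhoc erefl (tp (rhoc erefl (tp 1 a)) b) *: curried_val x y.
Proof.
rewrite /curried_val !happZ.
have -> : dval (a *: happ (dval H p) x : Res Q N (i + p)%N) q =
  (rhoc erefl (tp 1 a) : A (i + p)%N) *: dval (happ (dval H p) x : Res Q N (i + p)%N) q
  by reflexivity.
rewrite homr_scaleE res_tinl_scale res_tinr_scale; exact: rhocr_rhocl.
Qed.
Lemma hom_uncurry_valZ p q (e : (p + q)%N = r) a b x y :
  hom_uncurry_val e (a *: x) (b *: y) = rhoc e (tp a b) *: hom_uncurry_val e x y.
Proof.
rewrite /hom_uncurry_val curried_val_tp zcastZ [RHS]res_tinr_scale.
exact: (congr1 (fun t : A (i + r)%N => t *: zcast (assoc3 e) (curried_val x y))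
  (rhoc_assoc erefl e _ erefl _ _ _)).
Qed.
Definition hom_uncurry : homr (PQ r) (delta A N (i, r)) :=
  nabla_lift (Z := res (tinr (A i) (A r)) (delta A N (i, r)))
    hom_uncurry_valDl hom_uncurry_valDr hom_uncurry_valZ.
Lemma hom_uncurryE p q (e : (p + q)%N = r) x y :
  happ hom_uncurry (nb e x y) = hom_uncurry_val e x y.
Proof. exact: nabla_liftE. Qed.
End Backward.

Lemma hom_curry_surj (H : L N i) : exists G, hom_curry G = H.
Proof.
have supp : exists s : seq nat, forall r, r \notin s -> hom_uncurry H r = 0.
  have [s s0] := gsupp PQ; exists s => r /s0 PQ0; apply: happ_eq => x.
  by rewrite (PQ0 x) !happ0r.
exists (DSum supp); apply: Res_Res_ext => p x q y; rewrite hom_curryE /hom_curry_val.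
by rewrite hom_uncurryE /hom_uncurry_val (zcast_trans _ _ erefl).
Qed.
End Forward.

Lemma Res_comp : natiso (Res P \of Res Q) (Res PQ).
Proof.
apply: natiso_sym.
apply: (@natiso_bij F _ _ A A (Res PQ) (Res P \of Res Q) hom_curry)
  => [N i|N N' f i G].
  apply: inj_surj_bij; [exact: hom_curry_inj|exact: hom_curry_surj].
apply: Res_Res_ext => p x q y.
exact: esym (zcast_mor f (addnA i p q) (happ (dval G (p + q)%N) (nb erefl x y))).
Qed.
End RestrictionComposition.

(** * Grothendieck groups *)

Section Isom.
Variable R : pzRingType.
Implicit Types M N L : lmodType R.

Lemma isom_refl M : isom M M.
Proof. by exists idfun; exists id. Qed.
Lemma isom_sym M N : isom M N -> isom N M.
Proof.
by move=> [f [g fK gK]]; exists (lin_inv fK gK); exists f.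
Qed.
Lemma isom_trans M N L : isom M N -> isom N L -> isom M L.
Proof.
move=> [f fb] [g gb]; exists (g \o f : {linear _ -> _}).
exact: (bij_comp gb fb).
Qed.
Lemma isom_projective M N : isom M N -> projective M -> projective N.
Proof. by move=> [f fb]; exact: projective_bij fb. Qed.
Lemma isom_fgen M N : isom M N -> fgen M -> fgen N.
Proof.
move=> [f [g fK gK]] [n [s hs]]; exists n, (f \o s) => y; have [c cE] := hs (g y).
exists c; rewrite -[LHS]gK cE linear_sum; apply: eq_bigr => i _.
by rewrite linearZ.
Qed.

Lemma ses_isom M' M M'' N' N N'' (f : {linear M' -> M}) (g : {linear M -> M''}) :
  isom M' N' -> isom M N -> isom M'' N'' -> ses f g ->
  exists (f' : {linear N' -> N}) (g' : {linear N -> N''}), ses f' g'.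
Proof.
move=> [a' [b' aK' bK']] [a [b aK bK]] [a'' [b'' aK'' bK'']] [fI fg gs].
exists (a \o f \o lin_inv aK' bK' : {linear _ -> _}).
exists (a'' \o g \o lin_inv aK bK : {linear _ -> _}); split=> [x y|x|z] /=.
- by move=> /(can_inj aK) /fI /(can_inj bK').
- rewrite /lin_of_fun; split=> [/eqP|[y ->]].
    rewrite -(linear0 a'') (can_eq aK'') => /eqP /fg[y yE].
    by exists (a' y); rewrite aK' -yE bK.
  rewrite aK; have -> : g (f (b' y)) = 0 by apply/fg; eexists.
  exact: linear0.
have [x xE] := gs (b'' z); exists (a x).
by rewrite /lin_of_fun aK xE bK''.
Qed.

(** An isomorphism is a short exact sequence with zero quotient; in this form the relations of the
    Grothendieck group apply to it. *)
Lemma isom_ses_l M M' N : isom M M' -> zero_module N ->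
  exists (f : {linear M -> M'}) (g : {linear M' -> N}), ses f g.
Proof.
move=> [f [f' fK f'K]] N0; exists f, (GRing.null_fun N : {linear M' -> N}).
split=> [|x|z]; first exact: can_inj fK.
  by split=> // _; exists (f' x); rewrite f'K.
by exists 0; rewrite (N0 z).
Qed.

Lemma prod_ses M' M'' :
  exists (f : {linear M' -> (M' * M'')%type})
    (g : {linear (M' * M'')%type -> M''}), ses f g.
Proof.
have fD : {morph (fun x : M' => (x, 0) : M' * M'') : x y / x + y}.
  by move=> x y; congr pair; rewrite addr0.
have fZ a (x : M') : ((a *: x, 0) : M' * M'') = a *: ((x, 0) : M' * M'').
  by congr pair; rewrite scaler0.
have gD : {morph (fun x : M' * M'' => x.2) : x y / x + y} by [].
have gZ a (x : M' * M'') : (a *: x).2 = a *: x.2 by [].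
exists (lin_of fD fZ), (lin_of gD gZ); split=> [x y []//|[x y]|z].
  rewrite /= /lin_of_fun /=; split=> [y0|[x' [_ ->]]//].
  by exists x; congr pair.
by exists (0, z).
Qed.

(** With a section s of g, the isomorphism from the product is (x, z) |-> f x + s z. *)
Lemma ses_split M' M M'' (f : {linear M' -> M}) (g : {linear M -> M''}) :
  projective M'' -> ses f g -> isom M (M' * M'')%type.
Proof.
move=> pM [fI fg gs]; have [s sK] := pM _ _ g idfun gs.
pose h (x : M' * M'') := f x.1 + s x.2.
have hD : {morph h : x y / x + y} by move=> x y; rewrite /h !linearD addrACA.
have hZ a x : h (a *: x) = a *: h x by rewrite /h !linearZ scalerDr.
have gf x : g (f x) = 0 by apply/fg; exists x.
apply: isom_sym; exists (lin_of hD hZ); apply: inj_surj_bij => [[x x'] [y y'] /= e|z].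
  have e' : x' = y'.
    by have := congr1 g e; rewrite /lin_of_fun /h !linearD !gf !sK !add0r.
  by move: e; rewrite /lin_of_fun /h e' /= => /addIr /fI ->.
have /fg[x xE] : g (z - s (g z)) = 0 by rewrite linearB sK subrr.
by exists (x, g z); rewrite /= /lin_of_fun /h /= -xE subrK.
Qed.
End Isom.

Section MatrixModules.
Variables (F : fieldType) (B : fdalg F).

Lemma fgen_mxmod (X : mxrep B) : fgen (mxmod X).
Proof.
apply: fd_fgen; exists (mxdim X), (fun i => delta_mx i 0 : 'cV[F]__) => v.
exists (fun i => (v : 'cV_(mxdim X)) i 0).
transitivity (\sum_i (v : 'cV_(mxdim X)) i 0 *: (delta_mx i 0 : 'cV[F]_(mxdim X))).
  by rewrite {1}[v : 'cV_(mxdim X)]matrix_sum_delta; apply: eq_bigr => i _;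
    rewrite big_ord1.
apply: eq_bigr => i _; rewrite res_scaleE -[RHS]/(X (scal B _) *m _) mxact_scal.
by rewrite mul_scalar_mx.
Qed.

(** The representation consists of the matrices by which B acts in an F-basis of M. *)
Lemma fgen_mxrep (M : lmodType B) : fgen M -> exists X : mxrep B, isom M (mxmod X).
Proof.
move=> /fgen_fd/fgen_fbasis[d [e be]].
pose c (v : M) i : F := fcoord be v i.
have cD i v w : c (v + w) i = c v i + c w i by exact: (fcoordD be i v w).
have cZ i k v : c (scal B k *: v) i = k * c v i by exact: (fcoordZ be i k v).
have c0 i : c 0 i = 0 by apply: (addIr (c 0 i)); rewrite -cD !add0r.
have cE v : v = \sum_i scal B (c v i) *: (e i : M) by exact: (fcoordE be).
have cU v w : (forall i, c v i = c w i) -> v = w.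
  by move=> vw; rewrite [v]cE [w]cE; apply: eq_bigr => i _; rewrite vw.
have ce i j : c (e j) i = (i == j)%:R.
  have : fcoord be (e j) = [ffun i => (i == j)%:R].
    apply: fcoord_uniq; rewrite (bigD1 j) //= big1 ?addr0 ?ffunE ?eqxx ?scale1r //.
    by move=> k kj; rewrite ffunE (negPf kj) scale0r.
  by move=> /(congr1 (fun h : {ffun _ -> _} => h i)); rewrite ffunE.
have cA b v i : c (b *: v) i = \sum_j c (b *: (e j : M)) i * c v j.
  rewrite {1}[v]cE scaler_sumr
    (big_morph (fun v => c v i) (fun v w => cD i v w) (c0 i)).
  by apply: eq_bigr => j _; rewrite -scal_scale cZ mulrC.
pose X (b : B) : 'M[F]_d := \matrix_(i, j) c (b *: (e j : M)) i.
have XD : zmod_morphism X.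
  move=> a b; apply/matrixP => i j; rewrite !mxE; apply: (addIr (c (b *: (e j : M)) i)).
  by rewrite subrK -cD -scalerDl subrK.
have XM : monoid_morphism X.
  split=> [|a b]; apply/matrixP => i j; rewrite !mxE; first by rewrite scale1r ce.
  by rewrite -scalerA cA; apply: eq_bigr => k _; rewrite !mxE.
pose HX : {rmorphism B -> 'M[F]_d} := HB.pack X
  (GRing.isZmodMorphism.Build B 'M[F]_d X XD)
  (GRing.isMonoidMorphism.Build B 'M[F]_d X XM).
have Xs k : HX (scal B k) = k%:M.
  by apply/matrixP => i j; rewrite !mxE cZ ce; case: eqP; rewrite ?mulr1 ?mulr0.
exists (MxRep Xs).
pose f (v : M) : mxmod (MxRep Xs) := \col_i c v i.
have fD : {morph f : x y / x + y} by move=> x y; apply/colP => i; rewrite !mxE cD.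
have fZ b v : f (b *: v) = b *: f v.
  by apply/colP => i; rewrite !mxE cA; apply: eq_bigr => j _; rewrite !mxE.
exists (lin_of fD fZ); apply: inj_surj_bij => [v w /= /colP vw|u].
  by apply: cU => i; have := vw i; rewrite !mxE.
exists (\sum_i scal B ((u : 'cV_d) i 0) *: (e i : M)); apply/colP => i; rewrite mxE.
rewrite (big_morph (fun v => c v i) (fun v w => cD i v w) (c0 i)) (bigD1 i) //=.
rewrite cZ ce eqxx mulr1 big1 ?addr0 // => j ji.
by rewrite cZ ce eq_sym (negPf ji) mulr0.
Qed.

Lemma zero_mxrep_ex : exists X : mxrep B, zero_module (mxmod X).
Proof.
have [X [f fb]] : exists X : mxrep B, isom ({ffun 'I_0 -> B^o} : lmodType B) (mxmod X).
  apply: fgen_mxrep; exists 0%N, (fun _ => 0) => m; exists (fun _ => 0).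
  by apply/ffunP => -[].
exists X => x; case: fb => g _ gK; rewrite -[x]gK -[RHS](linear0 f).
by congr (f _); apply/ffunP => -[].
Qed.
End MatrixModules.

Section GrothendieckClasses.
Variables (F : fieldType) (B : fdalg F) (k : gkind).
Implicit Types M N : lmodType B.

Lemma admissible_isom M N : isom M N -> admissible k M -> admissible k N.
Proof. by rewrite /admissible; case: k => // h; exact: isom_projective. Qed.

(** With [ses_extension], this replaces the two kinds of relations by one: short exact sequences of
    admissible modules. For [Split] the converse holds because a projective quotient splits off. *)
Lemma extension_ses M' M M'' : extension k M' M M'' ->
  exists (f : {linear M' -> M}) (g : {linear M -> M''}), ses f g.
Proof.
rewrite /extension; case: k => // h.
have [f [g fg]] := prod_ses M' M''.
exact: ses_isom (isom_refl _) (isom_sym h) (isom_refl _) fg.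
Qed.

Lemma ses_extension M' M M'' (f : {linear M' -> M}) (g : {linear M -> M''}) :
  admissible k M'' -> ses f g -> extension k M' M M''.
Proof.
rewrite /admissible /extension; case: k => [_ fg|]; first by exists f, g.
exact: ses_split.
Qed.

Lemma ggen_ex M : fgen M -> admissible k M -> exists X : ggen B k, isom M (gmodule X).
Proof.
move=> /fgen_mxrep[X iX] aM.
by exists (exist _ X (admissible_isom iX aM) : {X | admissible k (mxmod X)}).
Qed.
Lemma ggen_admissible (X : ggen B k) : admissible k (gmodule X).
Proof. exact: (proj2_sig (X : {X | admissible k (mxmod X)})). Qed.

Lemma pgen_ses (X' X X'' : ggen B k) (f : {linear gmodule X' -> gmodule X})
    (g : {linear gmodule X -> gmodule X''}) : ses f g ->
  pgen (@grel F B k) X = pgen (@grel F B k) X' + pgen (@grel F B k) X''.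
Proof.
move=> /(ses_extension (ggen_admissible X''))/Grel/(@pgen_kills _ (@grel F B k)).
rewrite /wval !big_cons big_nil /= addr0 -opprD => /eqP.
by rewrite subr_eq0 => /eqP.
Qed.

Lemma zero_ggen_ex : exists Z : ggen B k, zero_module (gmodule Z).
Proof.
have [X X0] := zero_mxrep_ex B.
have aX : admissible k (mxmod X).
  by rewrite /admissible; case: k => //; exact: projective_zero.
by exists (exist _ X aX : {X | admissible k (mxmod X)}).
Qed.

(** The relation for 0 -> X -> Y -> Z -> 0 with Z = 0, together with [Z] = [Z] + [Z], which makes
    the class of Z vanish. *)
Lemma pgen_isom (X Y : ggen B k) : isom (gmodule X) (gmodule Y) ->
  pgen (@grel F B k) X = pgen (@grel F B k) Y.
Proof.
have [Z Z0] := zero_ggen_ex; move=> h.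
have [f [g fg]] := isom_ses_l h Z0; rewrite (pgen_ses fg).
have [f' [g' fg']] := isom_ses_l (isom_refl (gmodule Z)) Z0.
have /eqP := pgen_ses fg'; rewrite -subr_eq0 opprD addrA subrr sub0r oppr_eq0.
by move=> /eqP ->; rewrite addr0.
Qed.

Lemma clsE M (X : ggen B k) : isom M (gmodule X) -> cls k M = pgen (@grel F B k) X.
Proof.
move=> h; rewrite /cls; case: pselect => [h'|[]]; last by exists X.
case: (cid h') => Y /= hY; apply: pgen_isom; exact: isom_trans (isom_sym hY) h.
Qed.

Lemma cls_ses M' M M'' (f : {linear M' -> M}) (g : {linear M -> M''}) :
  fgen M' -> fgen M -> fgen M'' ->
  admissible k M' -> admissible k M -> admissible k M'' -> ses f g ->
  cls k M = cls k M' + cls k M''.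
Proof.
move=> f1 f2 f3 a1 a2 a3 fg.
have [X' h'] := ggen_ex f1 a1; have [X h] := ggen_ex f2 a2.
have [X'' h''] := ggen_ex f3 a3.
have [f' [g' fg']] := ses_isom h' h h'' fg.
by rewrite (clsE h') (clsE h) (clsE h''); exact: pgen_ses fg'.
Qed.

(** The condition under which [glift phi] is additive and takes the value phi M on the class of M.
    It ranges over all admissible modules, not only the matrix representatives, so that phi is also
    invariant under isomorphism. *)
Definition additive_on_ses (Z : zmodType) (phi : lmodType B -> Z) : Prop :=
  forall M' M M'' (f : {linear M' -> M}) (g : {linear M -> M''}),
  fgen M' -> fgen M -> fgen M'' ->
  admissible k M' -> admissible k M -> admissible k M'' -> ses f g ->
  phi M = phi M' + phi M''.

Lemma cls_additive : additive_on_ses (cls k).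
Proof. exact: cls_ses. Qed.

Section Lift.
Variables (Z : zmodType) (phi : lmodType B -> Z).
Hypothesis phiA : additive_on_ses phi.

Lemma additive_zero M : zero_module M -> phi M = 0.
Proof.
move=> M0; have [f [g fg]] := isom_ses_l (isom_refl M) M0.
have fM : fgen M by exists 0%N, (fun _ => 0) => m; exists (fun _ => 0);
    rewrite (M0 m) big_ord0.
have aM : admissible k M.
  by rewrite /admissible; case: k => //; exact: projective_zero.
have /eqP := phiA fM fM fM aM aM aM fg.
by rewrite -subr_eq0 opprD addrA subrr sub0r oppr_eq0 => /eqP.
Qed.

Lemma additive_isom M N : fgen M -> admissible k M -> isom M N -> phi M = phi N.
Proof.
move=> fM aM h; have [Z0 Z0P] := zero_ggen_ex.
have [f [g fg]] := isom_ses_l h Z0P.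
have fN := isom_fgen h fM; have aN := admissible_isom h aM.
rewrite (phiA fM fN (fgen_mxmod _) aM aN (ggen_admissible Z0) fg).
by rewrite (additive_zero Z0P) addr0.
Qed.

Lemma additive_kills : kills (@grel F B k) (fun X => phi (gmodule X)).
Proof.
move=> w [X' X X'' /extension_ses[f [g fg]]].
rewrite /wval !big_cons big_nil /= addr0 (phiA _ _ _ _ _ _ fg); first last.
- exact: ggen_admissible.
- exact: ggen_admissible.
- exact: ggen_admissible.
- exact: fgen_mxmod.
- exact: fgen_mxmod.
- exact: fgen_mxmod.
by rewrite -opprD subrr.
Qed.

Lemma gliftD : {morph glift (k := k) phi : x y / x + y}.
Proof. exact: (pliftD additive_kills). Qed.
Lemma glift_cls M : fgen M -> admissible k M -> glift phi (cls k M) = phi M.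
Proof.
move=> fM aM; have [X h] := ggen_ex fM aM.
rewrite (clsE h) /glift (plift_gen additive_kills); apply: esym.
exact: additive_isom.
Qed.
End Lift.

Lemma cls_isom M N : fgen M -> admissible k M -> isom M N -> cls k M = cls k N.
Proof. by move=> f a; exact: (additive_isom cls_additive f a). Qed.

Lemma Groth_ind (T : Groth B k -> Prop) :
  (forall x y, T x -> T y -> T (x + y)) -> (forall x, T x -> T (- x)) ->
  (forall M, fgen M -> admissible k M -> T (cls k M)) -> forall x, T x.
Proof.
move=> TD TN Tc; have T0 : T 0.
  have [Z Z0] := zero_ggen_ex.
  by rewrite -(additive_zero cls_additive Z0); apply: Tc;
    [exact: fgen_mxmod|exact: ggen_admissible].
apply: pres_ind => // X; rewrite -(clsE (isom_refl (gmodule X))).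
by apply: Tc; [exact: fgen_mxmod|exact: ggen_admissible].
Qed.
End GrothendieckClasses.

(** * Additive functions on direct sums of finite support *)

Section AdditiveSums.
Variables (F : fieldType) (B : fdalg F) (k : gkind) (Z : zmodType).
Variable phi : lmodType B -> Z.
Hypothesis phiA : additive_on_ses k phi.

Section Truncation.
Variables (I : choiceType) (M : I -> lmodType B).
Hypotheses (fM : forall i, fgen (M i)) (aM : forall i, admissible k (M i)).

(** Partial sums, from which [phi_trunc] splits off one summand at a time. *)
Definition trunc (p : pred I) : lmodType B := dsumm (fun i : {i | p i} => M (val i)).

Lemma trunc_fgen (s : seq I) p : (forall i, i \notin s -> zero_module (M i)) ->
  fgen (trunc p).
Proof.
move=> s0; apply: dsumm_fgen => [|i]; last exact: fM.
exists (pmap insub s) => i; rewrite mem_pmap_sub => /s0; exact.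
Qed.
Lemma trunc_admissible p : admissible k (trunc p).
Proof.
rewrite /admissible; case: k aM => // pM.
by apply: projective_dsumm => i; exact: pM.
Qed.

Lemma trunc_ses (p : pred I) a : p a ->
  exists (f : {linear M a -> trunc p})
    (g : {linear trunc p -> trunc (fun i => p i && (i != a))}), ses f g.
Proof.
move=> pa; pose q i := p i && (i != a).
pose lift (i : {i | q i}) : {i | p i} := exist _ (val i) (proj1 (andP (valP i))).
have supp (x : trunc p) : exists s : seq {i | q i}, forall i, i \notin s ->
    dval x (lift i) = 0.
  have [s s0] := dsupp x; exists (pmap insub (map val s)) => i.
  rewrite mem_pmap_sub => si; apply: s0; apply: contra si => si.
  by apply/mapP; exists (lift i).
pose g (x : trunc p) : trunc q :=
  DSum (dval := fun i => dval x (lift i) : M (val i)) (supp x).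
have gD : {morph g : x y / x + y} by move=> x y; apply: dsum_ext.
have gZ c x : g (c *: x) = c *: g x by apply: dsum_ext.
pose a' : {i | p i} := exist _ a pa.
pose f : {linear M a -> trunc p} := dinj_map (fun i : {i | p i} => M (val i)) a'.
have la i : a' != lift i.
  apply/eqP => /(congr1 val) /= ai; have /andP[_] := valP i.
  by rewrite /= -ai eqxx.
have fE (m : M a) : dval (f m) a' = m by 
  exact: (@dinj_same _ (fun i : {i | p i} => M (val i)) a' m).
exists f, (lin_of gD gZ); split=> [x y xy|x|z].
- by rewrite -[x]fE -[y]fE xy.
- split=> [gx|[y ->]]; last first.
    by apply: dsum_ext => i; exact:
      (@dinj_other _ (fun i : {i | p i} => M (val i)) a' (lift i)).
  exists (dval x a'); apply: dsum_ext => i; have [<-|ia] := eqVneq a' i.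
    exact: esym (fE _).
  apply: etrans (esym (@dinj_other _ (fun i : {i | p i} => M (val i)) a' i
    (dval x a') ia)).
  have qi : q (val i).
    rewrite /q (valP i) /=; apply: contra ia => /eqP ai; apply/eqP.
    by apply: val_inj; rewrite /= ai.
  have -> : i = lift (exist _ (val i) qi) by apply: val_inj.
  exact: (congr1 (fun y : trunc q => dval y (exist _ (val i) qi)) gx).
(* A preimage of z is its extension by 0 at a. Quantifying over all j and e makes the chosen value
   independent of how i arises as [lift j]. *)
have ex (i : {i | p i}) : exists m : M (val i),
    forall (j : {i | q i}) (e : lift j = i),
    m = ecast i (M (val i)) e (dval z j : M (val (lift j))).
  have [qi|qi] := boolP (q (val i)); last first.
    by exists 0 => j e; case/negP: qi; rewrite -e; exact: (valP j).
  pose j : {i | q i} := exist _ (val i) qi.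
  have e : lift j = i by apply: val_inj.
  exists (ecast i (M (val i)) e (dval z j : M (val (lift j)))) => j' e'.
  have jj : j = j' by apply: val_inj; rewrite -[LHS]/(val (lift j)) e -e'.
  by case: _ / jj e' => e'; rewrite (eq_irrelevance e e').
pose x i := projT1 (cid (ex i)).
have xE j : x (lift j) = dval z j by exact: (projT2 (cid (ex (lift j))) j erefl).
have xs : exists s : seq {i | p i}, forall i, i \notin s -> x i = 0.
  have [s s0] := dsupp z; exists (a' :: map lift s) => i; rewrite inE negb_or.
  move=> /andP[ia is_]; have qi : q (val i).
    rewrite /q (valP i) /=; apply: contra ia => /eqP ai; apply/eqP.
    by apply: val_inj; rewrite /= ai.
  have e : i = lift (exist _ (val i) qi) by apply: val_inj.
  rewrite e xE; apply: s0; apply: contra is_ => js; rewrite e.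
  by apply/mapP; exists (exist _ (val i) qi).
exists (DSum xs); apply: dsum_ext => j; exact: xE.
Qed.

(** Induction on u with p varying: if the head a satisfies p, [trunc_ses] splits off M_a and removes
    a from p; otherwise a contributes nothing. *)
Lemma phi_trunc (s u : seq I) (p : pred I) : uniq u ->
  (forall i, i \notin s -> zero_module (M i)) ->
  (forall i, p i -> i \notin u -> zero_module (M i)) ->
  phi (trunc p) = \sum_(i <- u | p i) phi (M i).
Proof.
move=> + s0; elim: u p => [|a u IH] p /=.
  move=> _ p0; rewrite big_nil; apply: (additive_zero phiA) => x.
  by apply: dsum_ext => i; exact: p0 (valP i) _ _.
move=> /andP[au uu] p0; rewrite big_cons; case: ifP => pa.
  have [f [g fg]] := trunc_ses pa.
  rewrite (phiA _ _ _ _ _ _ fg) //; try exact: trunc_fgen s0;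
    try exact: trunc_admissible.
  congr (_ + _); rewrite IH // => [|i /andP[pi ia] iu]; last first.
    by apply: p0 => //; rewrite inE negb_or ia.
  rewrite [LHS]big_seq_cond [RHS]big_seq_cond; apply: eq_bigl => i.
  have [iu|//] := boolP (i \in u); rewrite /= andbC.
  by have [ia|//] := eqVneq i a; rewrite ia (negPf au) in iu.
apply: IH => // i pi iu; apply: p0 => //; rewrite inE negb_or iu andbT.
by apply: contraFneq pa => <-.
Qed.

Lemma phi_dsumm (s : seq I) : uniq s ->
  (forall i, i \notin s -> zero_module (M i)) ->
  phi (dsumm M) = \sum_(i <- s) phi (M i).
Proof.
move=> us s0; rewrite -(@phi_trunc s s predT) // => [|i _]; last exact: s0.
have bs (x : dsumm M) : exists s : seq {i | predT i}, forall i, i \notin s ->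
    dval x (val i) = 0.
  have [t t0] := dsupp x; exists (pmap insub t) => i.
  by rewrite mem_pmap_sub => /t0.
have cs (x : trunc predT) : exists s : seq I, forall i, i \notin s ->
    dval x (exist _ i isT) = 0.
  have [t t0] := dsupp x; exists (map val t) => i it; apply: t0.
  by apply: contra it => it; apply/mapP; exists (exist _ i isT).
pose b (x : dsumm M) : trunc predT :=
  DSum (dval := fun i : {i | predT i} => dval x (val i)) (bs x).
have bD : {morph b : x y / x + y} by move=> x y; apply: dsum_ext.
have bZ c x : b (c *: x) = c *: b x by apply: dsum_ext.
have fD : fgen (dsumm M) by apply: dsumm_fgen => //; exists s.
have aD : admissible k (dsumm M).
  rewrite /admissible; case: k aM => // pM.
  by apply: projective_dsumm => i; exact: pM.
apply: (additive_isom phiA fD aD); exists (lin_of bD bZ).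
exists (fun x => DSum (cs x)) => x; first by apply: dsum_ext.
by apply: dsum_ext => -[i pi]; rewrite /= (bool_irrelevance pi isT).
Qed.
End Truncation.
End AdditiveSums.

(** * Classes of graded modules and their products *)

Section GradedClasses.
Variables (F : fieldType) (A : tower F) (k : gkind).

Definition gadmissible (X : gmod A) : Prop := forall n, admissible k (X n).

Lemma fgen_xtens (B C : fdalg F) (M : lmodType B) (N : lmodType C) :
  fgen M -> fgen N -> fgen (xtens M N : lmodType (talg B C)).
Proof. by move=> fM fN; apply: fd_fgen; apply: xtens_fd; apply: fgen_fd. Qed.

Lemma admissible_xtens (B C : fdalg F) (M : lmodType B) (N : lmodType C) :
  admissible k M -> admissible k N -> admissible k (xtens M N : lmodType (talg B C)).
Proof. by rewrite /admissible; case: k => //; exact: projective_xtens. Qed.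

Lemma admissible_ind (R S : fdalg F) (f : {rmorphism R -> S}) (M : lmodType R) :
  admissible k M -> admissible k (ind f M).
Proof. by rewrite /admissible; case: k => //; exact: projective_ind. Qed.

Definition mul_cls m n (M : lmodType (A m)) (N : lmodType (A n)) : GK A k :=
  dinj (cls k (ind (rho A m n) (xtens M N : lmodType (talg (A m) (A n))))).

Lemma mul_clsE m n j (M : lmodType (A m)) (N : lmodType (A n)) (e : (m + n)%N = j) :
  dval (mul_cls M N) j = cls k (ind (rhoc e) (xtens M N : lmodType (talg (A m) (A n)))).
Proof. by case: _ / e; rewrite [LHS]dinj_same. Qed.

Lemma mul_cls_additive_r m n (M : lmodType (A m)) : fgen M -> admissible k M ->
  additive_on_ses k (@mul_cls m n M).
Proof.
move=> fM aM N' N N'' f g f1 f2 f3 a1 a2 a3 fg.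
rewrite /mul_cls -dinjD; congr (dinj _).
have h := ind_ses (@rho_projr F A m n) (xtens_ses fM fg).
by apply: (cls_ses _ _ _ _ _ _ h);
  try (by apply: ind_fgen; exact: fgen_xtens);
  by apply: admissible_ind; exact: admissible_xtens.
Qed.
Lemma mul_cls_additive_l m n (N : lmodType (A n)) : fgen N -> admissible k N ->
  additive_on_ses k (fun M => @mul_cls m n M N).
Proof.
move=> fN aN M' M M'' f g f1 f2 f3 a1 a2 a3 fg.
rewrite /mul_cls -dinjD; congr (dinj _).
have h := ind_ses (@rho_projr F A m n) (xtens_ses_l fN fg).
by apply: (cls_ses _ _ _ _ _ _ h);
  try (by apply: ind_fgen; exact: fgen_xtens);
  by apply: admissible_ind; exact: admissible_xtens.
Qed.

Lemma glift_mul_cls m n (M : lmodType (A m)) (N : lmodType (A n)) :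
  fgen M -> fgen N -> admissible k M -> admissible k N ->
  glift (fun M => glift (fun N => mul_cls M N) (cls k N)) (cls k M) = mul_cls M N.
Proof.
move=> fM fN aM aN; rewrite glift_cls //;
  first by rewrite (glift_cls (mul_cls_additive_r fM aM)).
move=> M' M0 M'' f g f1 f2 f3 a1 a2 a3 fg.
rewrite !(glift_cls (mul_cls_additive_r _ _)) //.
exact: (mul_cls_additive_l fN aN f1 f2 f3 a1 a2 a3 fg).
Qed.

Lemma glift0 (B : fdalg F) (Z : zmodType) (phi : lmodType B -> Z) :
  additive_on_ses k phi -> glift phi (0 : Groth B k) = 0.
Proof. by move=> pA; apply: (addIr (glift phi (0 : Groth B k)));
  rewrite -(gliftD pA) !add0r. Qed.

Lemma gsupp_uniq (I : choiceType) (B : I -> fdalg F) (X : gmod B) :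
  exists2 s : seq I, uniq s & forall n, n \notin s -> zero_module (X n).
Proof.
have [s s0] := gsupp X; exists (undup s); first exact: undup_uniq.
by move=> n; rewrite mem_undup; exact: s0.
Qed.

Section Product.
Variables X Y : gmod A.
Hypotheses (aX : gadmissible X) (aY : gadmissible Y).

Lemma gmul_gclsE (s u : seq nat) : uniq s -> uniq u ->
  (forall n, n \notin s -> zero_module (X n)) ->
  (forall n, n \notin u -> zero_module (Y n)) ->
  gmul (gcls k X) (gcls k Y) = \sum_(m <- s) \sum_(n <- u) mul_cls (X m) (Y n).
Proof.
move=> us uu s0 u0.
pose h m (a : Groth (A m) k) n (b : Groth (A n) k) : GK A k :=
  glift (fun M => glift (fun N => mul_cls M N) b) a.
have hE m n : h m (cls k (X m)) n (cls k (Y n)) = mul_cls (X m) (Y n).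
  by apply: glift_mul_cls => //; exact: fgP.
have rE m : dlift (h m (cls k (X m))) (gcls k Y) =
    \sum_(n <- u) mul_cls (X m) (Y n).
  rewrite (dlift_supp uu) => [|n /u0 Y0].
    by apply: eq_bigr => n _; exact: hE.
  rewrite hE; apply: additive_zero Y0.
  by apply: mul_cls_additive_r => //; exact: fgP.
rewrite -[LHS]/(dlift (fun m a => dlift (h m a) (gcls k Y)) (gcls k X)).
rewrite (dlift_supp us) => [|m /s0 X0]; first by apply: eq_bigr => m _; exact: rE.
rewrite rE big1 // => n _.
apply: (additive_zero (k := k) (phi := fun M => mul_cls M (Y n))) X0.
by apply: mul_cls_additive_l => //; exact: fgP.
Qed.

(** In degree j, nabla is a direct sum over the pairs (m, n) with m + n = j, almost all of them
    zero, and classes are additive on such sums. *)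
Lemma gmul_gcls : gmul (gcls k X) (gcls k Y) = gcls k (nabla A (gtens X Y)).
Proof.
have [s us s0] := gsupp_uniq X; have [u uu u0] := gsupp_uniq Y.
rewrite (gmul_gclsE us uu s0 u0); apply: dsum_ext => j.
pose XY (p : nat * nat) : lmodType (A2 A p) := gtens X Y p.
pose N (q : {p | addp p == j}) : lmodType (A j) :=
  ind (fibre_hom (rhop A) q) (XY (val q)).
pose r := [seq (m, n) | m <- s, n <- u].
have ur : uniq r by apply: allpairs_uniq => // -[a b] [c d] _ _ [-> ->].
have r0 p : p \notin r -> zero_module (XY p).
  case: p => m n mn; apply: tens_zero.
  have [ms|/s0] := boolP (m \in s); last by left.
  have [nu|/u0] := boolP (n \in u); last by right.
  by case/negP: mn; apply: allpairs_f.
have aN q : admissible k (N q).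
  by apply: admissible_ind; apply: admissible_xtens; [exact: aX|exact: aY].
have fN q : fgen (N q).
  by apply: ind_fgen; exact: fgP.
rewrite -[RHS]/(cls k (dsumm N)).
rewrite (phi_dsumm (@cls_additive F (A j) k) fN aN (s := pmap insub r)); first last.
- move=> q; rewrite mem_pmap_sub => /r0 X0 x.
  by apply: tens_zero; right.
- exact: pmap_sub_uniq.
rewrite big_pmap dsum_sumE.
rewrite big_allpairs; apply: eq_bigr => m _.
rewrite -[LHS]/(dval (\sum_(n <- u) mul_cls (X m) (Y n)) j) dsum_sumE.
apply: eq_bigr => n _.
case: insubP => [q /= e qE|e].
  have {}e : (m + n)%N = j := eqP e.
  have -> : q = fidx (i := (m, n)) e by apply: val_inj; exact: qE.
  by apply: etrans (mul_clsE _ _ e) _; rewrite /N fibre_homE.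
by rewrite dinj_other.
Qed.
End Product.
End GradedClasses.

(** * Hom spaces and the pairing of K_0 with G_0 *)

Section HomDimension.
Variables (F : fieldType) (B : fdalg F).

(** Evaluation at generators of P embeds the Hom space into a finite power of M. *)
Lemma fgen_homF (P M : lmodType B) : fgen P -> fgen M -> fgen (homF P M).
Proof.
move=> [n [s hs]] /fgen_fd fM.
have supp (f : homF P M) :
    exists t : seq 'I_n, forall i, i \notin t -> (happ f (s i) : resF M) = 0.
  by exists (enum 'I_n) => i; rewrite mem_enum.
pose ev (f : homF P M) : dsumm (fun _ : 'I_n => resF M) := DSum (supp f).
have evD : {morph ev : f g / f + g} by move=> f g; apply: dsum_ext.
have evZ a f : ev (a *: f) = a *: ev f by apply: dsum_ext.
apply: (@fgen_inj _ _ _ (lin_of evD evZ)).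
  move=> f g fg; apply: happ_eq => x; have [c ->] := hs x.
  rewrite !(big_morph _ (happDr _) (happ0r _)); apply: eq_bigr => i _.
  by rewrite !happZ; congr (_ *: _); exact: (congr1 (fun h : dsumm _ => dval h i) fg).
apply: dsumm_fgen => // ; exists (enum 'I_n) => i; by rewrite mem_enum.
Qed.

Section Post.
Variables (P M N : lmodType B) (h : {linear M -> N}).
Definition postc_fun (f : homF P M) : homF P N :=
  h \o (f : {linear _ -> _}) : {linear _ -> _}.
Lemma postc_funD : {morph postc_fun : f g / f + g}.
Proof. by move=> f g; apply: happ_eq => x; exact: (linearD h). Qed.
Lemma postc_funZ a (f : homF P M) : postc_fun (a *: f) = a *: postc_fun f.
Proof. by apply: happ_eq => x; exact: (linearZ_LR h). Qed.
Definition postc : {linear homF P M -> homF P N} := lin_of postc_funD postc_funZ.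
End Post.

Section Pre.
Variables (P Q M : lmodType B) (h : {linear P -> Q}).
Definition prec_fun (f : homF Q M) : homF P M :=
  (f : {linear _ -> _}) \o h : {linear _ -> _}.
Lemma prec_funD : {morph prec_fun : f g / f + g}.
Proof. by move=> f g; apply: happ_eq. Qed.
Lemma prec_funZ a (f : homF Q M) : prec_fun (a *: f) = a *: prec_fun f.
Proof. by apply: happ_eq. Qed.
Definition prec : {linear homF Q M -> homF P M} := lin_of prec_funD prec_funZ.
End Pre.

Lemma postc_ses (P M' M M'' : lmodType B) (f : {linear M' -> M})
    (g : {linear M -> M''}) : projective P -> ses f g -> ses (postc P f) (postc P g).
Proof.
move=> pP fg; have [fI fk gs] := fg; split=> [x y xy|h|h].
- by apply: happ_eq => p; apply: fI; exact: (congr1 (fun f => happ f p) xy).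
- split=> [gh|[h' ->]]; last by apply: happ_eq => p; apply/fk; exists (happ h' p).
  have [p|k kE] := ses_factor (h := h) fg; last by exists k; exact: happ_eq.
  exact: (congr1 (fun f => happ f p) gh).
by have [k kE] := pP _ _ g h gs; exists k; exact: happ_eq.
Qed.

(** A section s of g yields a retraction r of f, with f r = id - s g. Maps on P' extend to P by
    composing with r, and a map h killed by f equals (h s) g. *)
Lemma prec_ses (P' P P'' M : lmodType B) (f : {linear P' -> P})
    (g : {linear P -> P''}) : projective P'' -> ses f g -> ses (prec M g) (prec M f).
Proof.
move=> pP fg; have [fI fk gs] := fg.
have [s sK] := pP _ _ g idfun gs.
have gf y : g (f y) = 0 by apply/fk; exists y.
pose d x := x - s (g x).
have dD : {morph d : x y / x + y}.
  by move=> x y; rewrite /d !linearD addrACA.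
have dZ a x : d (a *: x) = a *: d x.
  by rewrite /d (linearZ_LR g) (linearZ_LR s) scalerBr.
have [p|r rE] := ses_factor (h := lin_of dD dZ) fg.
  by rewrite /= /lin_of_fun /d linearB sK subrr.
have rf y : r (f y) = y by apply: fI; rewrite -rE /= /lin_of_fun /d gf linear0 subr0.
split=> [x y xy|h|h].
- apply: happ_eq => z; have [p <-] := gs z.
  exact: (congr1 (fun f => happ f p) xy).
- split=> [hf|[k ->]]; last first.
    by apply: happ_eq => p; rewrite -[LHS]/(happ k (g (f p))) gf happ0r.
  exists ((h : {linear _ -> _}) \o s : {linear _ -> _}); apply: happ_eq => p.
  rewrite -[RHS]/(happ h (s (g p))).
  have -> : p = f (r p) + s (g p) by rewrite -rE /= /lin_of_fun /d subrK.
  rewrite linearD gf add0r happDr.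
  rewrite -[X in X + _]/(happ (prec M f h) (r p)) hf.
  by rewrite sK -[X in X + _]/(0 : M) add0r.
exists ((h : {linear _ -> _}) \o r : {linear _ -> _}); apply: happ_eq => p.
by rewrite -[LHS]/(happ h (r (f p))) rf.
Qed.

Definition hdim (P M : lmodType B) : int := (dimv (homF P M))%:Z.

Lemma hdim_additive_r (P : lmodType B) : fgen P -> projective P ->
  additive_on_ses Abelian (hdim P).
Proof.
move=> fP pP M' M M'' f g f1 _ f3 _ _ _ /(postc_ses pP) fg.
by rewrite /hdim (dimv_ses _ _ fg) ?PoszD //; exact: fgen_homF.
Qed.

Lemma hdim_additive_l (M : lmodType B) : fgen M ->
  additive_on_ses Split (hdim^~ M).
Proof.
move=> fM P' P P'' f g f1 _ f3 _ _ pP /(prec_ses M pP) fg.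
rewrite /hdim (dimv_ses _ _ fg) ?PoszD 1?addrC //; exact: fgen_homF.
Qed.

Lemma G0_K0_pairing_cls (P M : lmodType B) : fgen P -> projective P -> fgen M ->
  G0_K0_pairing (cls Split P) (cls Abelian M) = hdim P M.
Proof.
move=> fP pP fM; rewrite /G0_K0_pairing glift_cls //.
  exact: (glift_cls (hdim_additive_r fP pP)).
move=> P' P0 P'' f g f1 f2 f3 a1 a2 a3 fg.
rewrite -!/(hdim _) !(glift_cls (hdim_additive_r _ _)) //.
exact: (hdim_additive_l fM f1 f2 f3 a1 a2 a3 fg).
Qed.
End HomDimension.

(** * The graded pairing and restriction in degree 0 *)

Section TowerPairing.
Variables (F : fieldType) (A : tower F).
Local Notation G := (GK A Abelian).
Local Notation K := (GK A Split).

(** The unit e of the tower is only some element of A_0. As A_0 is the field, e is a scalar, and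
    this scalar turns out to be 1. *)
Lemma rho0l n (a : A n) : rho A 0 n (tp 1 a) = a.
Proof.
have [e eP] := rho_unit A; have [g gK Kg] := tower_deg0 A.
have rE m (b : A m) : b = scal (A m) (g e) * rho A 0 m (tp 1 b).
  have [eb _] := eP m b; rewrite -[LHS]eb -(ahom_scal (rho A 0 m)) -rmorphM.
  have -> // : scal (talg (A 0) (A m)) (g e) * tp 1 b = tp e b.
  by rewrite -[LHS]/(tp (scal (A 0) (g e)) 1 * tp 1 b) tpM mulr1 mul1r Kg.
(* In degree 0, [rE] at the element 1 says that 1 is the scalar [g e], since [rho] preserves
   units. *)
have e1 : g e = 1.
  have := rE 0%N 1; rewrite tp1 rmorph1 mulr1 => h.
  by apply: (can_inj gK); rewrite -h rmorph1.
by rewrite [RHS]rE e1 rmorph1 mul1r.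
Qed.

(** By [rho0l], restricting N_(0 + n) to the second factor of A_0 (x) A_n gives back N_n, with F
    acting through A_0. *)
Lemma homF_homr n (P : lmodType (A n)) (N : gmod A) :
  isom (homF P (N n)) (resF (homr P (delta A N (0%N, n)))).
Proof.
pose W := res (tinr (A 0) (A n)) (delta A N (0%N, n)).
have actE (a : A n) (x : W) : a *: x = (a *: (x : N n) : N n).
  by rewrite -[LHS]/(rho A 0 n (tp 1 a) *: (x : N n)) rho0l.
have fD (h : homF P (N n)) : {morph (happ h : P -> W) : x y / x + y}.
  by move=> x y; exact: (happDr h x y).
have fZ (h : homF P (N n)) a x : (happ h (a *: x) : W) = a *: (happ h x : W).
  by rewrite happZ actE.
pose f (h : homF P (N n)) : resF (homr P (delta A N (0%N, n))) :=
  lin_of (fD h) (fZ h).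
have f'D (h : homr P (delta A N (0%N, n))) : {morph (happ h : P -> N n) : x y / x + y}.
  by move=> x y; exact: (happDr h x y).
have f'Z (h : homr P (delta A N (0%N, n))) a x :
    (happ h (a *: x) : N n) = a *: (happ h x : N n).
  by rewrite happZ actE.
pose f' (h : resF (homr P (delta A N (0%N, n)))) : homF P (N n) :=
  lin_of (f'D h) (f'Z h).
have LD : {morph f : x y / x + y} by move=> x y; apply: lin_ext.
have LZ a x : f (a *: x) = a *: f x.
  apply: lin_ext => p.
  rewrite -[LHS]/(scal (A n) a *: happ x p).
  rewrite -[RHS]/(rho A 0 n (tp (scal (A 0) a) 1) *: (happ x p : N n)).
  have -> // : rho A 0 n (tp (scal (A 0) a) 1) = scal (A n) a.
  exact: (ahom_scal (rho A 0 n) a).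
exists (lin_of LD LZ), f' => h; exact: lin_ext.
Qed.

Lemma dimv_isom (V W : lmodType F) : fgen V -> isom V W -> dimv V = dimv W.
Proof.
move=> fV h; have W0 : zero_module ({ffun 'I_0 -> F^o} : lmodType F).
  by move=> x; apply/ffunP => -[].
have [f [g fg]] := isom_ses_l h W0.
rewrite (dimv_ses _ _ fg) //; last first.
  exists 0%N, (fun _ => 0) => x; exists (fun _ => 0); rewrite (W0 x) big_ord0 //.
rewrite (_ : dimv ({ffun 'I_0 -> F^o} : lmodType F) = 0%N) ?addn0 //.
apply: (dimv_fbasis (e := fun _ => 0)); apply: fbasisP => [x|c _ []//].
by exists (fun _ => 0); rewrite (W0 x) big_ord0.
Qed.

Lemma dimv_resF_additive (B : fdalg F) :
  additive_on_ses Abelian (fun M : lmodType B => (dimv (resF M))%:Z).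
Proof.
move=> M' M M'' f g f1 f2 f3 _ _ _ [fI fk gs].
have fg : ses (res_map (scal B) f) (res_map (scal B) g) by split.
by rewrite (dimv_ses _ _ fg) ?PoszD //; exact: fgen_fd.
Qed.

Lemma G0_K0_biadditive n : biadditive (@G0_K0_pairing F (A n)).
Proof. by have [] := tower_perfect A n. Qed.

Lemma pairing0l n (a : G0 (A n)) : G0_K0_pairing 0 a = 0.
Proof.
have [h _] := G0_K0_biadditive n.
by apply: (addIr (G0_K0_pairing 0 a)); rewrite -h !add0r.
Qed.
Lemma pairing0r n (x : K0 (A n)) : G0_K0_pairing x 0 = 0.
Proof.
have [_ h] := G0_K0_biadditive n.
by apply: (addIr (G0_K0_pairing x 0)); rewrite -h !add0r.
Qed.

Lemma gpairingE (x : K) (a : G) (s : seq nat) : uniq s ->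
  (forall n, n \notin s -> dval x n = 0 \/ dval a n = 0) ->
  gpairing x a = \sum_(n <- s) G0_K0_pairing (dval x n) (dval a n).
Proof.
move=> us s0; rewrite /gpairing -set_true -(bigfs _ us) // => n _ /s0.
by case=> ->; [exact: pairing0l|exact: pairing0r].
Qed.

Lemma gpairingDl (a : G) : {morph (fun x : K => gpairing x a) : x y / x + y}.
Proof.
move=> x y; have [s us s0] := dsum_uniq_supp a.
rewrite !(gpairingE us) => [|n /s0|n /s0|n /s0]; try by right.
rewrite -big_split; apply: eq_bigr => n _.
by have [h _] := G0_K0_biadditive n; exact: h.
Qed.
Lemma gpairingDr (x : K) : {morph (fun a : G => gpairing x a) : a b / a + b}.
Proof.
move=> a b; have [s us s0] := dsum_uniq_supp x.
rewrite !(gpairingE us) => [|n /s0|n /s0|n /s0]; try by left.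
rewrite -big_split; apply: eq_bigr => n _.
by have [_ h] := G0_K0_biadditive n; exact: h.
Qed.

Lemma gpairing_dinj n (x : K0 (A n)) (a : G) :
  gpairing (dinj x) a = G0_K0_pairing x (dval a n).
Proof.
rewrite (gpairingE (s := [:: n])) // => [|m]; first by rewrite big_seq1 dinj_same.
by rewrite inE => mn; left; rewrite dinj_other // eq_sym.
Qed.

(** In each degree the components of a and b represent the same functional on K_0, and perfectness
    makes the representing element unique. *)
Lemma gpairing_nondegenerate (a b : G) :
  (forall y, gpairing y a = gpairing y b) -> a = b.
Proof.
move=> ab; apply: dsum_ext => n.
have [[bD _] _ pU] := tower_perfect A n.
have fD : zmod_morphism (fun u => G0_K0_pairing u (dval a n)).
  by move=> u v; apply: (addIr (G0_K0_pairing v (dval a n))); rewrite subrK -bD subrK.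
pose f : {additive K0 (A n) -> int} := HB.pack (fun u => G0_K0_pairing u (dval a n))
  (GRing.isZmodMorphism.Build _ _ _ fD).
have [c [_ cU]] := pU f.
rewrite -(cU (dval a n)) //; apply: cU => u.
by rewrite -[RHS]/(G0_K0_pairing u (dval a n)) -!gpairing_dinj ab.
Qed.

Lemma gpairing_gcls (Q N : gmod A) : gproj Q ->
  gpairing (gcls Split Q) (gcls Abelian N) = (dimv (resF (Res Q N 0%N)))%:Z.
Proof.
move=> pQ; have [s us s0] := gsupp_uniq Q.
rewrite (gpairingE us) => [|n /s0 Q0]; last by left; exact: cls0.
pose V j : lmodType (A 0) := homr (Q j) (delta A N (0%N, j)).
have fV j : fgen (V j) by apply: homr_fgen; exact: fgP.
have V0 j : j \notin s -> zero_module (V j).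
  by move=> /s0 Q0 f; apply: happ_eq => x; rewrite (Q0 x) !happ0r.
apply: esym; apply: etrans
  (phi_dsumm (@dimv_resF_additive (A 0)) fV (fun=> Logic.I) us V0) _.
apply: eq_bigr => n _; rewrite /= G0_K0_pairing_cls //; try exact: fgP.
rewrite /hdim; congr Posz; apply: esym; apply: dimv_isom.
  by apply: fgen_homF; exact: fgP.
exact: homF_homr.
Qed.
End TowerPairing.

(** * The Heisenberg double of a dualizing tower *)

Section IntegerTensor.
Variables (U V : zmodType).

Lemma morphMz (Z W : zmodType) (g : Z -> W) (n : int) z :
  {morph g : x y / x + y} -> g (z *~ n) = g z *~ n.
Proof.
move=> gD.
have gZ : zmod_morphism g.
  by move=> x y; apply: (addIr (g y)); rewrite subrK -gD subrK.
pose h : {additive Z -> W} := HB.pack g (GRing.isZmodMorphism.Build _ _ g gZ).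
exact: (raddfMz h).
Qed.

Lemma biadditive_balanced (Z : zmodType) (f : U -> V -> Z) : biadditive f ->
  balanced (fun (m : U) (z : int) => m *~ z) (fun z (n : V) => n *~ z) f.
Proof.
move=> [fl fr]; split=> [m m' n|m n n'|m z n] //.
by rewrite (morphMz (g := f^~ n)) // (morphMz (g := f m)).
Qed.

Section Lift.
Variables (Z : zmodType) (f : U -> V -> Z).
Hypothesis fB : biadditive f.
Lemma zliftD : {morph zlift f : x y / x + y}.
Proof. exact: (tliftD (biadditive_balanced fB)). Qed.
Lemma zlift_pure u v : zlift f (purez u v) = f u v.
Proof. exact: (tlift_pure (biadditive_balanced fB)). Qed.
End Lift.

Lemma purez_biadditive : biadditive (@purez U V).
Proof. by split=> *; [exact: tpureDl|exact: tpureDr]. Qed.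

Lemma tensZ_addE (Z : zmodType) (g h : tensZ U V -> Z) :
  {morph g : x y / x + y} -> {morph h : x y / x + y} ->
  (forall u v, g (purez u v) = h (purez u v)) -> g =1 h.
Proof. exact: tens_addE. Qed.

Lemma zlift_comp (Z W : zmodType) (g : Z -> W) (f : U -> V -> Z) t :
  biadditive f -> {morph g : x y / x + y} ->
  g (zlift f t) = zlift (fun u v => g (f u v)) t.
Proof.
move=> fB gD.
have gfB : biadditive (fun u v => g (f u v)).
  by case: fB => fl fr; split=> *; rewrite ?fl ?fr gD.
move: t; apply: tensZ_addE => [x y|x y|u v].
- by rewrite (zliftD fB) gD.
- exact: (zliftD gfB).
by rewrite (zlift_pure fB) (zlift_pure gfB).
Qed.

Lemma eq_zlift (Z : zmodType) (f g : U -> V -> Z) : f =2 g -> zlift f =1 zlift g.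
Proof. by move=> fg t; congr (zlift _ t); apply/funext => u; apply/funext. Qed.
End IntegerTensor.

Section Dualizing.
Variables (F : fieldType) (A : tower F).
Hypothesis dA : dualizing A.
Local Notation G := (GK A Abelian).
Local Notation K := (GK A Split).
Implicit Types (x y z : K) (a b c : G).

Let hopfG : is_hopf (@gmul F A Abelian) (gone A Abelian) (@gcomul F A Abelian)
  (@gcounit F A Abelian). Proof. by case: dA. Qed.
Let hopfK : is_hopf (@gmul F A Split) (gone A Split) (@gcomul F A Split)
  (@gcounit F A Split). Proof. by case: dA. Qed.
Let pair_mul x y a : gpairing (gmul x y) a = gpairing2 (purez x y) (gcomul a).
Proof. by case: dA => _ _ []. Qed.
Let pair_comul x a b : gpairing x (gmul a b) = gpairing2 (gcomul x) (purez a b).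
Proof. by case: dA => _ _ []. Qed.
Let pair_one x : gpairing x (gone A Abelian) = gcounit x.
Proof. by case: dA => _ _ []. Qed.

Lemma gmulDl k (u : GK A k) : {morph (fun v : GK A k => gmul v u) : v w / v + w}.
Proof.
move=> v w; case: k u v w => u v w.
  by have [h _] := hopf_mul_biadd hopfG; exact: h.
by have [h _] := hopf_mul_biadd hopfK; exact: h.
Qed.
Lemma gmulDr k (u : GK A k) : {morph (fun v : GK A k => gmul u v) : v w / v + w}.
Proof.
move=> v w; case: k u v w => u v w.
  by have [_ h] := hopf_mul_biadd hopfG; exact: h.
by have [_ h] := hopf_mul_biadd hopfK; exact: h.
Qed.

Lemma pairing_biadditive x y : biadditive (fun a b => gpairing x a * gpairing y b).
Proof. by split=> *; rewrite gpairingDr ?mulrDl ?mulrDr. Qed.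

Lemma gpairing2_biadditive (t : tensZ G G) :
  biadditive (fun x y => zlift (fun a b => gpairing x a * gpairing y b) t).
Proof.
split=> [x x' y|x y y']; move: t; apply: tensZ_addE => [s t|s t|a b];
  rewrite ?(zliftD (pairing_biadditive _ _)) //; try by rewrite addrACA.
- by rewrite !(zlift_pure (pairing_biadditive _ _)) gpairingDl mulrDl.
by rewrite !(zlift_pure (pairing_biadditive _ _)) gpairingDl mulrDr.
Qed.

Lemma gpairing2D t : {morph (fun s : tensZ K K => gpairing2 s t) : s s' / s + s'}.
Proof. exact: (zliftD (gpairing2_biadditive t)). Qed.
Lemma gpairing2_pure x y t : gpairing2 (purez x y) t =
  zlift (fun a b => gpairing x a * gpairing y b) t.
Proof. exact: (zlift_pure (gpairing2_biadditive t)). Qed.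
Lemma gpairing2_pures x y a b :
  gpairing2 (purez x y) (purez a b) = gpairing x a * gpairing y b.
Proof. by rewrite gpairing2_pure (zlift_pure (pairing_biadditive x y)). Qed.

(** The choice in [Rstar] succeeds: as the product of K is dual to the coproduct of G, the sum of
    <x, a_(2)> a_(1) over the coproduct of a has the required pairings. *)
Lemma RstarE x a y : gpairing y (Rstar x a) = gpairing (gmul y x) a.
Proof.
suff h : exists b, forall y, gpairing y b = gpairing (gmul y x) a.
  by move: y; exact: (xgetPex (0 : G) h).
pose f (a1 a2 : G) : G := a1 *~ gpairing x a2.
have fB : biadditive f.
  by split=> *; rewrite /f ?mulrzDl ?gpairingDr ?mulrzDr // mulrzDl.
exists (zlift f (gcomul a)) => z; rewrite (zlift_comp _ fB (gpairingDr z)).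
rewrite pair_mul gpairing2_pure; apply: eq_zlift => a1 a2.
by rewrite /f (morphMz _ _ (gpairingDr z)) -mulrzr intz.
Qed.

Lemma RstarDr x : {morph (fun a => Rstar x a) : a b / a + b}.
Proof.
move=> a b; apply: gpairing_nondegenerate => y.
by rewrite gpairingDr !RstarE gpairingDr.
Qed.
Lemma RstarDl a : {morph (fun x => Rstar x a) : x y / x + y}.
Proof.
move=> x x'; apply: gpairing_nondegenerate => y.
by rewrite gpairingDr !RstarE gmulDr gpairingDl.
Qed.
Lemma Rstar1 a : Rstar (gone A Split) a = a.
Proof.
by apply: gpairing_nondegenerate => y; rewrite RstarE (hopf_mulr1 hopfK).
Qed.
(** Pairing with the unit is the counit, and the counit is multiplicative. *)
Lemma Rstar_one x : Rstar x (gone A Abelian) = gone A Abelian *~ gcounit x.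
Proof.
apply: gpairing_nondegenerate => y; rewrite RstarE (morphMz _ _ (gpairingDr y)).
by rewrite !pair_one (hopf_counitM hopfK) -mulrzr intz.
Qed.
Lemma RstarM x y a : Rstar (gmul x y) a = Rstar x (Rstar y a).
Proof.
by apply: gpairing_nondegenerate => z; rewrite !RstarE (hopf_mulA hopfK).
Qed.

Lemma Rstar_gmul_biadditive a b :
  biadditive (fun x1 x2 => gmul (Rstar x1 a) (Rstar x2 b)).
Proof. by split=> *; rewrite RstarDl ?gmulDl ?gmulDr. Qed.

(** G is a module algebra over K. Paired with y, the claim reads <yx, ab> = <(coproduct of
    y)(coproduct of x), a (x) b>, which holds because the coproduct of K is multiplicative and dual
    to the product of G. *)
Lemma Rstar_gmul x a b : Rstar x (gmul a b) =
  zlift (fun x1 x2 => gmul (Rstar x1 a) (Rstar x2 b)) (gcomul x).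
Proof.
apply: gpairing_nondegenerate => y.
rewrite RstarE pair_comul (hopf_comulM hopfK).
rewrite (zlift_comp _ (Rstar_gmul_biadditive a b) (gpairingDr y)).
under [RHS]eq_zlift => x1 x2 do rewrite pair_comul.
have bb s : biadditive (fun x1 x2 =>
    gpairing2 s (purez (Rstar x1 a) (Rstar x2 b))).
  have pB := purez_biadditive G G.
  have g2D t t' : gpairing2 s (t + t') = gpairing2 s t + gpairing2 s t'.
    move: s; apply: tensZ_addE => [s s'|s s'|u v].
    - exact: gpairing2D.
    - by rewrite !gpairing2D addrACA.
    by rewrite !gpairing2_pure (zliftD (pairing_biadditive _ _)).
  by case: pB => pl pr; split=> *; rewrite RstarDl ?pl ?pr g2D.
have mB (t : tensZ K K) :
    biadditive (fun x y => zlift (fun x' y' => purez (gmul x x') (gmul y y')) t).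
  have cB u v : biadditive (fun x' y' => purez (gmul u x') (gmul v y') : tensZ K K).
    by have [pl pr] := purez_biadditive K K; split=> *; rewrite gmulDr ?pl ?pr.
  have [pl pr] := purez_biadditive K K.
  split=> [u u' v|u v v']; move: t; apply: tensZ_addE => [s t|s t|w w'];
    rewrite ?(zliftD (cB _ _)) //; try by rewrite addrACA.
  - by rewrite !(zlift_pure (cB _ _)) gmulDl pl.
  by rewrite !(zlift_pure (cB _ _)) gmulDl pr.
rewrite /tensZ_mul.
(* Both sides are additive in the two coproducts, so these may be replaced by arbitrary tensors and
   then by pure ones. *)
move: (gcomul y) (gcomul x) => s t.
move: s; apply: tensZ_addE => [s s'|s s'|y1 y2].
- by rewrite (zliftD (mB t)) gpairing2D.
- move: t; apply: tensZ_addE => [t t'|t t'|x1 x2].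
  + exact: (zliftD (bb _)).
  + by rewrite !(zliftD (bb _)) addrACA.
  by rewrite !(zlift_pure (bb _)) gpairing2D.
rewrite (zlift_pure (mB t)); move: t; apply: tensZ_addE => [t t'|t t'|x1 x2].
- rewrite zliftD ?gpairing2D //.
  by have [pl pr] := purez_biadditive K K; split=> *; rewrite gmulDr ?pl ?pr.
- exact: (zliftD (bb _)).
rewrite (zlift_pure (bb _)) zlift_pure; last first.
  by have [pl pr] := purez_biadditive K K; split=> *; rewrite gmulDr ?pl ?pr.
by rewrite !gpairing2_pures !RstarE.
Qed.

Lemma hact_biadditive b : biadditive (fun a x => gmul a (Rstar x b)).
Proof. by split=> *; rewrite ?RstarDl ?gmulDl ?gmulDr. Qed.
Lemma hactDl b : {morph (fun u : heis A => hact u b) : u v / u + v}.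
Proof. exact: (zliftD (hact_biadditive b)). Qed.
Lemma hact_pure a x b : hact (purez a x) b = gmul a (Rstar x b).
Proof. exact: (zlift_pure (hact_biadditive b)). Qed.
Lemma hactDr (u : heis A) : {morph hact u : a b / a + b}.
Proof.
move=> a b; move: u; apply: tensZ_addE => [u v|u v|c x].
- exact: hactDl.
- by rewrite !hactDl addrACA.
by rewrite !hact_pure RstarDr gmulDr.
Qed.
Lemma hact_hG a b : hact (hG a) b = gmul a b.
Proof. by rewrite hact_pure Rstar1. Qed.
Lemma hact_hK x b : hact (hK x) b = Rstar x b.
Proof. by rewrite hact_pure (hopf_mul1 hopfG). Qed.

Lemma hmul_in_biadditive a b y :
  biadditive (fun x1 x2 => purez (gmul a (Rstar x1 b)) (gmul x2 y) : heis A).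
Proof.
have [pl pr] := purez_biadditive G K.
by split=> *; rewrite ?RstarDl ?gmulDr ?gmulDl ?pl ?pr.
Qed.
Lemma hmul_r_biadditive a x : biadditive (fun b y =>
  zlift (fun x1 x2 => purez (gmul a (Rstar x1 b)) (gmul x2 y) : heis A) (gcomul x)).
Proof.
have [pl pr] := purez_biadditive G K.
split=> [b b' y|b y y']; move: (gcomul x); apply: tensZ_addE => [s t|s t|x1 x2];
  rewrite ?(zliftD (hmul_in_biadditive _ _ _)) //; try by rewrite addrACA.
- by rewrite !(zlift_pure (hmul_in_biadditive _ _ _)) RstarDr gmulDr pl.
by rewrite !(zlift_pure (hmul_in_biadditive _ _ _)) gmulDr pr.
Qed.
Lemma hmul_l_biadditive (v : heis A) : biadditive (fun a x =>
  zlift (fun b y =>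
    zlift (fun x1 x2 => purez (gmul a (Rstar x1 b)) (gmul x2 y) : heis A)
      (gcomul x)) v).
Proof.
have [pl pr] := purez_biadditive G K.
split=> [a a' x|a x x']; move: v; apply: tensZ_addE => [s t|s t|b y];
  rewrite ?(zliftD (hmul_r_biadditive _ _)) //; try by rewrite addrACA.
  rewrite !(zlift_pure (hmul_r_biadditive _ _)).
  move: (gcomul x); apply: tensZ_addE => [s t|s t|x1 x2];
    rewrite ?(zliftD (hmul_in_biadditive _ _ _)) //; first by rewrite addrACA.
  by rewrite !(zlift_pure (hmul_in_biadditive _ _ _)) gmulDl pl.
rewrite !(zlift_pure (hmul_r_biadditive _ _)) (hopf_comulD hopfK).
by rewrite (zliftD (hmul_in_biadditive _ _ _)).
Qed.
Lemma hmulDl (v : heis A) : {morph (fun u => hmul u v) : u u' / u + u'}.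
Proof. exact: (zliftD (hmul_l_biadditive v)). Qed.
Lemma hmul_purel a x (v : heis A) : hmul (purez a x) v =
  zlift (fun b y =>
    zlift (fun x1 x2 => purez (gmul a (Rstar x1 b)) (gmul x2 y) : heis A)
      (gcomul x)) v.
Proof. exact: (zlift_pure (hmul_l_biadditive v)). Qed.
Lemma hmulDr (u : heis A) : {morph hmul u : v v' / v + v'}.
Proof.
move=> v v'; move: u; apply: tensZ_addE => [s t|s t|a x].
- exact: hmulDl.
- by rewrite !hmulDl addrACA.
by rewrite !hmul_purel (zliftD (hmul_r_biadditive _ _)).
Qed.
Lemma hmul_pures a x b y : hmul (purez a x) (purez b y) =
  zlift (fun x1 x2 => purez (gmul a (Rstar x1 b)) (gmul x2 y) : heis A) (gcomul x).
Proof. by rewrite hmul_purel (zlift_pure (hmul_r_biadditive _ _)). Qed.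

Lemma hmul_hG a b : hmul (hG a) (hG b) = hG (gmul a b).
Proof.
rewrite hmul_pures (hopf_comul1 hopfK) (zlift_pure (hmul_in_biadditive _ _ _)).
by rewrite Rstar1 (hopf_mul1 hopfK).
Qed.
(** x_(1) acts on the unit of G by its counit, so the counit axiom collapses the sum. *)
Lemma hmul_hK x y : hmul (hK x) (hK y) = hK (gmul x y).
Proof.
have [pl pr] := purez_biadditive G K.
rewrite hmul_pures.
pose g z : heis A := purez (gone A Abelian) (gmul z y).
have gD : {morph g : z z' / z + z'} by move=> z z'; rewrite /g gmulDl pr.
transitivity (zlift (fun x1 x2 => g (x2 *~ gcounit x1)) (gcomul x)).
  apply: eq_zlift => x1 x2; rewrite Rstar_one (hopf_mul1 hopfG) (morphMz _ _ gD).
  by rewrite (morphMz (g := fun a => purez a _)).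
rewrite -zlift_comp //; last first.
  by split=> *; rewrite ?mulrzDl // (hopf_counitD hopfK) mulrzDr.
by rewrite (hopf_counitl hopfK).
Qed.
Lemma hmul_hK_hG x a : hmul (hK x) (hG a) = hcross x a.
Proof.
rewrite hmul_pures; apply: eq_zlift => x1 x2.
by rewrite (hopf_mul1 hopfG) (hopf_mulr1 hopfK).
Qed.

(** This is the module algebra law: the normal form of xa acts as multiplication by a followed by
    the action of x. *)
Lemma hact_hcross x a b : hact (hcross x a) b = Rstar x (gmul a b).
Proof.
have [pl pr] := purez_biadditive G K.
rewrite /hcross (zlift_comp (g := fun u => hact u b)); first last.
- exact: hactDl.
- by split=> *; rewrite ?RstarDl ?pl ?pr.
by rewrite Rstar_gmul; apply: eq_zlift => x1 x2; rewrite hact_pure.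
Qed.
End Dualizing.

(** * Categorification *)

Section GradedGenerators.
Variables (F : fieldType) (A : tower F) (k : gkind).

Definition zero_fgmod n : fgmod (A n) :=
  FgMod (fgen_mxmod (projT1 (cid (zero_mxrep_ex (A n))))).
(** M placed in degree n, with zero modules elsewhere; this realizes each generator of a single
    Grothendieck group by a graded module. *)
Definition conc_val n (M : fgmod (A n)) i : fgmod (A i) :=
  if n =P i is ReflectT e then
    match e in _ = i' return fgmod (A i') with erefl => M end
  else zero_fgmod i.
Lemma conc_same n (M : fgmod (A n)) : conc_val M n = M.
Proof. by rewrite /conc_val; case: eqP => // e; rewrite (eq_irrelevance e erefl). Qed.
Lemma conc_other n (M : fgmod (A n)) i : n != i -> zero_module (conc_val M i).
Proof.
rewrite /conc_val; case: eqP => // _ _.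
exact: (projT2 (cid (zero_mxrep_ex (A i)))).
Qed.
Lemma conc_supp n (M : fgmod (A n)) :
  exists s : seq nat, forall i, i \notin s -> zero_module (conc_val M i).
Proof. by exists [:: n] => i; rewrite inE eq_sym; exact: conc_other. Qed.
Definition conc n (M : fgmod (A n)) : gmod A := @GMod _ _ A _ (conc_supp M).

Lemma gcls_conc n (M : fgmod (A n)) : gcls k (conc M) = dinj (cls k M).
Proof.
apply: dsum_ext => i; have [<-|ni] := eqVneq n i.
  by rewrite dinj_same [LHS]/= conc_same.
by rewrite dinj_other //; apply: cls0; exact: conc_other.
Qed.

Lemma gadmissible_conc n (M : fgmod (A n)) :
  admissible k M -> gadmissible k (conc M).
Proof.
move=> aM i; have [<-|ni] := eqVneq n i; first by rewrite /= conc_same.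
rewrite /admissible; case: k => //; apply: projective_zero; exact: conc_other.
Qed.

(** Reduces additive identities in G(A) and K(A) to classes of graded modules, to which the functors
    apply. *)
Lemma GK_ind (T : GK A k -> Prop) :
  (forall x y, T x -> T y -> T (x + y)) -> (forall x, T x -> T (- x)) ->
  (forall X, gadmissible k X -> T (gcls k X)) -> forall x, T x.
Proof.
move=> TD TN Tc.
have Tinj n (x : Groth (A n) k) : T (dinj x).
  move: x; apply: Groth_ind => [x y Tx Ty|x Tx|M fM aM].
  - by rewrite dinjD; exact: TD.
  - have -> : dinj (- x) = - dinj x :> GK A k.
      by apply: (addIr (dinj x)); rewrite -dinjD !addNr dinj0.
    exact: TN.
  by rewrite -(gcls_conc (FgMod fM)); apply: Tc; exact: gadmissible_conc.
by apply: dsum_ind => //; rewrite -(dinj0 (fun n => Groth (A n) k) 0%N).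
Qed.

Lemma gcls_natiso (T T' : functor (modc A) (modc A)) X : natiso T T' ->
  gadmissible k (T X) -> gcls k (T X) = gcls k (T' X).
Proof.
move=> h aT; apply: dsum_ext => n; apply: cls_isom; [exact: fgP|exact: aT|].
exact: natiso_isom h X n.
Qed.
End GradedGenerators.

Lemma additive_opp (U V : zmodType) (g : U -> V) :
  {morph g : x y / x + y} -> forall x, g (- x) = - g x.
Proof.
move=> gD x; have g0 : g 0 = 0 by apply: (addIr (g 0)); rewrite -gD !add0r.
by apply: (addIr (g x)); rewrite -gD !addNr.
Qed.

Section Functors.
Variables (F : fieldType) (A : tower F).

Lemma exact_nabla : exact_functor (nabla A).
Proof. by apply: exact_Indf => -[m n]; exact: rho_projr. Qed.
Lemma exact_Ind (M : gmod A) : exact_functor (Ind M).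
Proof. by apply: exact_comp; [exact: exact_Tensf|exact: exact_nabla]. Qed.
Lemma exact_Res (P : gmod A) : gproj P -> exact_functor (Res P).
Proof. by move=> pP; apply: exact_comp; [exact: exact_Resf|exact: exact_Homf]. Qed.

Lemma gproj_Ind (M N : gmod A) : gproj M -> gproj N -> gproj (Ind M N).
Proof. by move=> pM pN; apply: gproj_Indf; exact: gproj_gtens. Qed.
Lemma gproj_Res (P N : gmod A) : gproj P -> gproj N -> gproj (Res P N).
Proof.
move=> pP pN; apply: gproj_Homf => //; apply: gproj_Resf => // -[m n].
exact: rho_projl.
Qed.
End Functors.

Section Categorification.
Variables (F : fieldType) (A : tower F).
Hypothesis dA : dualizing A.
Local Notation G := (GK A Abelian).
Local Notation K := (GK A Split).
Local Notation clsG := (@gcls F A Abelian).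
Local Notation clsK := (@gcls F A Split).

Lemma Rstar_gcls (P N : gmod A) : gproj P ->
  Rstar (clsK P) (clsG N) = clsG (Res P N).
Proof.
move=> pP; apply: gpairing_nondegenerate => y; rewrite (RstarE dA).
move: y; apply: GK_ind => [x y ex ey|x ex|Q pQ].
- by rewrite (gmulDl dA) !gpairingDl ex ey.
- rewrite (additive_opp (gmulDl dA (clsK P))) !(additive_opp (gpairingDl _)).
  by rewrite ex.
rewrite gmul_gcls // !gpairing_gcls //; last by apply: gproj_Ind.
congr Posz; have [f [f' fK f'K]] := natiso_isom (natiso_sym (Res_comp Q P)) N 0%N.
apply: dimv_isom; first by apply: fgen_fd; exact: fgP.
by exists (res_map (scal (A 0)) f), f'.
Qed.

Lemma induces_natiso T T' (phi psi : G -> G) : natiso T T' -> phi =1 psi ->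
  induces T phi -> induces T' psi.
Proof.
move=> h /funext <- [eT pD cT]; split=> //; first exact: natiso_exact h eT.
by move=> N; rewrite -cT; apply: esym; apply: gcls_natiso.
Qed.

Lemma induces_comp T T' (phi psi : G -> G) : induces T phi -> induces T' psi ->
  induces (T \of T') (phi \o psi).
Proof.
move=> [eT pD cT] [eT' pD' cT']; split=> [|a b|N] /=.
- exact: exact_comp.
- by rewrite pD' pD.
by rewrite cT cT'.
Qed.

Lemma induces_Ind (M : gmod A) : induces (Ind M) (hact (hG (clsG M))).
Proof.
split=> [||N]; [exact: exact_Ind|exact: hactDr|].
by rewrite (hact_hG dA) gmul_gcls.
Qed.
Lemma induces_Res (P : gmod A) : gproj P -> induces (Res P) (hact (hK (clsK P))).
Proof.
move=> pP; split=> [||N]; [exact: exact_Res|exact: hactDr|].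
by rewrite (hact_hK dA) Rstar_gcls.
Qed.

Variable c : algauts A.
Hypothesis sA : strong c.

Lemma categorifies : categorifies_fock c.
Proof.
split=> [|||P Q pP pQ|M P pP]; first exact: induces_Ind.
- exact: induces_Res.
- move=> M N; have h := Ind_comp M N; split=> //; first exact: hmul_hG.
    by apply: induces_comp; exact: induces_Ind.
  apply: induces_natiso h _ (induces_comp (induces_Ind M) (induces_Ind N)) => a.
  by rewrite /= !(hact_hG dA) (hopf_mulA (let: And3 h _ _ := dA in h)).
- have h := Res_comp P Q; split=> //; first exact: hmul_hK.
    by apply: induces_comp; exact: induces_Res.
  apply: induces_natiso h _ (induces_comp (induces_Res pP) (induces_Res pQ)) => a.
  by rewrite /= !(hact_hK dA) RstarM.
have h := Res_Ind M sA pP; split=> //; first exact: hmul_hK_hG.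
  by apply: induces_comp; [exact: induces_Res|exact: induces_Ind].
apply: induces_natiso h _ (induces_comp (induces_Res pP) (induces_Ind M)) => a.
by rewrite /= (hact_hK dA) (hact_hG dA) (hact_hcross dA).
Qed.
End Categorification.

(** * The projective Fock space *)

Section ProjectiveCategorification.
Variables (F : fieldType) (A : tower F).
Local Notation G := (GK A Abelian).
Local Notation K := (GK A Split).
Local Notation clsG := (@gcls F A Abelian).
Local Notation clsK := (@gcls F A Split).

Lemma cartan_additive (B : fdalg F) :
  additive_on_ses Split (fun P : lmodType B => cls Abelian P).
Proof.
by move=> M' M M'' f g f1 f2 f3 _ _ _ fg; exact: (cls_ses f1 f2 f3 _ _ _ fg).
Qed.

Lemma cartan_supp (x : K) : exists s : seq nat, forall n, n \notin s ->
  glift (fun P => cls Abelian P) (dval x n) = 0.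
Proof.
have [s s0] := dsupp x; exists s => n /s0 ->; exact: glift0 (@cartan_additive _).
Qed.
Definition cartan (x : K) : G := DSum (cartan_supp x).

Lemma cartanD : {morph cartan : x y / x + y}.
Proof. by move=> x y; apply: dsum_ext => n; exact: (gliftD (@cartan_additive _)). Qed.
Lemma cartan_gcls (X : gmod A) : gproj X -> cartan (clsK X) = clsG X.
Proof.
move=> pX; apply: dsum_ext => n.
by apply: (glift_cls (@cartan_additive _)); [exact: fgP|exact: pX].
Qed.
Lemma in_Gproj_cartan (x : K) : in_Gproj (cartan x).
Proof. by exists x. Qed.
Lemma in_GprojP (a : G) : in_Gproj a -> exists x, a = cartan x.
Proof. by move=> [x ax]; exists x; exact: dsum_ext. Qed.

Lemma in_GprojD (a b : G) : in_Gproj a -> in_Gproj b -> in_Gproj (a + b).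
Proof.
by move=> /in_GprojP[x ->] /in_GprojP[y ->]; rewrite -cartanD; exact: in_Gproj_cartan.
Qed.
Lemma in_GprojN (a : G) : in_Gproj a -> in_Gproj (- a).
Proof.
move=> /in_GprojP[x ->]; rewrite -(additive_opp cartanD); exact: in_Gproj_cartan.
Qed.
Lemma in_Gproj_gcls (X : gmod A) : gproj X -> in_Gproj (clsG X).
Proof. by move=> /cartan_gcls <-; exact: in_Gproj_cartan. Qed.

(** The image of the Cartan map is generated as a group by the classes of graded projective modules,
    because K(A) is. *)
Lemma in_Gproj_ind (T : G -> Prop) :
  (forall a b, T a -> T b -> T (a + b)) -> (forall a, T a -> T (- a)) ->
  (forall X, gproj X -> T (clsG X)) -> forall a, in_Gproj a -> T a.
Proof.
move=> TD TN Tc a /in_GprojP[x ->].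
move: x; apply: GK_ind => [x y ex ey|x ex|X pX].
- by rewrite cartanD; exact: TD.
- by rewrite (additive_opp cartanD); exact: TN.
by rewrite (cartan_gcls pX); exact: Tc.
Qed.

Lemma in_Gproj_one : in_Gproj (gone A Abelian).
Proof.
have fA : fgen ((A 0)^o : lmodType (A 0)).
  by apply: fd_fgen; exact: alg_fin.
rewrite /gone -(gcls_conc Abelian (FgMod fA)); apply: in_Gproj_gcls.
by apply: (gadmissible_conc (k := Split)); exact: projective_regular.
Qed.

Lemma in_hprojD (u v : heis A) : in_hproj u -> in_hproj v -> in_hproj (u + v).
Proof.
move=> [s [sP ->]] [t [tP ->]]; exists (s ++ t); split; last by rewrite big_cat.
by move=> a x; rewrite mem_cat => /orP[/sP|/tP].
Qed.
Lemma in_hproj_purez (a : G) (x : K) : in_Gproj a -> in_hproj (purez a x : heis A).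
Proof.
move=> pa; exists [:: (a, x)]; split; last by rewrite big_seq1.
by move=> b y; rewrite inE => /eqP[-> _].
Qed.
Lemma in_hproj0 : in_hproj (0 : heis A).
Proof. by exists [::]; split=> //; rewrite big_nil. Qed.
Lemma in_hproj_ind (T : heis A -> Prop) : T 0 ->
  (forall u v, T u -> T v -> T (u + v)) ->
  (forall a x, in_Gproj a -> T (purez a x)) -> forall u, in_hproj u -> T u.
Proof.
move=> T0 TD Tp u [s [sP ->]]; rewrite big_seq.
by apply: big_ind => // -[a x] /sP; exact: Tp.
Qed.

Hypothesis dA : dualizing A.

Lemma in_Gproj_gmul (a b : G) : in_Gproj a -> in_Gproj b -> in_Gproj (gmul a b).
Proof.
move=> pa pb; move: a pa.
apply: (in_Gproj_ind (T := fun a => in_Gproj (gmul a b))) => [x y px py|x px|X pX].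
- by rewrite (gmulDl dA); exact: in_GprojD.
- by rewrite (additive_opp (gmulDl dA b)); exact: in_GprojN.
move: b pb; apply: (in_Gproj_ind (T := fun b => in_Gproj (gmul (clsG X) b)))
  => [x y px py|x px|Y pY].
- by rewrite (gmulDr dA); exact: in_GprojD.
- by rewrite (additive_opp (gmulDr dA (clsG X))); exact: in_GprojN.
by rewrite gmul_gcls //; apply: in_Gproj_gcls; exact: gproj_Ind.
Qed.

Lemma in_Gproj_Rstar (x : K) (b : G) : in_Gproj b -> in_Gproj (Rstar x b).
Proof.
move=> pb; move: x; apply: GK_ind => [x y px py|x px|P pP].
- by rewrite (RstarDl dA); exact: in_GprojD.
- by rewrite (additive_opp (RstarDl dA b)); exact: in_GprojN.
move: b pb; apply: (in_Gproj_ind (T := fun b => in_Gproj (Rstar (clsK P) b)))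
  => [x y px py|x px|N pN].
- by rewrite (RstarDr dA); exact: in_GprojD.
- by rewrite (additive_opp (RstarDr dA (clsK P))); exact: in_GprojN.
by rewrite Rstar_gcls //; apply: in_Gproj_gcls; exact: gproj_Res.
Qed.

Lemma in_Gproj0 : in_Gproj (0 : G).
Proof.
have p1 := in_Gproj_one; rewrite -(subrr (gone A Abelian)).
by apply: in_GprojD => //; exact: in_GprojN.
Qed.

Lemma in_Gproj_hact u (a : G) : in_hproj u -> in_Gproj a -> in_Gproj (hact u a).
Proof.
move=> pu pa; move: u pu.
apply: (in_hproj_ind (T := fun u => in_Gproj (hact u a))) => [|u v pu pv|b x pb].
- have -> : hact 0 a = 0.
    by apply: (addIr (hact 0 a)); rewrite -(hactDl dA) !add0r.
  exact: in_Gproj0.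
- by rewrite (hactDl dA); exact: in_GprojD.
by rewrite (hact_pure dA); apply: in_Gproj_gmul => //; exact: in_Gproj_Rstar.
Qed.

(** After reduction to pure tensors, the left factors of the product are a times [Rstar x1 b]. They
    stay in the image of the Cartan map, since Ind and Res by projectives preserve projectives. *)
Lemma in_hproj_hmul (u v : heis A) : in_hproj u -> in_hproj v -> in_hproj (hmul u v).
Proof.
move=> pu pv; move: u pu.
apply: (in_hproj_ind (T := fun u => in_hproj (hmul u v))) => [|u w pu pw|a x pa].
- have -> : hmul 0 v = 0.
    by apply: (addIr (hmul 0 v)); rewrite -(hmulDl dA) !add0r.
  exact: in_hproj0.
- by rewrite (hmulDl dA); exact: in_hprojD.
move: v pv; apply: (in_hproj_ind (T := fun v => in_hproj (hmul (purez a x) v)))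
  => [|u w pu pw|b y pb].
- have -> : hmul (purez a x : heis A) 0 = 0.
    by apply: (addIr (hmul (purez a x : heis A) 0)); rewrite -(hmulDr dA) !add0r.
  exact: in_hproj0.
- by rewrite (hmulDr dA); exact: in_hprojD.
rewrite (hmul_pures dA); elim/tens_ind: (gcomul x) => [s t hs ht|x1 x2].
  by rewrite (zliftD (hmul_in_biadditive dA a b y)); exact: in_hprojD.
rewrite -[tpure _ _ x1 x2]/(purez x1 x2) (zlift_pure (hmul_in_biadditive dA a b y)).
by apply: in_hproj_purez; apply: in_Gproj_gmul => //; exact: in_Gproj_Rstar.
Qed.

Lemma in_hproj_hG (a : G) : in_Gproj a -> in_hproj (hG a).
Proof. exact: in_hproj_purez. Qed.
Lemma in_hproj_hK (x : K) : in_hproj (hK x).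
Proof. by apply: in_hproj_purez; exact: in_Gproj_one. Qed.

Lemma induces_proj_of T (phi : G -> G) : induces T phi ->
  (forall N, gproj N -> gproj (T N)) ->
  (forall a, in_Gproj a -> in_Gproj (phi a)) -> induces_proj T phi.
Proof. by move=> [eT pD cT] TP pp; split=> // a b _ _; exact: pD. Qed.

(** Everything restricts from the relation on all modules once T preserves projectives: T' preserves
    them because it is isomorphic to T, and w = uv lies in the subalgebra. *)
Lemma induces_relation_proj_of T T' (u v w : heis A) :
  induces_relation T T' u v w -> in_hproj u -> in_hproj v ->
  (forall N, gproj N -> gproj (T N)) -> induces_relation_proj T T' u v w.
Proof.
move=> [h uvw iT iT'] pu pv TP.
have TP' N : gproj N -> gproj (T' N) by move=> /TP; exact: natiso_gproj.
split=> //.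
- by exists TP, TP'; exact: natiso_full.
- apply: induces_proj_of iT TP _ => a pa.
  exact: in_Gproj_hact pu (in_Gproj_hact pv pa).
apply: induces_proj_of iT' TP' _ => a pa.
by apply: in_Gproj_hact => //; rewrite -uvw; exact: in_hproj_hmul.
Qed.

Variable c : algauts A.
Hypothesis sA : strong c.

Lemma categorifies_proj : categorifies_fock_proj c.
Proof.
have [iI iR rI rR rX] := categorifies dA sA.
have pG M : gproj M -> in_hproj (hG (clsG M)).
  by move=> pM; apply: in_hproj_hG; exact: in_Gproj_gcls.
have pK P : in_hproj (hK (clsK P)) by exact: in_hproj_hK.
split; first exact: in_hproj_hmul.
split; first exact: in_Gproj_hact.
split=> [M pM|P pP|M N pM pN|P Q pP pQ|M P pM pP].
- split; first exact: pG.
  apply: induces_proj_of (iI M) _ _ => [N|a]; first exact: gproj_Ind.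
  by apply: in_Gproj_hact; exact: pG.
- split; first exact: pK.
  apply: induces_proj_of (iR P pP) _ _ => [N|a]; first exact: gproj_Res.
  by apply: in_Gproj_hact; exact: pK.
- apply: induces_relation_proj_of (rI M N) (pG M pM) (pG N pN) _ => X pX.
  exact: gproj_Ind pM (gproj_Ind pN pX).
- apply: induces_relation_proj_of (rR P Q pP pQ) (pK P) (pK Q) _ => X pX.
  exact: gproj_Res pP (gproj_Res pQ pX).
apply: induces_relation_proj_of (rX M P pP) (pK P) (pG M pM) _ => X pX.
by apply: gproj_Res => //; exact: gproj_Ind.
Qed.
End ProjectiveCategorification.

Theorem theorem3p18 (F : fieldType) (A : tower F) (c : algauts A)
    (A_strong : strong c) :
  (forall M N : modc A,
     natiso (Ind M \of Ind N) (Ind (nabla A (gtens M N)))) /\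
  (forall P Q : modc A, gproj P -> gproj Q ->
     natiso (Res P \of Res Q) (Res (nabla A (gtens P Q)))) /\
  (forall M P : modc A, gproj P ->
     natiso (Res P \of Ind M) (nabla A \of Res2 (Psi2DeltaPsiV c P) M)) /\
  (dualizing A -> categorifies_fock c /\ categorifies_fock_proj c).
Proof.
split=> [M N|]; first exact: Ind_comp.
split=> [P Q _ _|]; first exact: Res_comp.
split=> [M P pP|dA]; first exact: Res_Ind.
by split; [exact: categorifies|exact: categorifies_proj].
Qed.
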